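(* Given $T>0$, $R>0$, there are constants $\tau_R>0$ and $c_{R,T}>0$ ($c_{R,T}$ depending on $R,T$ but not on $\tau$) such that the following holds for all $\tau\in(0,\tau_R)$. Let $v(t)$ be the exact solution of the twisted KdV equation on $[0,T]$ with $v(0)=u_0$, let $v^n$, $n\ge0$, be the iterates of the resonance-based midpoint rule in the twisted variable with $v^0=u_0$, and let $t_n=n\tau$. If $\sup_{t\in[0,T]}\|v(t)\|_{H^5}<R/2$, then $$\|v(t_n)-v^n\|_{H^1}\le c_{R,T}\,\tau^2\qquad\text{for all }0\le n\le\lfloor T/\tau\rfloor .$$
   Context: $\mathbb{T}=\mathbb{R}/(2\pi\mathbb{Z})$; $H^r=H^r(\mathbb{T})$ is the periodic Sobolev space with norm $\|u\|_{H^r}^2=\sum_{m}\langle m\rangle^{2r}|\hat u_m|^2$, $\langle m\rangle=|m|$ ($m\neq0$), $\langle0\rangle=1$. All functions are real-valued with zero mean. $\partial_x^{-1}$ is the Fourier multiplier $\widehat{(\partial_x^{-1}v)}_k=\hat v_k/(ik)$ for $k\ne0$ and $0$ for $k=0$. Twisted KdV equation: $\partial_tv=\frac12e^{t\partial_x^3}\partial_x\big(e^{-t\partial_x^3}v\big)^2$, $v(0)=u_0$ (equivalently $v(t)=e^{t\partial_x^3}u(t)$ with $\partial_tu+\partial_x^3u=\frac12\partial_x(u^2)$, $u(0)=u_0$). Resonance-based midpoint rule (twisted variable), step size $\tau$, $t_n=n\tau$: $$v^{n+1}=v^n+\tfrac1{24}e^{(t_n+\tau)\partial_x^3}\Big(e^{-(t_n+\tau)\partial_x^3}\partial_x^{-1}(v^{n+1}+v^n)\Big)^2-\tfrac1{24}e^{t_n\partial_x^3}\Big(e^{-t_n\partial_x^3}\partial_x^{-1}(v^{n+1}+v^n)\Big)^2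 .$$ The implicit equation is solved by fixed-point iteration: $v^{n+1}$ is the limit of the iteration $w\mapsto v^n+\frac1{24}e^{(t_n+\tau)\partial_x^3}(e^{-(t_n+\tau)\partial_x^3}\partial_x^{-1}(w+v^n))^2-\frac1{24}e^{t_n\partial_x^3}(e^{-t_n\partial_x^3}\partial_x^{-1}(w+v^n))^2$ started at $w=v^n$ (which exists for sufficiently small $\tau$). *)

(* Defs.v *)
From HB Require Import structures.
From mathcomp Require Import all_boot all_order all_algebra.
From mathcomp Require Import complex.
From mathcomp Require Import all_classical all_reals all_analysis.

Set Implicit Arguments.
Unset Strict Implicit.
Unset Printing Implicit Defensive.

Import Order.TTheory GRing.Theory Num.Theory.
Import numFieldNormedType.Exports.

Local Open Scope classical_set_scope.
Local Open Scope ring_scope.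
Local Open Scope complex_scope.

(* Functions on the torus R/(2 pi Z) are 2 pi-periodic functions R -> R, taken
   up to almost-everywhere equality: the operators, norms and limits below
   depend on a function only through its Fourier coefficients. *)

Definition cis (R : realType) (y : R) : R[i] := cos y +i* sin y.

(* (1 / 2pi) \int_0^{2pi} u(x) e^{-ikx} dx, by real and imaginary parts *)
Definition fcoef (R : realType) (u : R -> R) (k : int) : R[i] :=
  ((2 * pi)^-1 *
     \int[lebesgue_measure]_(x in `[0%R, 2 * pi]) (u x * cos (k%:~R * x)))
  -i* ((2 * pi)^-1 *
     \int[lebesgue_measure]_(x in `[0%R, 2 * pi]) (u x * sin (k%:~R * x))).

Definition japanese (R : realType) (m : int) : R :=
  if m == 0 then 1 else `|m%:~R|.

Definition sqnormc (R : realType) (z : R[i]) : R :=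
  complex.Re z ^+ 2 + complex.Im z ^+ 2.

Definition hnorm (R : realType) (r : nat) (u : R -> R) : \bar R :=
  sqrte (\esum_(m in [set: int])
           (japanese R m ^+ (2 * r) * sqnormc (fcoef u m))%:E).

(* real-valued zero-mean functions in H^r(T) *)
Definition in_H (R : realType) (r : nat) (u : R -> R) : Prop :=
  [/\ forall x, u (x + 2 * pi) = u x,
      measurable_fun [set: R] u,
      (@lebesgue_measure R).-integrable `[0%R, 2 * pi]
        (fun x => ((u x) ^+ 2)%:E),
      \int[lebesgue_measure]_(x in `[0%R, 2 * pi]) u x = 0 &
      (hnorm r u < +oo)%E].

(* Fourier multiplier with symbol a: the function with Fourier series
   \sum_k a_k \hat u_k e^{ikx}, as the limit of its symmetric partial sums
   |k| <= N.  All the symbols used satisfy a_{-k} = conj(a_k), so that these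
   sums are real and taking the real part only changes their type. *)
Definition fmult (R : realType) (a : int -> R[i]) (u : R -> R) (x : R) : R :=
  lim ((fun N : nat =>
    complex.Re (\sum_(j < (2 * N).+1)
      (let k : int := j%:Z - N%:Z in
       a k * fcoef u k * cis (k%:~R * x)))) @ \oo).

Definition dx (R : realType) : (R -> R) -> (R -> R) :=
  fmult (fun k : int => 0 +i* k%:~R).

Definition dx_inv (R : realType) : (R -> R) -> (R -> R) :=
  fmult (fun k : int => if k == 0 then 0 else (0 +i* k%:~R)^-1).

(* e^{t dx^3}; the symbol is e^{t (ik)^3} = e^{-i t k^3} *)
Definition airy (R : realType) (t : R) : (R -> R) -> (R -> R) :=
  fmult (fun k : int => cis (- (t * k%:~R ^+ 3))).

Definition sqf (R : realType) (u : R -> R) : R -> R := fun x => u x ^+ 2.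

Definition tkdv_rhs (R : realType) (t : R) (u : R -> R) : R -> R :=
  fun x => 2^-1 * airy t (dx (sqf (airy (- t) u))) x.

(* Exact solution on [0, T] in H^5: at every time (one-sidedly at 0 and T) the
   time derivative exists as a limit in L^2 = H^0 and satisfies the equation. *)
Definition tkdv_solution (R : realType) (T : R) (u0 : R -> R)
    (v : R -> R -> R) : Prop :=
  [/\ v 0 = u0,
      forall t, t \in `[0, T] -> in_H 5 (v t) &
      forall t, t \in `[0, T] ->
        hnorm 0 (fun x => (s - t)^-1 * (v s x - v t x) - tkdv_rhs t (v t) x)
          @[s --> within `[0, T]%classic t^'] --> 0%E].

Definition rmr_map (R : realType) (tau t : R) (v w : R -> R) : R -> R :=
  fun x => v x
    + 24^-1 * airy (t + tau)
        (sqf (airy (- (t + tau)) (dx_inv (fun y => w y + v y)))) x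
    - 24^-1 * airy t (sqf (airy (- t) (dx_inv (fun y => w y + v y)))) x.

(* v' is the H^1-limit of the fixed-point iteration started at w = v *)
Definition rmr_step (R : realType) (tau t : R) (v v' : R -> R) : Prop :=
  in_H 1 v' /\
  hnorm 1 (fun x => iter m (rmr_map tau t v) v x - v' x) @[m --> \oo] --> 0%E.

(* v^0 = u0 and the first N steps of the resonance-based midpoint rule *)
Definition rmr_iterates (R : realType) (tau : R) (N : int) (u0 : R -> R)
    (vn : nat -> R -> R) : Prop :=
  vn 0%N = u0 /\
  forall n : nat, n%:Z < N -> rmr_step tau (n%:R * tau) (vn n) (vn n.+1).

(* Main.v *)
(* On Fourier coefficients one step of the rule is a bilinear map Phi with symbol
   (1/24) (e^{i theta (t + tau)} - e^{i theta t}) / (i j i (k - j)), where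
   theta t = -3 t k j (k - j).  As |e^{ia} - e^{ib}|^2 <= 2 |a - b|, this symbol
   is O(tau^{1/2}), so the fixed-point map is a contraction of H^1 and the error
   of a single step is a priori of the size of the previous one.

   Consistency: put m = (v(t) + v(t + tau)) / 2.  The rule replaces v(s) by m in
   the time integral of the nonlinearity, and v(s) - m changes sign up to
   O(tau^2) under the reflection s -> 2t + tau - s.  Comparing the integrand at s
   and at the reflected time gives a local error O(tau^3) in H^1 for v in H^5.

   Stability: with E the sum of the errors before and after a step and W the sum
   of the exact values, E^+ - E^- = 2 Phi(W, E) + Phi(E, E) + local error.  Pair
   this with E in H^1.  In <Phi(W, E), E> the derivative lost on E is recovered
   by symmetrising over the two factors E, which leaves O(tau) |E|^2; the cubic
   term is O(tau^{1/2}) |E|^3, that is O(tau) |E|^2 once |E| <= tau^{1/2}, which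
   the a priori bound provides.  Discrete Gronwall then gives O(tau^2). *)
Require Import Defs.
From HB Require Import structures.
From mathcomp Require Import all_boot all_order all_algebra.
From mathcomp Require Import complex ring lra zify.
From mathcomp Require Import all_classical all_reals all_analysis.
From mathcomp Require Import measurable_realfun.

Set Implicit Arguments.
Unset Strict Implicit.
Unset Printing Implicit Defensive.

Import Order.TTheory GRing.Theory Num.Theory.
Import numFieldNormedType.Exports.
Import Normc.

Local Open Scope classical_set_scope.
Local Open Scope ring_scope.
Local Open Scope complex_scope.

(** * Unordered sums over the integers *)

(** No time integral is ever formed. The equation is available only through one-sided time
    derivatives of Fourier coefficients, so every integral bound is a mean value inequality in H^r
    ([hb_mvt]). For consistency it is applied to the defect of a step stopped at time s,
    antisymmetrised under the reflection: the cancellation of signs then sits in its derivative.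

    Regularity is spent as follows. The time derivative of v lies in H^4. Its Lipschitz bound in
    time holds in H^2, since differentiating the phase costs k j (k - j). The derivative in the
    nonlinearity leads from there to H^1.

    The contraction alone yields only eps' <= 3 eps + O(tau^3), which cannot be iterated over T /
    tau steps. Used once, on an error already known to be O(tau^2), it suffices to tame the cubic
    term, and the energy inequality then restores a factor 1 + O(tau). The induction has to carry an
    H^1 bound on v^n as well, because the contraction, and with it the existence of the next
    iterate, depends on that bound. *)

Section Sums.
Variable R : realType.
Implicit Types (f g h : int -> R) (A B e : R) (s t : seq int).

(** The index window of the partial sums in [fmult], in the same enumeration, so that [big_Zs]
    identifies the two. *)
Definition Zs (N : nat) : seq int := [seq j%:Z - N%:Z | j <- iota 0 (2 * N).+1].

Lemma mem_Zs N (k : int) : (k \in Zs N) = (`|k| <= N)%N.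
Proof.
apply/mapP/idP => [[j]|kN].
  by rewrite mem_iota => /andP[_ jN] ->; lia.
exists (absz (k + N%:Z)%R); last by lia.
by rewrite mem_iota; lia.
Qed.

Lemma Zs_uniq N : uniq (Zs N).
Proof. by rewrite map_inj_uniq ?iota_uniq // => i j; lia. Qed.

Lemma Zs_sub s : exists N, {subset s <= Zs N}.
Proof.
elim: s => [|k s [N sN]]; first by exists 0%N.
exists (maxn N `|k|) => j; rewrite inE => /predU1P[->|/sN].
  by rewrite mem_Zs leq_maxr.
by rewrite !mem_Zs => /leq_trans; apply; rewrite leq_maxl.
Qed.

Lemma Zs_mono N M : (N <= M)%N -> {subset Zs N <= Zs M}.
Proof. by move=> NM k; rewrite !mem_Zs => /leq_trans; apply. Qed.

Lemma big_Zs (V : nmodType) (F : int -> V) N :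
  \sum_(k <- Zs N) F k = \sum_(j < (2 * N).+1) F (j%:Z - N%:Z).
Proof.
by rewrite big_map -(big_mkord xpredT (fun j => F (j%:Z - N%:Z))) /index_iota subn0.
Qed.

Lemma big_subseq (V : nmodType) (F : int -> V) s t :
  uniq s -> uniq t -> {subset t <= s} ->
  \sum_(k <- s) F k = \sum_(k <- t) F k + \sum_(k <- [seq k <- s | k \notin t]) F k.
Proof.
move=> us ut ts; rewrite (bigID (mem t)) /= big_filter; congr (_ + _).
rewrite -big_filter; apply: perm_big; apply: uniq_perm; rewrite ?filter_uniq //.
by move=> k; rewrite mem_filter /=; case: (boolP (k \in t)) => // /ts.
Qed.

(* Norms are replaced by predicates "every finite partial sum is at most B", so
   that no convergence has to be known before a bound can be stated. *)
Definition sumB f B := forall s, uniq s -> \sum_(k <- s) f k <= B.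

Definition summ f := exists B, sumB (fun k => `|f k|) B.

Lemma sumB_ge0 f B : sumB f B -> 0 <= B.
Proof. by move/(_ [::] isT); rewrite big_nil. Qed.

Lemma sumB_le f g A B : (forall k, f k <= g k) -> A <= B -> sumB g A -> sumB f B.
Proof.
move=> fg AB gA s us; apply: le_trans AB; apply: le_trans (gA s us).
by apply: ler_sum.
Qed.

Lemma sumB1 f B k : sumB f B -> f k <= B.
Proof. by move/(_ [:: k] isT); rewrite big_seq1. Qed.

Lemma sumBD f g A B : sumB f A -> sumB g B -> sumB (fun k => f k + g k) (A + B).
Proof. by move=> fA gB s us; rewrite big_split lerD //; [exact: fA|exact: gB]. Qed.

Lemma sumBZ f A c : 0 <= c -> sumB f A -> sumB (fun k => c * f k) (c * A).
Proof. by move=> c0 fA s us; rewrite -mulr_sumr ler_wpM2l// fA. Qed.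

Lemma sumB_inj f A (p : int -> int) : injective p -> sumB f A -> sumB (f \o p) A.
Proof.
move=> pi fA s us; rewrite -(big_map p xpredT f); apply: fA.
by rewrite map_inj_uniq.
Qed.

Lemma summ_le f g : (forall k, `|f k| <= `|g k|) -> summ g -> summ f.
Proof. by move=> fg [B gB]; exists B; exact: sumB_le gB. Qed.

Lemma summD f g : summ f -> summ g -> summ (fun k => f k + g k).
Proof.
move=> [A fA] [B gB]; exists (A + B).
by apply: sumB_le (sumBD fA gB) => // k; exact: ler_normD.
Qed.

Lemma summZ c f : summ f -> summ (fun k => c * f k).
Proof.
move=> [A fA]; exists (`|c| * A).
by apply: sumB_le (sumBZ _ fA) => // k; rewrite normrM.
Qed.

Lemma summN f : summ f -> summ (fun k => - f k).
Proof. by apply: summ_le => k; rewrite normrN. Qed.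

Lemma summB f g : summ f -> summ g -> summ (fun k => f k - g k).
Proof. by move=> sf sg; apply: summD => //; exact: summN. Qed.

Lemma summ_inj f (p : int -> int) : injective p -> summ f -> summ (f \o p).
Proof. by move=> pi [B fB]; exists B; exact: (sumB_inj pi fB). Qed.

(** A finite set whose sum of |f| comes within e of the supremum leaves at most e for any finite set
    disjoint from it. *)
Lemma summ_tail f : summ f -> forall e, 0 < e -> exists N, forall s, uniq s ->
  {in s, forall k, k \notin Zs N} -> \sum_(k <- s) `|f k| <= e.
Proof.
move=> [B fB] e e0.
pose S := [set r | exists2 s, uniq s & r = \sum_(k <- s) `|f k|].
have S0 : S 0 by exists [::] => //; rewrite big_nil.
have hS : has_sup S.
  by split; [exists 0 | exists B => _ [s us ->]; exact: fB].
have [_ [s0 us0 ->] hs0] := sup_adherent e0 hS.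
have [N s0N] := Zs_sub s0.
exists N => s us sN.
have u : uniq (s0 ++ s).
  rewrite cat_uniq us0 us andbT; apply/hasPn => k /sN /negP kN.
  by apply/negP => /s0N.
have : \sum_(k <- s0 ++ s) `|f k| <= sup S.
  by apply: ub_le_sup; [case: hS|exists (s0 ++ s)].
rewrite big_cat /=; move: hs0; lra.
Qed.

(** Symmetric windows are taken because [fmult] uses them. The value is meaningful under [summ],
    where [rsum_net] makes it independent of the exhaustion. *)
Definition rsum f : R := lim ((fun N => \sum_(k <- Zs N) f k) @ \oo).

Lemma rsum_cvg f : summ f ->
  (\sum_(k <- Zs N) f k) @[N --> \oo] --> rsum f.
Proof.
move=> sf; apply: cauchy_cvg; apply: cauchy_exP => e e0.
have e2 : 0 < e / 2 by lra.
have [N HN] := summ_tail sf e2.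
exists (\sum_(k <- Zs N) f k); exists N => // M /= NM.
rewrite /ball /= (big_subseq f (Zs_uniq M) (Zs_uniq N) (Zs_mono NM)).
rewrite opprD addrA subrr sub0r normrN.
apply: le_lt_trans (_ : e / 2 < e); last by lra.
apply: le_trans (ler_norm_sum _ _ _) _.
apply: HN; first by rewrite filter_uniq ?Zs_uniq.
by move=> k; rewrite mem_filter => /andP[].
Qed.

(** Symmetric windows are not preserved by reindexings such as j -> k - j. Convergence along all
    finite supersets is, and it yields both the algebra of sums and [rsum_bij]. *)
Lemma rsum_net f : summ f -> forall e, 0 < e -> exists N, forall s, uniq s ->
  {subset Zs N <= s} -> `|\sum_(k <- s) f k - rsum f| <= e.
Proof.
move=> sf e e0; have e2 : 0 < e / 2 by lra.
have [N HN] := summ_tail sf e2.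
have /cvgrPdist_le /(_ _ e2) [M _ HM] := rsum_cvg sf.
exists (maxn N M) => s us Ns.
rewrite (big_subseq f us (Zs_uniq (maxn N M)) Ns).
have := HM (maxn N M) (leq_maxr _ _).
have : `|\sum_(k <- [seq k <- s | k \notin Zs (maxn N M)]) f k| <= e / 2.
  apply: le_trans (ler_norm_sum _ _ _) _; apply: HN; first by rewrite filter_uniq.
  move=> k; rewrite mem_filter => /andP[+ _]; apply: contra.
  by apply: Zs_mono; rewrite leq_maxl.
by rewrite !ler_norml; lra.
Qed.

Lemma rsum_eqP f l : summ f -> (forall e, 0 < e -> exists N, forall s, uniq s ->
  {subset Zs N <= s} -> `|\sum_(k <- s) f k - l| <= e) -> rsum f = l.
Proof.
move=> sf H; apply/eqP; rewrite -subr_eq0 -normr_le0; apply/ler_addgt0Pr => e e0.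
have e2 : 0 < e / 2 by lra.
have [N HN] := rsum_net sf e2; have [M HM] := H _ e2.
have u := Zs_uniq (maxn N M).
have := HN _ u (Zs_mono (leq_maxl _ _)).
have := HM _ u (Zs_mono (leq_maxr _ _)).
by rewrite !ler_norml; lra.
Qed.

Lemma eq_rsum f g : f =1 g -> rsum f = rsum g.
Proof. by move=> /funext ->. Qed.

Lemma rsumD f g : summ f -> summ g -> rsum (fun k => f k + g k) = rsum f + rsum g.
Proof.
move=> sf sg; apply: rsum_eqP; first exact: summD.
move=> e e0; have e2 : 0 < e / 2 by lra.
have [N HN] := rsum_net sf e2; have [M HM] := rsum_net sg e2.
exists (maxn N M) => s us hs; rewrite big_split /=.
have := HN _ us (fun k hk => hs k (Zs_mono (leq_maxl _ _) hk)).
have := HM _ us (fun k hk => hs k (Zs_mono (leq_maxr _ _) hk)).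
by rewrite !ler_norml; lra.
Qed.

Lemma rsumZ c f : summ f -> rsum (fun k => c * f k) = c * rsum f.
Proof.
move=> sf; apply: rsum_eqP; first exact: summZ.
move=> e e0; have c0 : 0 < `|c| + 1 by have := normr_ge0 c; lra.
have [N HN] := rsum_net sf (divr_gt0 e0 c0).
exists N => s us hs; rewrite -mulr_sumr -mulrBr normrM.
have := HN s us hs; rewrite ler_pdivlMr //.
have := normr_ge0 c; have := normr_ge0 (\sum_(k <- s) f k - rsum f); nra.
Qed.

Lemma rsumN f : summ f -> rsum (fun k => - f k) = - rsum f.
Proof.
move=> sf; rewrite -mulN1r -rsumZ //; apply: eq_rsum => k; by rewrite mulN1r.
Qed.

Lemma rsumB f g : summ f -> summ g -> rsum (fun k => f k - g k) = rsum f - rsum g.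
Proof. by move=> sf sg; rewrite rsumD ?rsumN //; exact: summN. Qed.

Lemma rsum_ge0 f : (forall k, 0 <= f k) -> summ f -> 0 <= rsum f.
Proof.
move=> f0 sf; apply/ler_addgt0Pr => e e0; have [N HN] := rsum_net sf e0.
have := HN _ (Zs_uniq N) (fun=> id); rewrite ler_norml.
have : 0 <= \sum_(k <- Zs N) f k by apply: sumr_ge0.
lra.
Qed.

Lemma rsum_le f g : (forall k, f k <= g k) -> summ f -> summ g -> rsum f <= rsum g.
Proof.
move=> fg sf sg; rewrite -subr_ge0 -rsumB //; apply: rsum_ge0; last exact: summB.
by move=> k; rewrite subr_ge0.
Qed.

Lemma sumB_summ f B : (forall k, 0 <= f k) -> sumB f B -> summ f.
Proof. by move=> f0 fB; exists B; apply: sumB_le fB => // k; rewrite ger0_norm. Qed.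

Lemma rsum_leB f B : summ f -> sumB f B -> rsum f <= B.
Proof.
move=> sf fB; apply/ler_addgt0Pr => e e0; have [N HN] := rsum_net sf e0.
have := HN _ (Zs_uniq N) (fun=> id); rewrite ler_norml.
have := fB _ (Zs_uniq N); lra.
Qed.

Lemma sum_le_rsum f s : (forall k, 0 <= f k) -> summ f -> uniq s ->
  \sum_(k <- s) f k <= rsum f.
Proof.
move=> f0 sf us; apply/ler_addgt0Pr => e e0; have [N HN] := rsum_net sf e0.
have u := undup_uniq (s ++ Zs N).
have := HN _ u; rewrite ler_norml => /(_ _)/andP[].
  by move=> k kN; rewrite mem_undup mem_cat kN orbT.
have ss : {subset s <= undup (s ++ Zs N)}.
  by move=> k ks; rewrite mem_undup mem_cat ks.
rewrite (big_subseq f u us ss).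
set a := \sum_(k <- s) _; set b := \sum_(k <- seq.filter _ _) _.
have : 0 <= b by apply: sumr_ge0.
lra.
Qed.

Lemma ler_norm_rsum f : summ f -> `|rsum f| <= rsum (fun k => `|f k|).
Proof.
move=> sf; have sn : summ (fun k => `|f k|) by apply: summ_le sf => k; rewrite normr_id.
rewrite ler_norml -rsumN //; apply/andP; split; apply: rsum_le => //.
- by move=> k; rewrite lerNl -normrN ler_norm.
- exact: summN.
- by move=> k; exact: ler_norm.
Qed.

Lemma norm_rsum_leB f B : sumB (fun k => `|f k|) B -> `|rsum f| <= B.
Proof.
move=> fB; have sf : summ f by exists B.
apply: le_trans (ler_norm_rsum sf) _; apply: rsum_leB => //.
by apply: sumB_summ fB.
Qed.

Lemma rsum_bij f (p q : int -> int) : cancel p q -> cancel q p -> summ f ->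
  rsum (f \o p) = rsum f.
Proof.
move=> pq qp sf; apply: rsum_eqP; first exact: summ_inj (can_inj pq) sf.
move=> e e0; have [N HN] := rsum_net sf e0.
have [M HM] := Zs_sub (map q (Zs N)).
exists M => s us Ms; rewrite -(big_map p xpredT f); apply: HN.
  by rewrite map_inj_uniq //; exact: can_inj pq.
move=> k kN; apply/mapP; exists (q k); last by rewrite qp.
by apply/Ms/HM/map_f.
Qed.

Lemma summ_sum (I : Type) (r : seq I) (F : I -> int -> R) :
  (forall i, summ (F i)) -> summ (fun k => \sum_(i <- r) F i k).
Proof.
move=> sF; elim: r => [|i r IH].
  by exists 0 => s us; rewrite big1 // => k _; rewrite big_nil normr0.
have -> : (fun k => \sum_(j <- i :: r) F j k) = (fun k => F i k + \sum_(j <- r) F j k).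
  by apply/funext => k; rewrite big_cons.
exact: summD.
Qed.

Lemma rsum_fin f N : (forall k, k \notin Zs N -> f k = 0) ->
  rsum f = \sum_(k <- Zs N) f k.
Proof.
move=> fN; have H s : uniq s -> {subset Zs N <= s} ->
    \sum_(k <- s) f k = \sum_(k <- Zs N) f k.
  move=> us hs; rewrite (big_subseq f us (Zs_uniq N) hs) [X in _ + X]big_seq_cond.
  rewrite [X in _ + X]big1 ?addr0 // => k /andP[].
  by rewrite mem_filter => /andP[/fN].
have sf : summ f.
  exists (\sum_(k <- Zs N) `|f k|) => s us.
  have u := undup_uniq (s ++ Zs N).
  have ss : {subset s <= undup (s ++ Zs N)} by move=> k ks; rewrite mem_undup mem_cat ks.
  have sn : {subset Zs N <= undup (s ++ Zs N)} by move=> k ks; rewrite mem_undup mem_cat ks orbT.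
  have <- : \sum_(k <- undup (s ++ Zs N)) `|f k| = \sum_(k <- Zs N) `|f k|.
    rewrite (big_subseq _ u (Zs_uniq N) sn) [X in _ + X]big_seq_cond.
    rewrite [X in _ + X]big1 ?addr0 // => k /andP[].
    by rewrite mem_filter => /andP[/fN ->]; rewrite normr0.
  by rewrite (big_subseq (fun k => `|f k|) u us ss) lerDl sumr_ge0.
apply: rsum_eqP => // e e0; exists N => s us hs.
by rewrite H // subrr normr0 ltW.
Qed.

Lemma rsum_sum (I : Type) (r : seq I) (F : I -> int -> R) :
  (forall i, summ (F i)) ->
  rsum (fun k => \sum_(i <- r) F i k) = \sum_(i <- r) rsum (F i).
Proof.
move=> sF; elim: r => [|i r IH].
  rewrite big_nil (_ : (fun k => _) = fun=> 0); last by apply/funext => k; rewrite big_nil.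
  by rewrite (rsum_fin (N := 0)) // big1.
rewrite big_cons -IH -rsumD //; last exact: summ_sum.
by apply: eq_rsum => k; rewrite big_cons.
Qed.

End Sums.

(** * Absolutely convergent complex series *)

Section Csum.
Variable R : realType.
Local Notation C := R[i].
Implicit Types (f g h : int -> C) (A B e : R) (s t : seq int) (z : C).

Lemma normc_ge0 z : 0 <= normc z.
Proof. by case: z => a b; exact: sqrtr_ge0. Qed.

Lemma sqr_le_le (a b : R) : 0 <= b -> a ^+ 2 <= b ^+ 2 -> a <= b.
Proof. by move=> b0; rewrite !expr2 => h; rewrite leNgt; apply/negP => ?; nra. Qed.

Lemma sqnormcE z : sqnormc z = normc z ^+ 2.
Proof. by case: z => a b /=; rewrite sqr_sqrtr // addr_ge0 ?sqr_ge0. Qed.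

Lemma normc_Re z : `|complex.Re z| <= normc z.
Proof.
apply: sqr_le_le; first exact: normc_ge0.
by rewrite -sqnormcE /sqnormc real_normK ?num_real // lerDl sqr_ge0.
Qed.

Lemma normc_Im z : `|complex.Im z| <= normc z.
Proof.
apply: sqr_le_le; first exact: normc_ge0.
by rewrite -sqnormcE /sqnormc real_normK ?num_real // lerDr sqr_ge0.
Qed.

Lemma normc_leD z : normc z <= `|complex.Re z| + `|complex.Im z|.
Proof.
apply: sqr_le_le; first by rewrite addr_ge0.
rewrite -sqnormcE /sqnormc sqrrD !real_normK ?num_real //.
by rewrite addrAC lerDl mulrn_wge0 ?mulr_ge0.
Qed.

Lemma normcR (a : R) : normc (a%:C) = `|a|.
Proof. by rewrite /normc /= expr0n /= addr0 sqrtr_sqr. Qed.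

Lemma normcB z1 z2 : normc (z1 - z2) = normc (z2 - z1).
Proof. by rewrite -normcN opprB. Qed.

Lemma normc_conj z : normc (conjc z) = normc z.
Proof. by case: z => a b /=; rewrite sqrrN. Qed.

Lemma ReD z1 z2 : complex.Re (z1 + z2) = complex.Re z1 + complex.Re z2.
Proof. by case: z1 z2 => ? ? []. Qed.

Lemma ImD z1 z2 : complex.Im (z1 + z2) = complex.Im z1 + complex.Im z2.
Proof. by case: z1 z2 => ? ? []. Qed.

Lemma ReN z : complex.Re (- z) = - complex.Re z.
Proof. by case: z. Qed.

Lemma ImN z : complex.Im (- z) = - complex.Im z.
Proof. by case: z. Qed.

Lemma Re_sum (I : Type) (r : seq I) (F : I -> C) :
  complex.Re (\sum_(i <- r) F i) = \sum_(i <- r) complex.Re (F i).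
Proof. exact: (big_morph _ ReD). Qed.

Lemma Im_sum (I : Type) (r : seq I) (F : I -> C) :
  complex.Im (\sum_(i <- r) F i) = \sum_(i <- r) complex.Im (F i).
Proof. exact: (big_morph _ ImD). Qed.

Lemma normc_sum (I : Type) (r : seq I) (F : I -> C) :
  normc (\sum_(i <- r) F i) <= \sum_(i <- r) normc (F i).
Proof.
elim: r => [|i r IH]; first by rewrite !big_nil normc0.
by rewrite !big_cons; apply: le_trans (le_normcD _ _) _; rewrite lerD2l.
Qed.

Definition summC f := summ (fun k => normc (f k)).

Definition csum f : C := rsum (fun k => complex.Re (f k)) +i* rsum (fun k => complex.Im (f k)).

Lemma summC_Re f : summC f -> summ (fun k => complex.Re (f k)).
Proof. by apply: summ_le => k; rewrite [leRHS]ger0_norm ?normc_ge0 ?normc_Re. Qed.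

Lemma summC_Im f : summC f -> summ (fun k => complex.Im (f k)).
Proof. by apply: summ_le => k; rewrite [leRHS]ger0_norm ?normc_ge0 ?normc_Im. Qed.

Lemma summC_le f (g : int -> R) : (forall k, normc (f k) <= g k) -> summ g -> summC f.
Proof.
by move=> fg; apply: summ_le => k; rewrite ger0_norm ?normc_ge0 // (le_trans (fg k)) // ler_norm.
Qed.

Lemma eq_csum f g : f =1 g -> csum f = csum g.
Proof. by move=> /funext ->. Qed.

Lemma summCD f g : summC f -> summC g -> summC (fun k => f k + g k).
Proof. by move=> sf sg; apply: summC_le (summD sf sg) => k; exact: le_normcD. Qed.

Lemma summCZ c f : summC f -> summC (fun k => c * f k).
Proof. by move=> sf; apply: summC_le (summZ (normc c) sf) => k; rewrite normcM. Qed.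

Lemma summCN f : summC f -> summC (fun k => - f k).
Proof. by move=> sf; apply: summC_le sf => k; rewrite normcN. Qed.

Lemma summCB f g : summC f -> summC g -> summC (fun k => f k - g k).
Proof. by move=> sf sg; apply: summCD => //; exact: summCN. Qed.

Lemma csum_net f : summC f -> forall e, 0 < e -> exists N, forall s, uniq s ->
  {subset Zs N <= s} -> normc (\sum_(k <- s) f k - csum f) <= e.
Proof.
move=> sf e e0; have e2 : 0 < e / 2 by lra.
have [N HN] := rsum_net (summC_Re sf) e2; have [M HM] := rsum_net (summC_Im sf) e2.
exists (maxn N M) => s us hs.
have := HN _ us (fun k hk => hs k (Zs_mono (leq_maxl _ _) hk)).
have := HM _ us (fun k hk => hs k (Zs_mono (leq_maxr _ _) hk)).
rewrite -Re_sum -Im_sum => h1 h2; apply: le_trans (normc_leD _) _.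
by rewrite ReD ImD ReN ImN /=; lra.
Qed.

Lemma csum_cvg f : summC f -> forall e, 0 < e -> exists N, forall M, (N <= M)%N ->
  normc (\sum_(k <- Zs M) f k - csum f) <= e.
Proof.
move=> sf e e0; have [N HN] := csum_net sf e0; exists N => M NM.
by apply: HN; [exact: Zs_uniq|exact: Zs_mono].
Qed.

Lemma normc_eq0_le z : (forall e, 0 < e -> normc z <= e) -> z = 0.
Proof.
move=> H; apply: eq0_normc; apply/eqP; rewrite eq_le normc_ge0 andbT.
by apply/ler_addgt0Pr => e e0; rewrite add0r H.
Qed.

(** Bounding real and imaginary parts separately would cost a constant; the finite triangle
    inequality, passed to the limit, keeps the factor 1. *)
Lemma csum_norm f : summC f -> normc (csum f) <= rsum (fun k => normc (f k)).
Proof.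
move=> sf; apply/ler_addgt0Pr => e e0.
have [N HN] := csum_net sf e0; have u := Zs_uniq N.
have h := HN _ u (fun=> id).
rewrite -[csum f](subrK (\sum_(k <- Zs N) f k)) addrC.
apply: le_trans (le_normcD _ _) _; rewrite [normc (csum f - _)]normcB lerD //.
apply: le_trans (normc_sum _ _) _; apply: sum_le_rsum => // k; exact: normc_ge0.
Qed.

Lemma csumD f g : summC f -> summC g -> csum (fun k => f k + g k) = csum f + csum g.
Proof.
move=> sf sg; rewrite /csum -[RHS]/(Complex _ _); congr Complex; rewrite -rsumD;
  do ?[exact: summC_Re|exact: summC_Im]; apply: eq_rsum => k; [exact: ReD|exact: ImD].
Qed.

Lemma csumZ c f : summC f -> csum (fun k => c * f k) = c * csum f.
Proof.
move=> sf; have sr := summC_Re sf; have si := summC_Im sf.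
case: c => a b; rewrite /csum -[RHS]/(Complex _ _); congr Complex.
  rewrite -!rsumZ // -rsumB; [|exact: summZ|exact: summZ].
  by apply: eq_rsum => k; case: (f k).
rewrite -!rsumZ // -rsumD; [|exact: summZ|exact: summZ].
by apply: eq_rsum => k; case: (f k).
Qed.

Lemma csumN f : summC f -> csum (fun k => - f k) = - csum f.
Proof.
by move=> sf; rewrite -mulN1r -csumZ //; apply: eq_csum => k; rewrite mulN1r.
Qed.

Lemma csumB f g : summC f -> summC g -> csum (fun k => f k - g k) = csum f - csum g.
Proof. by move=> sf sg; rewrite csumD ?csumN //; exact: summCN. Qed.

Lemma csum_bij f (p q : int -> int) : cancel p q -> cancel q p -> summC f ->
  csum (f \o p) = csum f.
Proof.
move=> pq qp sf; rewrite /csum.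
rewrite -(rsum_bij pq qp (summC_Re sf)) -(rsum_bij pq qp (summC_Im sf)).
by congr Complex; exact: eq_rsum.
Qed.

Lemma csum_fin f N : (forall k, k \notin Zs N -> f k = 0) ->
  csum f = \sum_(k <- Zs N) f k.
Proof.
move=> fN; rewrite /csum (rsum_fin (N := N)); last by move=> k /fN ->.
rewrite (rsum_fin (N := N) (f := fun k => complex.Im (f k))); last by move=> k /fN ->.
by rewrite -Re_sum -Im_sum; case: (\sum_(k <- Zs N) f k).
Qed.

Lemma csum_normB f B : sumB (fun k => normc (f k)) B -> normc (csum f) <= B.
Proof.
move=> fB; have sf : summC f by apply: sumB_summ fB => k; exact: normc_ge0.
by apply: le_trans (csum_norm sf) _; apply: rsum_leB.
Qed.

End Csum.

(** * Square-summable sequences *)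

Section L2.
Variable R : realType.
Implicit Types (f g h : int -> R) (A B e : R) (s t : seq int).

Lemma sum_CS (I : Type) (r : seq I) (f g : I -> R) :
  (\sum_(i <- r) f i * g i) ^+ 2 <= (\sum_(i <- r) f i ^+ 2) * (\sum_(i <- r) g i ^+ 2).
Proof.
elim: r => [|i r IH]; first by rewrite !big_nil expr0n mul0r.
rewrite !big_cons; move: IH.
have : 0 <= \sum_(i <- r) f i ^+ 2 by apply: sumr_ge0 => j _; exact: sqr_ge0.
have : 0 <= \sum_(i <- r) g i ^+ 2 by apply: sumr_ge0 => j _; exact: sqr_ge0.
set S := \sum_(i <- r) _ * _; set F := \sum_(i <- r) f i ^+ 2.
set G := \sum_(i <- r) _; set a := f i; set b := g i => G0 F0 SFG.
(* The cross term: S^2 <= F G gives (2 S a b)^2 <= 4 (F b^2) (G a^2) <= (F b^2 + G a^2)^2. *)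
have h : 2 * (S * (a * b)) <= F * b ^+ 2 + G * a ^+ 2.
  apply: sqr_le_le.
    by apply: addr_ge0; apply: mulr_ge0 => //; exact: sqr_ge0.
  have := ler_wpM2r (sqr_ge0 (a * b)) SFG.
  have := sqr_ge0 (F * b ^+ 2 - G * a ^+ 2); lra.
lra.
Qed.

Lemma sum_CS_le (I : Type) (r : seq I) (f g : I -> R) A B : 0 <= A -> 0 <= B ->
  \sum_(i <- r) f i ^+ 2 <= A ^+ 2 -> \sum_(i <- r) g i ^+ 2 <= B ^+ 2 ->
  \sum_(i <- r) f i * g i <= A * B.
Proof.
move=> A0 B0 fA gB; apply: sqr_le_le; first exact: mulr_ge0.
apply: le_trans (sum_CS _ _ _) _; rewrite exprMn; apply: ler_pM => //;
  by apply: sumr_ge0 => j _; exact: sqr_ge0.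
Qed.

Definition l2 f B := 0 <= B /\ sumB (fun k => f k ^+ 2) (B ^+ 2).

Lemma l2_le f g A B : (forall k, `|f k| <= g k) -> A <= B -> l2 g A -> l2 f B.
Proof.
move=> fg AB [A0 gA]; split; first exact: le_trans AB.
apply: sumB_le gA; last by rewrite ler_sqr // nnegrE // (le_trans A0).
by move=> k; rewrite -real_normK ?num_real // ler_sqr ?nnegrE // (le_trans _ (fg k)).
Qed.

Lemma l2_point f B k : l2 f B -> `|f k| <= B.
Proof.
move=> [B0 /(sumB1 k)]; rewrite -real_normK ?num_real // ler_sqr ?nnegrE //.
Qed.

Lemma l2_ge0 f B : l2 f B -> 0 <= B.
Proof. by case. Qed.

Lemma l2D f g A B : l2 f A -> l2 g B -> l2 (fun k => f k + g k) (A + B).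
Proof.
move=> [A0 fA] [B0 gB]; split; first exact: addr_ge0.
move=> s us; have := fA s us; have := gB s us => gs fs.
have := sum_CS_le A0 B0 fs gs.
have -> : \sum_(k <- s) (f k + g k) ^+ 2 = \sum_(k <- s) f k ^+ 2 +
    2 * (\sum_(k <- s) f k * g k) + \sum_(k <- s) g k ^+ 2.
  by rewrite mulr_sumr -!big_split; apply: eq_bigr => k _ /=; ring.
lra.
Qed.

Lemma l2Z c f A : 0 <= c -> l2 f A -> l2 (fun k => c * f k) (c * A).
Proof.
move=> c0 [A0 fA]; split; first exact: mulr_ge0.
rewrite exprMn; apply: sumB_le (sumBZ (sqr_ge0 c) fA) => // k; by rewrite exprMn.
Qed.

Lemma l2_inj f A (p : int -> int) : injective p -> l2 f A -> l2 (f \o p) A.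
Proof. by move=> pi [A0 fA]; split => //; exact: (sumB_inj pi fA). Qed.

(** Only finite sums enter [l2], and each of them passes to the pointwise limit. *)
Lemma l2_fatou (F : nat -> int -> R) f B : (forall n, l2 (F n) B) ->
  (forall k, F n k @[n --> \oo] --> f k) -> l2 f B.
Proof.
move=> FB Ff; split; first by case: (FB 0%N).
move=> s us.
have cv : \sum_(k <- s) F n k ^+ 2 @[n --> \oo] --> \sum_(k <- s) f k ^+ 2.
  elim: s {us} => [|k s IH].
    by rewrite (_ : (fun n => _) = fun=> 0) ?big_nil; [exact: cvg_cst|apply/funext => n; rewrite big_nil].
  rewrite (_ : (fun n => _) = fun n => F n k * F n k + \sum_(j <- s) F n j ^+ 2); last first.
    by apply/funext => n; rewrite big_cons expr2.
  by rewrite big_cons expr2; apply: cvgD => //; apply: cvgM.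
rewrite -(cvg_lim _ cv) //; apply: limr_le; first by apply/cvg_ex; eexists; exact: cv.
by near=> n; case: (FB n) => _ /(_ s us).
Unshelve. all: by end_near. Qed.

Lemma summM f g A B : l2 f A -> l2 g B -> summ (fun k => f k * g k).
Proof.
move=> [A0 fA] [B0 gB]; exists (A * B) => s us.
rewrite (eq_bigr (fun k => `|f k| * `|g k|)) => [|k _]; last exact: normrM.
apply: sum_CS_le => //; rewrite (eq_bigr _ (fun k _ => real_normK (num_real _))).
  exact: fA.
exact: gB.
Qed.

Lemma rsum_CS f g A B : l2 f A -> l2 g B -> `|rsum (fun k => f k * g k)| <= A * B.
Proof.
move=> [A0 fA] [B0 gB]; apply: norm_rsum_leB => s us.
rewrite (eq_bigr (fun k => `|f k| * `|g k|)) => [|k _]; last exact: normrM.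
apply: sum_CS_le => //; rewrite (eq_bigr _ (fun k _ => real_normK (num_real _))).
  exact: fA.
exact: gB.
Qed.

Definition convol f g (k : int) := rsum (fun j => f j * g (k - j)).

Lemma subrKi (k : int) : involutive (fun j : int => k - j).
Proof. by move=> j; rewrite opprB addrCA subrr addr0. Qed.

Lemma convol_summ f g A B k : (forall k, 0 <= f k) -> sumB f A ->
  (forall k, `|g k| <= B) -> summ (fun j => f j * g (k - j)).
Proof.
move=> f0 fA gB; apply: summ_le (summZ B (sumB_summ f0 fA)) => j.
rewrite !normrM mulrC ler_wpM2r //; apply: le_trans (gB _) _; exact: ler_norm.
Qed.

Lemma convolC f g k : summ (fun j => f j * g (k - j)) -> convol f g k = convol g f k.
Proof.
move=> s; rewrite /convol -(rsum_bij (subrKi k) (subrKi k) s).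
by apply: eq_rsum => j /=; rewrite subrKi mulrC.
Qed.

(** Cauchy-Schwarz with weight f bounds the square of the convolution at k by A times the sum over j
    of f j (g (k - j))^2; summing over k inside then costs B^2 for each j. *)
Lemma young f g A B : (forall k, 0 <= f k) -> (forall k, 0 <= g k) ->
  sumB f A -> l2 g B -> l2 (convol f g) (A * B).
Proof.
move=> f0 g0 fA gB; have A0 := sumB_ge0 fA; have B0 := l2_ge0 gB.
split; first exact: mulr_ge0.
have sf := sumB_summ f0 fA.
have gb k : `|g k| <= B by exact: l2_point.
have gb2 k : `|g k ^+ 2| <= B ^+ 2 by rewrite normrX ler_sqr ?nnegrE.
have s1 k := convol_summ k f0 fA gb.
have s2 k := convol_summ k f0 fA gb2.
have key k : convol f g k ^+ 2 <= A * rsum (fun j => f j * g (k - j) ^+ 2).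
  set Z := convol f g k.
  have Z0 : 0 <= Z by apply: rsum_ge0 => // j; rewrite mulr_ge0.
  have [A00|Agt0] := eqVneq A 0.
    suff : Z <= 0 by rewrite A00 mul0r => Zle; rewrite (le_anti (introT andP (conj Zle Z0))) expr0n.
    apply: rsum_leB => // s us; rewrite big1 // => j _.
    have := sumB1 j fA; rewrite A00 => fj.
    by rewrite (le_anti (introT andP (conj fj (f0 j)))) mul0r.
  have {}A0 : 0 < A by rewrite lt_def Agt0.
  (* Weighted Cauchy-Schwarz as positivity of a variance about Z / A: expanding gives q - 2 Z^2 / A
     + (Z / A)^2 W >= 0, where W is the sum of f and W <= A. The division by A is why A = 0 was
     treated apart. *)
  have : 0 <= rsum (fun j => f j * (g (k - j) - Z / A) ^+ 2).
    apply: rsum_ge0 => [j|]; first by rewrite mulr_ge0 ?sqr_ge0.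
    have -> : (fun j => f j * (g (k - j) - Z / A) ^+ 2) = (fun j => f j * g (k - j) ^+ 2
      + ((- 2 * (Z / A)) * (f j * g (k - j)) + (Z / A) ^+ 2 * f j)).
      by apply/funext => j; ring.
    by apply: summD => //; apply: summD; exact: summZ.
  have -> : (fun j => f j * (g (k - j) - Z / A) ^+ 2) = (fun j => f j * g (k - j) ^+ 2
      + ((- 2 * (Z / A)) * (f j * g (k - j)) + (Z / A) ^+ 2 * f j)).
    by apply/funext => j; ring.
  have sZ1 : summ (fun j => - 2 * (Z / A) * (f j * g (k - j))) by exact: summZ.
  have sZ2 : summ (fun j => (Z / A) ^+ 2 * f j) by exact: summZ.
  rewrite rsumD //; last exact: summD.
  rewrite rsumD // !rsumZ // -[rsum (fun j => f j * g (k - j))]/Z.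
  have rA : rsum f <= A by exact: rsum_leB.
  have := ler_wpM2l (sqr_ge0 (Z / A)) rA.
  set q := rsum (fun j => f j * g (k - j) ^+ 2); set W := rsum f.
  move=> h1 h2; have h3 : Z ^+ 2 / A <= q.
    have e1 : (Z / A) ^+ 2 * A = Z ^+ 2 / A by field; lra.
    have e2 : - 2 * (Z / A) * Z = - 2 * (Z ^+ 2 / A) by field; lra.
    by move: h1 h2; rewrite e1 e2; lra.
  by rewrite -ler_pdivrMl // mulrC.
move=> s us; apply: (@le_trans _ _ (\sum_(k <- s) A * rsum (fun j => f j * g (k - j) ^+ 2))).
  by apply: ler_sum.
rewrite -mulr_sumr -rsum_sum // exprMn expr2 -mulrA ler_wpM2l //.
apply: rsum_leB; first exact: summ_sum.
apply: (@sumB_le _ _ (fun j => B ^+ 2 * f j) (B ^+ 2 * A)); last 1 first.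
- exact: sumBZ (sqr_ge0 B) fA.
- move=> j; rewrite -mulr_sumr mulrC ler_wpM2r //.
  case: gB => _ gB; have inj : injective (fun k : int => k - j) by move=> a b; lia.
  exact: (sumB_inj inj gB).
- by rewrite mulrC.
Qed.

End L2.

(** * Sobolev weights and convolution estimates *)

Section Weights.
Variable R : realType.
Local Notation C := R[i].
Local Notation w := (japanese R).
Implicit Types (f g : int -> R) (x y z : int -> C) (A B e : R) (s : seq int).

Lemma w_int (k : int) : k != 0 -> w k = `|k%:~R|.
Proof. by rewrite /japanese => /negPf ->. Qed.

Lemma abs_w (k : int) : `|k%:~R : R| <= w k.
Proof. by rewrite /japanese; case: eqVneq => // ->; rewrite normr0. Qed.

Lemma w_ge1 (k : int) : 1 <= w k.
Proof.
rewrite /japanese; case: eqVneq => // k0.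
by rewrite -intr_norm -[leLHS]/(1%:~R) ler_int; lia.
Qed.

Lemma w_gt0 (k : int) : 0 < w k.
Proof. exact: lt_le_trans (w_ge1 k). Qed.

Lemma w_ge0 (k : int) : 0 <= w k.
Proof. exact: ltW (w_gt0 k). Qed.

Lemma wX_ge0 (k : int) r : 0 <= w k ^+ r.
Proof. by rewrite exprn_ge0 ?w_ge0. Qed.

Lemma wX_ge1 (k : int) r : 1 <= w k ^+ r.
Proof. by rewrite exprn_ege1 ?w_ge1. Qed.

Lemma w_opp (k : int) : w (- k) = w k.
Proof. by rewrite /japanese oppr_eq0 rmorphN normrN. Qed.

Lemma w_leD (k j : int) : w k <= w j + w (k - j).
Proof.
have [->|k0] := eqVneq k 0.
  by rewrite [leLHS]/japanese eqxx; apply: le_trans (w_ge1 j) _; rewrite lerDl w_ge0.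
rewrite [leLHS]w_int // -[in leLHS](subrK j k) rmorphD addrC.
by apply: le_trans (ler_normD _ _) _; apply: lerD; exact: abs_w.
Qed.

Lemma w_le2M (k j : int) : w k <= 2 * (w j * w (k - j)).
Proof.
by apply: le_trans (w_leD k j) _; have := w_ge1 j; have := w_ge1 (k - j); nra.
Qed.

Lemma wX_leD n (k j : int) : w k ^+ n <= 2 ^+ n * (w j ^+ n + w (k - j) ^+ n).
Proof.
have h : w k <= 2 * Num.max (w j) (w (k - j)).
  by apply: le_trans (w_leD k j) _; rewrite mulr_natl mulr2n lerD // le_max lexx ?orbT.
apply: (@le_trans _ _ ((2 * Num.max (w j) (w (k - j))) ^+ n)).
  by apply: lerXn2r => //; rewrite nnegrE ?w_ge0 // mulr_ge0 // le_max w_ge0.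
rewrite exprMn ler_wpM2l ?exprn_ge0 //; case: (leP (w j) (w (k - j))) => _; [rewrite lerDr|rewrite lerDl]; exact: wX_ge0.
Qed.

Lemma big_ZsS (F : int -> R) N :
  \sum_(k <- Zs N.+1) F k = F N.+1%:Z + (F (- N.+1%:Z) + \sum_(k <- Zs N) F k).
Proof.
have -> : F N.+1%:Z + (F (- N.+1%:Z) + \sum_(k <- Zs N) F k) =
    \sum_(k <- [:: N.+1%:Z, - N.+1%:Z & Zs N]) F k by rewrite !big_cons.
apply: perm_big; apply: uniq_perm; first exact: Zs_uniq.
  by rewrite 2!cons_uniq Zs_uniq in_cons !mem_Zs !negb_or; apply/and3P; split; apply/negP; lia.
by move=> k; rewrite mem_Zs 2!in_cons mem_Zs; lia.
Qed.

Lemma w_l2 : l2 (fun k => (w k)^-1) 3.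
Proof.
split => // s us; have [N sN] := Zs_sub s.
(* Telescoping, as 2 / (n + 2)^2 <= 2 / (n + 1) - 2 / (n + 2). The sum stays below 5, and 3 is a
   convenient number whose square exceeds 5. *)
have H n : \sum_(k <- Zs n.+1) (w k)^-1 ^+ 2 <= 5 - 2 / n.+1%:R.
  elim: n => [|n IH].
    rewrite !big_ZsS /Zs /= big_seq1 /japanese /=.
    by rewrite !rmorphN !rmorph1 !normrN !normr1 !invr1 !expr1n; lra.
  rewrite big_ZsS w_opp w_int // -pmulrn gtr0_norm ?ltr0Sn //.
  apply: (@le_trans _ _ (2 / n.+2%:R ^+ 2 + (5 - 2 / n.+1%:R))).
    by rewrite addrA lerD // -exprVn -mulr2n mulr_natl.
  have a0 : 0 < n.+1%:R :> R by rewrite ltr0Sn.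
  rewrite -[n.+2%:R]natr1; set a := n.+1%:R : R; rewrite -subr_ge0.
  have -> : 5 - 2 / (a + 1) - (2 / (a + 1) ^+ 2 + (5 - 2 / a)) = 2 / (a * (a + 1) ^+ 2).
    by field; rewrite !gt_eqF //; rewrite /a; lra.
  by rewrite divr_ge0 // mulr_ge0 ?sqr_ge0 // ltW.
have sN1 : {subset s <= Zs N.+1} by move=> k /sN; apply: Zs_mono.
apply: (@le_trans _ _ (\sum_(k <- Zs N.+1) (w k)^-1 ^+ 2)).
  rewrite (big_subseq _ (Zs_uniq _) us sN1) lerDl sumr_ge0 // => k _; exact: sqr_ge0.
apply: le_trans (H N) _; have : 0 <= 2 / N.+1%:R :> R by rewrite divr_ge0.
by set q := 2 / _; rewrite expr2; lra.
Qed.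

(** Cauchy-Schwarz against the weights of [w_l2]: one derivative in l^2 buys absolute summability.
    The factors 3 in the convolution bounds come from here. *)
Lemma l1_of_l2 f A : l2 (fun k => w k * f k) A -> sumB (fun k => `|f k|) (3 * A).
Proof.
move=> [A0 fA] s us.
rewrite (eq_bigr (fun k => (w k)^-1 * `|w k * f k|)); last first.
  by move=> k _; rewrite normrM ger0_norm ?w_ge0 // mulKf ?gt_eqF ?w_gt0.
apply: sum_CS_le => //; first by case: w_l2 => _; apply.
by rewrite (eq_bigr _ (fun k _ => real_normK (num_real _))); exact: fA.
Qed.

Definition wn r x k : R := w k ^+ r * normc (x k).

(* the H^r norm of the function with Fourier coefficients x is at most A *)
Definition hb r x A := l2 (wn r x) A.

Lemma wn_ge0 r x k : 0 <= wn r x k.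
Proof. by rewrite mulr_ge0 ?wX_ge0 ?normc_ge0. Qed.

Lemma wn_norm r x k : `|wn r x k| = wn r x k.
Proof. by rewrite ger0_norm ?wn_ge0. Qed.

Lemma hb_mono r x y A B : (forall k, normc (x k) <= normc (y k)) -> A <= B ->
  hb r y A -> hb r x B.
Proof.
by move=> xy AB; apply: l2_le AB => k; rewrite wn_norm ler_wpM2l ?wX_ge0 ?xy.
Qed.

Lemma hb_leB r x A B : A <= B -> hb r x A -> hb r x B.
Proof. by apply: hb_mono. Qed.

Lemma hb_ge0 r x A : hb r x A -> 0 <= A.
Proof. by case. Qed.

Lemma hb_ler r q x A : (r <= q)%N -> hb q x A -> hb r x A.
Proof.
move=> rq; apply: l2_le => // k; rewrite wn_norm ler_wpM2r ?normc_ge0 //.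
exact: (ler_weXn2l (w_ge1 k) rq).
Qed.

Lemma hbD r x y A B : hb r x A -> hb r y B -> hb r (fun k => x k + y k) (A + B).
Proof.
move=> hx hy; apply: l2_le (l2D hx hy) => // k.
by rewrite wn_norm /wn -mulrDr ler_wpM2l ?wX_ge0 ?le_normcD.
Qed.

Lemma hbN r x A : hb r x A -> hb r (fun k => - x k) A.
Proof. by apply: hb_mono => // k; rewrite normcN. Qed.

Lemma hbB r x y A B : hb r x A -> hb r y B -> hb r (fun k => x k - y k) (A + B).
Proof. by move=> hx hy; apply: hbD hx _; exact: hbN. Qed.

Lemma hbZ r x A (c : C) : hb r x A -> hb r (fun k => c * x k) (normc c * A).
Proof.
move=> hx; apply: l2_le (l2Z (normc_ge0 c) hx) => // k.
by rewrite wn_norm /wn normcM mulrCA.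
Qed.

Lemma hb_point r x A k : hb r x A -> normc (x k) <= A.
Proof.
move=> /(l2_point k); rewrite wn_norm; apply: le_trans.
by rewrite ler_peMl ?normc_ge0 ?wX_ge1.
Qed.

Lemma hb_l1 r x A : hb r.+1 x A -> sumB (wn r x) (3 * A).
Proof.
move=> hx; apply: sumB_le (l1_of_l2 (_ : l2 (fun k => w k * wn r x k) A)) => //.
- by move=> k; rewrite wn_norm.
- have -> : (fun k => w k * wn r x k) = wn r.+1 x.
    by apply/funext => k; rewrite /wn mulrA exprS.
  exact: hx.
Qed.

Lemma hb_summ r x A : hb r.+1 x A -> summC x.
Proof.
move=> /(hb_ler (ltn0Sn r)) /hb_l1 h.
have {}h : sumB (fun k => normc (x k)) (3 * A).
  by apply: sumB_le h => // j; rewrite /wn expr0 mul1r.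
by apply: sumB_summ h => k; exact: normc_ge0.
Qed.

Lemma hb_fatou r (X : nat -> int -> C) x B : (forall n, hb r (X n) B) ->
  (forall k e, 0 < e -> exists N, forall n, (N <= n)%N -> normc (X n k - x k) <= e) ->
  hb r x B.
Proof.
move=> XB Xx; apply: l2_fatou XB _ => k; apply/cvgrPdist_le => e e0.
have [N HN] := Xx k (e / w k ^+ r) (divr_gt0 e0 (lt_le_trans ltr01 (wX_ge1 _ _))).
exists N => // n /HN; rewrite ler_pdivlMr ?(lt_le_trans ltr01) ?wX_ge1 // => h.
rewrite /= /wn -mulrBr normrM ger0_norm ?wX_ge0 //.
apply: le_trans h; rewrite mulrC ler_wpM2r ?wX_ge0 //.
rewrite ler_norml; have := le_normcD (X n k - x k) (x k).
have := le_normcD (x k - X n k) (X n k).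
by rewrite !subrK [normc (x k - _)]normcB; lra.
Qed.

Lemma hb_closed r x B : (forall e, 0 < e -> hb r x (B + e)) -> hb r x B.
Proof.
move=> H; split.
  by apply/ler_addgt0Pr => e /H /hb_ge0.
move=> s us; rewrite leNgt; apply/negP.
set S := \sum_(k <- s) _ => hS.
have B0 : 0 <= B by apply/ler_addgt0Pr => e /H /hb_ge0.
(* This e satisfies e <= 1 and e (2 B + 1) < S - B^2, hence (B + e)^2 < S, against the hypothesis at
   e. *)
have e0 : 0 < (S - B ^+ 2) / (2 * B + 1 + (S - B ^+ 2)).
  by apply: divr_gt0; lra.
have [_ /(_ s us)] := H _ e0; rewrite -/S.
set d := S - B ^+ 2; have d0 : 0 < d by rewrite /d; lra.
set e := d / _; have e1 : e * (2 * B + 1 + d) = d by rewrite /e; field; lra.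
have ep : 0 < e by [].
have e1' : e <= 1 by rewrite ler_pdivrMr; lra.
have -> : S = B ^+ 2 + d by rewrite /d; ring.
nra.
Qed.

(** A bilinear Fourier multiplier on coefficients: the inputs at frequencies j and k - j meet at the
    output k with symbol p k j. *)
Definition cv (p : int -> int -> C) x y (k : int) : C :=
  csum (fun j => p k j * x j * y (k - j)).

Section ConvolutionBound.
Variables (p : int -> int -> C) (x y : int -> C) (r n a : nat) (c A B : R).
Hypothesis c0 : 0 <= c.
Hypothesis hp : forall k j,
  normc (p k j) * w k ^+ r <= c * w k ^+ n.+1 * (w j * w (k - j)) ^+ a.
Hypotheses (hx : hb (n.+1 + a) x A) (hy : hb (n.+1 + a) y B).

Let K : R := c * 2 ^+ n.+1.

Let U k j := K * (wn (n.+1 + a) x j * wn a y (k - j) + wn a x j * wn (n.+1 + a) y (k - j)).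

Let term_le k j : w k ^+ r * normc (p k j * x j * y (k - j)) <= U k j.
Proof.
rewrite !normcM mulrA mulrA [w k ^+ r * _]mulrC.
have h := hp k j; have X0 := normc_ge0 (x j); have Y0 := normc_ge0 (y (k - j)).
apply: (@le_trans _ _ (c * w k ^+ n.+1 * (w j * w (k - j)) ^+ a * normc (x j) * normc (y (k - j)))).
  by rewrite ler_wpM2r // ler_wpM2r.
rewrite /U /wn /K !exprD exprMn.
have h2 := wX_leD n.+1 k j; set W := w k ^+ n.+1 in h2 *.
set u := w j ^+ n.+1 in h2 *; set v := w (k - j) ^+ n.+1 in h2 *.
have q0 : 0 <= c * (w j ^+ a * w (k - j) ^+ a * normc (x j) * normc (y (k - j))).
  by rewrite mulr_ge0 // !mulr_ge0 // wX_ge0.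
have := ler_wpM2l q0 h2; lra.
Qed.

Let U_summ k : summ (U k).
Proof.
have sx : sumB (wn a x) (3 * A) by apply: hb_l1 (hb_ler _ hx); rewrite addSn ltnS leq_addl.
have sy : sumB (wn a y) (3 * B) by apply: hb_l1 (hb_ler _ hy); rewrite addSn ltnS leq_addl.
apply: summZ; apply: summD.
  have := @convol_summ _ (wn a y) (wn (n.+1 + a) x) (3 * B) A k (wn_ge0 _ _) sy
    (fun j => l2_point j hx) => h.
  by apply: summ_le (summ_inj (can_inj (@subrKi k)) h) => j /=; rewrite subrKi mulrC.
exact: convol_summ (wn_ge0 _ _) sx (fun j => l2_point j hy).
Qed.

Lemma cv_summ k : summC (fun j => p k j * x j * y (k - j)).
Proof.
apply: summC_le (U_summ k) => j; apply: le_trans (term_le k j).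
by rewrite ler_peMl ?normc_ge0 ?wX_ge1.
Qed.

(** A Leibniz rule: [wX_leD] puts the n + 1 output weights on one input, which is measured in l^2.
    The other input keeps only its [a] weights and has at least one derivative to spare, so it is in
    l^1 with constant 3. Young's inequality for the two resulting terms gives 6. *)
Lemma cv_hb : hb r (cv p x y) (c * 2 ^+ n.+1 * 6 * (A * B)).
Proof.
have sx : sumB (wn a x) (3 * A) by apply: hb_l1 (hb_ler _ hx); rewrite addSn ltnS leq_addl.
have sy : sumB (wn a y) (3 * B) by apply: hb_l1 (hb_ler _ hy); rewrite addSn ltnS leq_addl.
have Y1 := young (wn_ge0 _ _) (wn_ge0 _ _) sy hx.
have Y2 := young (wn_ge0 _ _) (wn_ge0 _ _) sx hy.
have K0 : 0 <= K by rewrite mulr_ge0 ?exprn_ge0.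
apply: l2_le (l2Z K0 (l2D Y1 Y2)); last by rewrite /K; lra.
move=> k; rewrite wn_norm.
have s1 := convol_summ k (wn_ge0 _ _) sy (fun j => l2_point j hx).
have s2 := convol_summ k (wn_ge0 _ _) sx (fun j => l2_point j hy).
have s1' : summ (fun j => wn (n.+1 + a) x j * wn a y (k - j)).
  by apply: summ_le (summ_inj (can_inj (@subrKi k)) s1) => j /=; rewrite subrKi mulrC.
rewrite (convolC s1) -[convol (wn a x) _ k]/(rsum _) -[convol _ (wn a y) k]/(rsum _).
rewrite -rsumD // -rsumZ; last exact: summD.
apply: (@le_trans _ _ (w k ^+ r * rsum (fun j => normc (p k j * x j * y (k - j))))).
  by rewrite ler_wpM2l ?wX_ge0 //; apply: csum_norm; exact: cv_summ.
rewrite -rsumZ; last exact: cv_summ.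
apply: rsum_le => [j| |]; first exact: term_le.
  by apply: summZ; exact: cv_summ.
exact: U_summ.
Qed.

End ConvolutionBound.

End Weights.

(** * Oscillatory factors and derivatives on an interval *)

Section Cis.
Variable R : realType.
Local Notation C := R[i].
Implicit Types (a b : R).

Lemma cisD a b : cis (a + b) = cis a * cis b.
Proof. by rewrite /cis cosD sinD; simpc; congr Complex; rewrite addrC. Qed.

Lemma cis0 : cis 0 = 1 :> C.
Proof. by rewrite /cis cos0 sin0. Qed.

Lemma normc_cis a : normc (cis a) = 1.
Proof. by rewrite /normc /cis cos2Dsin2 sqrtr1. Qed.

Lemma conj_cis a : conjc (cis a) = cis (- a).
Proof. by rewrite /cis /= cosN sinN. Qed.

Lemma mvt0 (f df : R -> R) : (forall x : R, is_derive x 1 f (df x)) -> forall a,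
  exists2 c, `|c| <= `|a| & f a - f 0 = df c * a.
Proof.
move=> fd a.
have cf x : {for x, continuous f}.
  by apply: differentiable_continuous; apply/derivable1_diffP; case: (fd x).
have [a0|a0] := leP 0 a.
  have [c] := MVT_segment a0 (fun x _ => fd x) (continuous_subspaceT cf).
  rewrite in_itv /= => /andP[c0 ca]; rewrite subr0 => ->; exists c => //.
  by rewrite !ger0_norm.
have [c] := MVT_segment (ltW a0) (fun x _ => fd x) (continuous_subspaceT cf).
rewrite in_itv /= => /andP[ac c0]; rewrite sub0r => h; exists c.
  by rewrite !ler0_norm ?lerN2 // ltW.
by rewrite -opprB h mulrN opprK.
Qed.

Lemma norm_cos1 a : `|cos a - 1| <= `|a|.
Proof.
have [c _] := mvt0 (@is_derive_cos R) a; rewrite cos0 => ->.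
by rewrite normrM normrN ler_piMl ?sin_max.
Qed.

Lemma norm_sin a : `|sin a| <= `|a|.
Proof.
have [c _] := mvt0 (@is_derive_sin R) a; rewrite sin0 subr0 => ->.
by rewrite normrM ler_piMl ?cos_max.
Qed.

Lemma norm_sinB a : `|sin a - a| <= a ^+ 2.
Proof.
have fd (x : R) : is_derive x 1 (fun y : R => sin y - y) (cos x - 1) by exact: is_deriveB.
have [c ca] := mvt0 fd a; rewrite sin0 subr0 subr0 => ->.
rewrite normrM -real_normK ?num_real // expr2 ler_wpM2r //.
exact: le_trans (norm_cos1 c) ca.
Qed.

Lemma cos1_sqr a : 2 - 2 * cos a <= a ^+ 2.
Proof.
have E : cos a = 1 - 2 * sin (a / 2) ^+ 2.
  have Ea : (a / 2) *+ 2 = a by rewrite -mulr_natr divfK.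
  by rewrite -[in LHS]Ea cos_mulr2n cos2sin2 -mulr_natl; ring.
have := norm_sin (a / 2); rewrite -ler_sqr ?nnegrE // !real_normK ?num_real //.
rewrite E; lra.
Qed.

Lemma normc_cis1_sqr a : normc (cis a - 1) ^+ 2 = 2 - 2 * cos a.
Proof.
rewrite -sqnormcE /sqnormc /= subr0; have := cos2Dsin2 a; lra.
Qed.

Lemma normc_cisB_sqr a b : normc (cis a - cis b) ^+ 2 = normc (cis (a - b) - 1) ^+ 2.
Proof.
have -> : cis a - cis b = cis b * (cis (a - b) - 1).
  by rewrite mulrBr -cisD [b + _]addrC subrK mulr1.
by rewrite normcM normc_cis mul1r.
Qed.

Lemma cis_lip a b : normc (cis a - cis b) <= `|a - b|.
Proof.
apply: sqr_le_le => //; rewrite normc_cisB_sqr normc_cis1_sqr real_normK ?num_real //.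
exact: cos1_sqr.
Qed.

Lemma cis_lip_sqr a b : normc (cis a - cis b) ^+ 2 <= 2 * `|a - b|.
Proof.
rewrite normc_cisB_sqr normc_cis1_sqr; have := norm_cos1 (a - b).
rewrite ler_norml; lra.
Qed.

Lemma cis_taylor a b : normc (cis b - cis a - (0 +i* (b - a)) * cis a) <= 2 * (b - a) ^+ 2.
Proof.
have -> : cis b - cis a - (0 +i* (b - a)) * cis a = cis a * (cis (b - a) - 1 - (0 +i* (b - a))).
  by rewrite !mulrBr -cisD [a + _]addrC subrK mulr1 [_ * cis a]mulrC.
rewrite normcM normc_cis mul1r; set d := b - a.
apply: le_trans (normc_leD _) _; rewrite /= !subr0.
have h1 := norm_sinB d.
have : `|cos d - 1| <= d ^+ 2.
  rewrite distrC ger0_norm; last by rewrite subr_ge0 cos_le1.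
  have := cos1_sqr d; have := cos_le1 d; lra.
lra.
Qed.

End Cis.

(** * One-sided time derivatives and the mean value inequality in H^r *)

Section Der.
Variable R : realType.
Local Notation C := R[i].
Local Notation w := (japanese R).

(* One-sided at the endpoints of [a, b], as in tkdv_solution. *)
Definition rder (a b : R) (f : R -> R) (t d : R) := forall e, 0 < e ->
  exists2 dl, 0 < dl & forall s, a <= s <= b -> `|s - t| <= dl ->
  `|f s - f t - (s - t) * d| <= e * `|s - t|.

Definition cder (a b : R) (f : R -> C) (t : R) (d : C) := forall e, 0 < e ->
  exists2 dl, 0 < dl & forall s, a <= s <= b -> `|s - t| <= dl ->
  normc (f s - f t - (s - t)%:C * d) <= e * `|s - t|.

(** One-sided derivatives at the endpoints still give continuity there, and the classical mean value
    theorem asks for differentiability in the open interval only. *)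
Lemma rder_mvt (a b : R) f g L : a <= b -> (forall t, a <= t <= b -> rder a b f t (g t)) ->
  (forall t, a <= t <= b -> g t <= L) -> f b - f a <= L * (b - a).
Proof.
rewrite le_eqVlt => /predU1P[-> _ _|ab fg gL]; first by rewrite !subrr mulr0.
have fd (x : R) : x \in `]a, b[%R -> is_derive x 1 f (g x).
  rewrite in_itv /= => /andP[ax xb].
  have cv : h^-1 *: ((f \o shift x) (h *: 1) - f x) @[h --> 0^'] --> g x.
    apply/cvgrPdist_le => e e0.
    have [|dl dl0 H] := fg x _ e e0; first by rewrite !ltW.
    near=> h.
    have h0 : h != 0 by near: h; exact: nbhs_dnbhs_neq.
    have hd : `|h| <= Num.min dl (Num.min (x - a) (b - x)).
      by near: h; apply: dnbhs0_le; rewrite !lt_min dl0 !subr_gt0 ax.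
    move: hd; rewrite !le_min => /andP[hd]; rewrite !(ler_norml h) => /andP[/andP[h1 h2] /andP[h3 h4]].
    have := H (h + x); rewrite addrK => /(_ _ hd).
    rewrite /= -/(h%R) [h *: 1]mulr1.
    have -> : g x - h^-1 *: (f (h + x) - f x) = - (h^-1 * (f (h + x) - f x - h * g x)).
      by rewrite -[_ *: _]/(_ * _); field.
    rewrite normrN normrM normfV => Hh.
    rewrite ler_pdivrMl ?normr_gt0 // [`|h| * e]mulrC; apply: Hh; lra.
  apply: DeriveDef; first exact/cvg_ex/(ex_intro _ (g x)).
  exact: cvg_lim cv.
have fc : {within `[a, b], continuous f}.
  have cont x : a <= x <= b -> forall e, 0 < e -> exists2 dl, 0 < dl &
      forall s, a <= s <= b -> `|s - x| <= dl -> `|f x - f s| <= e.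
    move=> xab e e0; have [dl dl0 H] := fg x xab 1 ltr01.
    have M0 : 0 < 1 + `|g x| by rewrite ltr_pwDl.
    exists (Num.min dl (e / (1 + `|g x|))); first by rewrite lt_min dl0 divr_gt0.
    move=> s sab; rewrite le_min ler_pdivlMr // => /andP[sd se].
    have := H s sab sd; rewrite mul1r => h.
    apply: le_trans se; rewrite distrC mulrDr mulr1 -normrM.
    rewrite -[f s - f x](subrK ((s - x) * g x)).
    by apply: le_trans (ler_normD _ _) _; rewrite lerD2r.
  apply/continuous_within_itvP => //; split.
  - move=> x xab; apply: differentiable_continuous; apply/derivable1_diffP.
    by case: (fd x xab).
  - apply/cvgrPdist_le => e e0; have [|dl dl0 H] := cont a _ e e0; first by rewrite lexx ltW.
    near=> s; apply: H.
      by apply/andP; split; near: s; [exact: nbhs_right_ge|exact: nbhs_right_le].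
    rewrite ger0_norm; last by rewrite subr_ge0; near: s; exact: nbhs_right_ge.
    by rewrite lerBlDr; near: s; apply: nbhs_right_le; rewrite ltrDr.
  - apply/cvgrPdist_le => e e0; have [|dl dl0 H] := cont b _ e e0; first by rewrite lexx ltW.
    near=> s; apply: H.
      by apply/andP; split; near: s; [exact: nbhs_left_ge|exact: nbhs_left_le].
    rewrite ler0_norm; last by rewrite subr_le0; near: s; exact: nbhs_left_le.
    by rewrite opprB lerBlDl -lerBlDr; near: s; apply: nbhs_left_ge; rewrite ltrBlDr ltrDl.
have [c] := MVT ab fd fc.
rewrite in_itv /= => /andP[ac cb] ->; rewrite ler_wpM2r ?subr_ge0 ?(ltW ab) //.
by apply: gL; rewrite !ltW.
Unshelve. all: by end_near. Qed.

Lemma rder_sum (I : Type) (r : seq I) a b (F : I -> R -> R) t (d : I -> R) :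
  (forall i, rder a b (F i) t (d i)) ->
  rder a b (fun s => \sum_(i <- r) F i s) t (\sum_(i <- r) d i).
Proof.
move=> Fd; elim: r => [|i r IH] e e0.
  exists 1 => // s _ _; by rewrite !big_nil mulr0 !subr0 normr0 mulr_ge0 // ltW.
have e2 : 0 < e / 2 by lra.
have [d1 d10 H1] := Fd i _ e2; have [d2 d20 H2] := IH _ e2.
exists (Num.min d1 d2); first by rewrite lt_min d10.
move=> s sab; rewrite le_min => /andP[s1 s2]; rewrite !big_cons.
have := H1 s sab s1; have := H2 s sab s2.
set A := \sum_(_ <- _) F _ s; set B := \sum_(_ <- _) F _ t; set D := \sum_(_ <- _) _.
have -> : F i s + A - (F i t + B) - (s - t) * (d i + D) =
  (F i s - F i t - (s - t) * d i) + (A - B - (s - t) * D) by ring.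
move=> h2 h1; apply: le_trans (ler_normD _ _) _; lra.
Qed.

Lemma cder_Re a b f t d (c : C) : cder a b f t d ->
  rder a b (fun s => complex.Re (c * f s)) t (complex.Re (c * d)).
Proof.
move=> fd e e0; have M0 : 0 < 1 + normc c by rewrite ltr_pwDl // normc_ge0.
have [dl dl0 H] := fd (e / (1 + normc c)) (divr_gt0 e0 M0).
exists dl => // s sab sd.
have -> : complex.Re (c * f s) - complex.Re (c * f t) - (s - t) * complex.Re (c * d) =
  complex.Re (c * (f s - f t - (s - t)%:C * d)).
  by case: c {M0 H} => c1 c2; case: (f s) => a1 a2; case: (f t) => b1 b2; case: d {fd} => d1 d2; simpc; rewrite /=; ring.
apply: le_trans (normc_Re _) _; rewrite normcM.
have := ler_wpM2l (normc_ge0 c) (H s sab sd); move=> h; apply: le_trans h _.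
rewrite mulrA ler_wpM2r // mulrCA ler_piMr ?ltW //.
by rewrite ltr_pdivrMr // mul1r ltrDr.
Qed.

Lemma cderD a b f g t d d' : cder a b f t d -> cder a b g t d' ->
  cder a b (fun s => f s + g s) t (d + d').
Proof.
move=> fd gd e e0; have e2 : 0 < e / 2 by lra.
have [d1 d10 H1] := fd _ e2; have [d2 d20 H2] := gd _ e2.
exists (Num.min d1 d2); first by rewrite lt_min d10.
move=> s sab; rewrite le_min => /andP[s1 s2].
have -> : f s + g s - (f t + g t) - (s - t)%:C * (d + d') =
  (f s - f t - (s - t)%:C * d) + (g s - g t - (s - t)%:C * d') by ring.
have := H1 s sab s1; have := H2 s sab s2.
move=> h2 h1; apply: le_trans (le_normcD _ _) _; lra.
Qed.

Lemma cderN a b f t d : cder a b f t d -> cder a b (fun s => - f s) t (- d).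
Proof.
move=> fd e e0; have [d1 d10 H1] := fd _ e0; exists d1 => // s sab /(H1 s sab).
by rewrite -normcN; congr (normc _ <= _); ring.
Qed.

Lemma cder_cst a b (c : C) t : cder a b (fun=> c) t 0.
Proof.
by move=> e e0; exists 1 => // s _ _; rewrite subrr mulr0 subr0 normc0 mulr_ge0 // ltW.
Qed.

Lemma cder_sub a b a' b' f t d : a <= a' -> b' <= b -> cder a b f t d -> cder a' b' f t d.
Proof.
move=> aa bb fd e e0; have [d1 d10 H1] := fd _ e0; exists d1 => // s /andP[as_ sb].
by apply: H1; rewrite (le_trans aa) //= (le_trans sb).
Qed.

Lemma cder_refl a b f t d u : cder (u - b) (u - a) f (u - t) d ->
  cder a b (fun s => f (u - s)) t (- d).
Proof.
move=> fd e e0; have [d1 d10 H1] := fd _ e0; exists d1 => // s /andP[as_ sb] st.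
have E : u - s - (u - t) = - (s - t) by ring.
have := H1 (u - s); rewrite E normrN rmorphN mulNr mulrN; apply => //.
by rewrite !lerB.
Qed.

(** The increment V serves as its own test vector. On a finite set of frequencies, the squared norm
    S of V is the increment of the scalar function Re <V, X(t)>, whose derivative is at most sqrt(S)
    L by Cauchy-Schwarz; hence S <= sqrt(S) L (b - a). *)
Lemma hb_mvt r a b (X Y : R -> int -> C) L : a <= b ->
  (forall t k, a <= t <= b -> cder a b (fun s => X s k) t (Y t k)) ->
  (forall t, a <= t <= b -> hb r (Y t) L) ->
  hb r (fun k => X b k - X a k) (L * (b - a)).
Proof.
move=> ab XY YL.
have L0 : 0 <= L by apply: hb_ge0 (YL a _); rewrite lexx.
have Lb : 0 <= L * (b - a) by rewrite mulr_ge0 ?subr_ge0.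
split=> // s us; pose V k := X b k - X a k.
pose S := \sum_(k <- s) wn r V k ^+ 2.
rewrite -/S; have S0 : 0 <= S by apply: sumr_ge0 => k _; exact: sqr_ge0.
pose G k t := complex.Re ((w k ^+ r * w k ^+ r)%:C * conjc (V k) * X t k).
pose D t k := complex.Re ((w k ^+ r * w k ^+ r)%:C * conjc (V k) * Y t k).
have Gd t : a <= t <= b -> rder a b (fun u => \sum_(k <- s) G k u) t (\sum_(k <- s) D t k).
  by move=> tab; apply: rder_sum => k; apply: cder_Re; exact: XY.
have DL t : a <= t <= b -> \sum_(k <- s) D t k <= Num.sqrt S * L.
  move=> tab; have [_ /(_ s us) YS] := YL t tab.
  apply: (@le_trans _ _ (\sum_(k <- s) wn r V k * wn r (Y t) k)).
    apply: ler_sum => k _; apply: le_trans (ler_norm _) _; apply: le_trans (normc_Re _) _.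
    rewrite !normcM normcR normc_conj ger0_norm ?mulr_ge0 ?wX_ge0 // /wn; lra.
  by apply: sum_CS_le => //; rewrite sqr_sqrtr.
have := rder_mvt ab Gd DL; rewrite -sumrB.
have -> : \sum_(k <- s) (G k b - G k a) = S.
  apply: eq_bigr => k _; rewrite /G /wn exprMn -sqnormcE /sqnormc /V.
  by case: (X b k) => b1 b2; case: (X a k) => a1 a2; simpc; rewrite /=; ring.
move=> h; have := sqr_sqrtr S0; have := sqrtr_ge0 S; set q := Num.sqrt S in h * => q0 qS.
suff : q <= L * (b - a) by move=> qL; rewrite -qS ler_sqr ?nnegrE.
rewrite leNgt; apply/negP => qL; nra.
Qed.

(** Termwise differentiation: with a summable majorant of total B, the remainders add up to at most
    B (s - t)^2, which is below e |s - t| once |s - t| <= e / (1 + B). *)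
Lemma cder_csum a b (f : R -> int -> C) t (d : int -> C) (bd : int -> R) :
  (forall s, summC (f s)) -> summC d -> summ bd ->
  (forall s j, normc (f s j - f t j - (s - t)%:C * d j) <= bd j * (s - t) ^+ 2) ->
  cder a b (fun s => csum (f s)) t (csum d).
Proof.
move=> sf sd [B sB] H e e0; have B0 := sumB_ge0 sB.
exists (e / (1 + B)); first by rewrite divr_gt0 // ltr_pwDl.
move=> s _; rewrite ler_pdivlMr ?ltr_pwDl // => hs.
rewrite -csumZ // -csumB // -csumB; [|exact: summCB|exact: summCZ].
apply: (@le_trans _ _ ((s - t) ^+ 2 * B)).
  apply: csum_normB; apply: sumB_le (sumBZ (sqr_ge0 (s - t)) sB) => // j.
  by apply: le_trans (H s j) _; rewrite mulrC ler_wpM2l ?sqr_ge0 ?ler_norm.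
rewrite -real_normK ?num_real // expr2 mulrAC; have := normr_ge0 (s - t); nra.
Qed.

End Der.

(** * The symbols of the equation and of the scheme *)

Section Symbols.
Variable R : realType.
Local Notation C := R[i].
Local Notation w := (japanese R).
Implicit Types (p q : int -> int -> C) (x y z : int -> C) (A B K t s tau : R).

(** Square summability without a recorded bound. For a symbol bounded in j at each k it makes every
    single coefficient of [cv] an absolutely convergent sum ([cv_summ0]), so bilinear identities
    need no tracking of norms. *)
Definition fin x := exists A, hb 0 x A.

Lemma hb_fin r x A : hb r x A -> fin x.
Proof. by move=> hx; exists A; exact: hb_ler hx. Qed.

Lemma finD x y : fin x -> fin y -> fin (fun k => x k + y k).
Proof. by move=> [A hx] [B hy]; exists (A + B); exact: hbD. Qed.

Lemma finZ x (c : C) : fin x -> fin (fun k => c * x k).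
Proof. by move=> [A hx]; exists (normc c * A); exact: hbZ. Qed.

Lemma eq_le_bound (z1 z2 : C) : z1 = z2 -> normc z1 <= normc z2.
Proof. by move=> ->. Qed.

Lemma halfC : (2^-1)%:C + (2^-1)%:C = 1 :> C.
Proof. by apply/eqP; rewrite eq_complex /=; apply/andP; split; apply/eqP; lra. Qed.

Definition bsym p := forall k, exists K, forall j, normc (p k j) <= K.

Lemma cv_summ0 p x y k : bsym p -> fin x -> fin y ->
  summC (fun j => p k j * x j * y (k - j)).
Proof.
move=> /(_ k) [K pK] [A hx] [B hy].
have hy' : l2 (fun j => wn 0 y (k - j)) B by apply: (l2_inj (can_inj (@subrKi k)) hy).
apply: summC_le (summZ K (summM hx hy')) => j.
rewrite !normcM /wn !expr0 !mul1r -mulrA ler_wpM2r //.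
by rewrite mulr_ge0 ?normc_ge0.
Qed.

Lemma cvDl p x x' y k : bsym p -> fin x -> fin x' -> fin y ->
  cv p (fun j => x j + x' j) y k = cv p x y k + cv p x' y k.
Proof.
move=> hp hx hx' hy; rewrite /cv -csumD; [|exact: cv_summ0|exact: cv_summ0].
by apply: eq_csum => j; ring.
Qed.

Lemma cvBl p x x' y k : bsym p -> fin x -> fin x' -> fin y ->
  cv p (fun j => x j - x' j) y k = cv p x y k - cv p x' y k.
Proof.
move=> hp hx hx' hy; rewrite /cv -csumB; [|exact: cv_summ0|exact: cv_summ0].
by apply: eq_csum => j; ring.
Qed.

Lemma cvDr p x y y' k : bsym p -> fin x -> fin y -> fin y' ->
  cv p x (fun j => y j + y' j) k = cv p x y k + cv p x y' k.
Proof.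
move=> hp hx hy hy'; rewrite /cv -csumD; [|exact: cv_summ0|exact: cv_summ0].
by apply: eq_csum => j; ring.
Qed.

Lemma cvBr p x y y' k : bsym p -> fin x -> fin y -> fin y' ->
  cv p x (fun j => y j - y' j) k = cv p x y k - cv p x y' k.
Proof.
move=> hp hx hy hy'; rewrite /cv -csumB; [|exact: cv_summ0|exact: cv_summ0].
by apply: eq_csum => j; ring.
Qed.

Lemma cvBp p q x y k : bsym p -> bsym q -> fin x -> fin y ->
  cv (fun k j => p k j - q k j) x y k = cv p x y k - cv q x y k.
Proof.
move=> hp hq hx hy; rewrite /cv -csumB; [|exact: cv_summ0|exact: cv_summ0].
by apply: eq_csum => j; ring.
Qed.

(** The rearrangement behind the order of the local error, with primes for the reflected time, x and
    x' the deviations from the midpoint value, p and q the symbols at the two times. Each term on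
    the right is of second order in the step: it contains x + x', or x' with q - p, or x' with y' -
    y. *)
Lemma cv_pair p q x x' y y' z k : bsym p -> bsym q -> fin x -> fin x' ->
  fin y -> fin y' -> fin z ->
  cv p x y k + cv p z x k + (cv q x' y' k + cv q z x' k) =
  cv p (fun j => x j + x' j) y k + cv p z (fun j => x j + x' j) k
  + (cv (fun k j => q k j - p k j) x' y k + cv (fun k j => q k j - p k j) z x' k)
  + cv q x' (fun j => y' j - y j) k.
Proof.
by move=> *; rewrite cvDl // cvDr // !cvBp // cvBr //; ring.
Qed.

(* the phase of the interaction (j, k - j) -> k in the twisted variable *)
Definition th t (k j : int) : C := cis (- (3 * t * (k * j * (k - j))%:~R)).

Definition dsym (j : int) : C := if j == 0 then 0 else (0 +i* j%:~R)^-1.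

Lemma dsymE j : j != 0 -> dsym j = 0 +i* (- (j%:~R)^-1).
Proof.
move=> j0; rewrite /dsym (negPf j0); apply: (mulIf (x := 0 +i* j%:~R)).
  by rewrite eq_complex /= eqxx intr_eq0.
rewrite mulVf; last by rewrite eq_complex /= eqxx intr_eq0.
by simpc; rewrite mulVf ?intr_eq0.
Qed.

(* Symbol of the twisted KdV nonlinearity; ksym is that of one step of the rule,
   and d/ds ksym t (s - t) k j = psym s k j / 4 for j (k - j) != 0. *)
Definition psym t (k j : int) : C := (0 +i* (k%:~R / 2)) * th t k j.

Definition ksym t tau (k j : int) : C :=
  (24^-1)%:C * (th (t + tau) k j - th t k j) * dsym j * dsym (k - j).

Lemma normc_th t k j : normc (th t k j) = 1.
Proof. exact: normc_cis. Qed.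

Lemma normc_i (a : R) : normc (0 +i* a) = `|a|.
Proof. by rewrite /normc expr0n add0r sqrtr_sqr. Qed.

Lemma normc_dsym j : normc (dsym j) <= 1.
Proof.
rewrite /dsym; case: eqVneq => [_|j0]; first by rewrite normc0.
rewrite normcV normc_i invf_le1; first by rewrite -w_int // w_ge1.
by rewrite -w_int // w_gt0.
Qed.

Lemma dsym_abs j : normc (dsym j) * `|j%:~R| <= 1.
Proof.
rewrite /dsym; case: eqVneq => [_|j0]; first by rewrite normc0 mul0r.
by rewrite normcV normc_i mulVf // -w_int // gt_eqF // w_gt0.
Qed.

Lemma th_lip s t k j : normc (th s k j - th t k j) <= 3 * `|s - t| * `|(k * j * (k - j))%:~R|.
Proof.
apply: le_trans (cis_lip _ _) _; set c := (_)%:~R.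
have -> : - (3 * s * c) - - (3 * t * c) = - (3 * (s - t) * c) by ring.
by rewrite normrN !normrM ger0_norm.
Qed.

Lemma th_lip_sqr s t k j :
  normc (th s k j - th t k j) ^+ 2 <= 6 * `|s - t| * `|(k * j * (k - j))%:~R|.
Proof.
apply: le_trans (cis_lip_sqr _ _) _; set c := (_)%:~R.
have -> : - (3 * s * c) - - (3 * t * c) = - (3 * (s - t) * c) by ring.
by rewrite normrN !normrM ger0_norm //; lra.
Qed.

Lemma abs_w3 (k j : int) : `|(k * j * (k - j))%:~R : R| <= w k * (w j * w (k - j)).
Proof.
rewrite !rmorphM /= !normrM mulrA; apply: ler_pM => //; last exact: abs_w.
by apply: ler_pM => //; exact: abs_w.
Qed.

Lemma bsym_th t : bsym (th t).
Proof. by move=> k; exists 1 => j; rewrite normc_th. Qed.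

Lemma bsym_psym t : bsym (psym t).
Proof.
by move=> k; exists (normc (0 +i* (k%:~R / 2) : C)) => j; rewrite normcM normc_th mulr1.
Qed.

(** The squared phase difference carries |k j (k - j)|, and the two inverse derivatives divide by
    j^2 (k - j)^2. What is left, |k| / (|j| |k - j|), is at most 2 because |k| <= |j| + |k - j|; no
    derivative is lost. *)
Lemma ksym_sqrt t tau k j : 0 <= tau -> normc (ksym t tau k j) <= Num.sqrt tau.
Proof.
move=> tau0; apply: sqr_le_le; first exact: sqrtr_ge0.
rewrite sqr_sqrtr // !normcM normcR ger0_norm ?invr_ge0 //.
have := th_lip_sqr (t + tau) t k j; rewrite [t + tau]addrC addrK ger0_norm //.
set mu := normc (_ - _); rewrite !rmorphM /= !normrM.
have := dsym_abs j; have := dsym_abs (k - j); have := normc_dsym j; have := normc_dsym (k - j).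
have kj : `|k%:~R : R| <= `|j%:~R| + `|(k - j)%:~R|.
  by rewrite -[in leLHS](subrK j k) rmorphD addrC; exact: ler_normD.
have := normc_ge0 (dsym j); have := normc_ge0 (dsym (k - j)).
have := normr_ge0 (k%:~R : R); have := normr_ge0 (j%:~R : R); have := normr_ge0 ((k - j)%:~R : R).
move: kj; set a := `|k%:~R|; set b := `|j%:~R|; set c := `|(k - j)%:~R|.
set d := normc (dsym j); set e := normc (dsym (k - j)).
move=> abc c0 b0 a0 e0 d0 e1 d1 ec db mu2.
have [db0 ec0] : 0 <= d * b /\ 0 <= e * c by split; exact: mulr_ge0.
have h1 : d * e * a <= 2.
  have : d * e * a <= d * e * (b + c) by rewrite ler_wpM2l // mulr_ge0.
  have : (d * b) * e <= 1 * 1 by exact: ler_pM.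
  have : (e * c) * d <= 1 * 1 by exact: ler_pM.
  lra.
have h2 : (d * b) * (e * c) * (d * e * a) <= 1 * 1 * 2.
  by apply: ler_pM => //; rewrite ?mulr_ge0 //; exact: ler_pM.
have := ler_wpM2l (mulr_ge0 (sqr_ge0 d) (sqr_ge0 e)) mu2.
rewrite !exprMn expr2.
have : tau * ((d * b) * (e * c) * (d * e * a)) <= tau * (1 * 1 * 2) by rewrite ler_wpM2l.
lra.
Qed.

Lemma bsym_ksym t tau : bsym (ksym t tau).
Proof.
move=> k; exists (2 * 24^-1) => j; rewrite !normcM normcR ger0_norm ?invr_ge0 //.
have h : normc (th (t + tau) k j - th t k j) <= 2.
  by apply: le_trans (le_normcD _ _) _; rewrite normcN !normc_th.
have := normc_ge0 (th (t + tau) k j - th t k j).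
have := normc_dsym j; have := normc_dsym (k - j).
have := normc_ge0 (dsym j); have := normc_ge0 (dsym (k - j)).
set d := normc (dsym j); set e := normc (dsym (k - j)).
set mu := normc (_ - _) in h * => e0 d0 e1 d1 mu0.
have : mu * d <= 2 * 1 by exact: ler_pM.
have : mu * d * e <= 2 * 1 * 1 by apply: ler_pM => //; [exact: mulr_ge0|exact: ler_pM].
lra.
Qed.

Lemma ksym_hb t tau x y A B : 0 <= tau -> hb 1 x A -> hb 1 y B ->
  hb 1 (cv (ksym t tau) x y) (12 * Num.sqrt tau * (A * B)).
Proof.
move=> tau0 hx hy.
apply: hb_leB (@cv_hb _ (ksym t tau) x y 1 0 0 (Num.sqrt tau) A B _ _ hx hy).
- by rewrite expr1; lra.
- exact: sqrtr_ge0.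
- by move=> k j; rewrite expr0 mulr1 ler_wpM2r ?wX_ge0 // ksym_sqrt.
Qed.

Lemma psym_hb r t x y A B : hb r.+1 x A -> hb r.+1 y B ->
  hb r (cv (psym t) x y) (6 * 2 ^+ r * (A * B)).
Proof.
move=> hx hy.
have := @cv_hb _ (psym t) x y r r 0 2^-1 A B; rewrite addn0 => h.
apply: hb_leB (h _ _ hx hy).
- by rewrite exprS; lra.
- by rewrite invr_ge0.
- move=> k j; rewrite expr0 mulr1 normcM normc_th mulr1 normc_i normrM exprS mulrA.
  rewrite ler_wpM2r ?wX_ge0 // mulrC ger0_norm ?invr_ge0 // ler_wpM2l ?invr_ge0 //.
  exact: abs_w.
Qed.

(** The phase difference costs one weight at each of k, j and k - j. Together with the derivative at
    k this puts r + 2 weights on the output and one on each input, so three derivatives are lost. *)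
Lemma psymB_hb r s t x y A B : hb r.+3 x A -> hb r.+3 y B ->
  hb r (cv (fun k j => psym s k j - psym t k j) x y) (9 * 2 ^+ r.+2 * `|s - t| * (A * B)).
Proof.
move=> hx hy.
have := @cv_hb _ (fun k j => psym s k j - psym t k j) x y r r.+1 1 (3 / 2 * `|s - t|) A B.
rewrite addn1 => h; apply: hb_leB (h _ _ hx hy).
- lra.
- by rewrite mulr_ge0.
- move=> k j; rewrite -mulrBr normcM normc_i normrM expr1.
  have h1 := th_lip s t k j; have h2 := abs_w3 k j; have h3 := abs_w R k.
  rewrite [in leRHS]exprS [w k ^+ r.+1]exprS.
  have h4 : normc (th s k j - th t k j) <= 3 * `|s - t| * (w k * (w j * w (k - j))).
    by apply: le_trans h1 _; rewrite ler_wpM2l // mulr_ge0.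
  have h5 : `|k%:~R| * normc (th s k j - th t k j) <= w k * (3 * `|s - t| * (w k * (w j * w (k - j)))).
    by apply: ler_pM => //; exact: normc_ge0.
  have h6 := ler_wpM2r (wX_ge0 R k r) h5.
  have -> : `|2^-1 : R| = 2^-1 by rewrite ger0_norm // invr_ge0.
  lra.
Qed.

End Symbols.

(** * Local error *)

Section LocalError.
Variable R : realType.
Local Notation C := R[i].
Local Notation w := (japanese R).
Variables (T M : R) (a : R -> int -> C).
Hypothesis a5 : forall t, 0 <= t <= T -> hb 5 (a t) M.
Hypothesis a0 : forall t, 0 <= t <= T -> a t 0 = 0.
Hypothesis ader : forall t k, 0 <= t <= T ->
  cder 0 T (fun s => a s k) t (cv (psym t) (a t) (a t) k).

Let F t := cv (psym t) (a t) (a t).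
(** [L1] bounds the time derivative of the solution in H^4, and [L2] is the Lipschitz constant of
    that derivative in H^2: one [psymB_hb] term and two [psym_hb] terms with r = 2. In [loc_cst] the
    three summands are the three groups of terms of [cv_pair], estimated with r = 1. *)
Let L1 := 96 * M ^+ 2.
Let L2 := 144 * M ^+ 2 + 48 * (L1 * M).
Definition loc_cst := 24 * (L2 * M) + 144 * (L1 * M) + 12 * L1 ^+ 2.

Let finA t : 0 <= t <= T -> fin (a t).
Proof. by move=> /a5 /hb_fin. Qed.

Let F4 t : 0 <= t <= T -> hb 4 (F t) L1.
Proof.
by move=> tT; apply: hb_leB (psym_hb t (a5 tT) (a5 tT)); rewrite /L1; lra.
Qed.

Let lip4 s t : 0 <= s <= T -> 0 <= t <= T ->
  hb 4 (fun k => a s k - a t k) (L1 * `|s - t|).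
Proof.
wlog ts : s t / t <= s.
  move=> H sT tT; have [ts|/ltW st] := leP t s; first exact: H.
  by apply: hb_mono (H t s st tT sT) => [k|]; rewrite ?[`|t - s|]distrC // normcB.
move=> /andP[s0 sT] /andP[t0 tT]; rewrite ger0_norm ?subr_ge0 //.
apply: (@hb_mvt _ 4 t s a F) => // [u k|u] /andP[tu us].
  have uT : 0 <= u <= T by rewrite (le_trans t0) // (le_trans us).
  exact: cder_sub t0 sT (ader k uT).
by apply: F4; rewrite (le_trans t0) // (le_trans us).
Qed.

Let FB s t : 0 <= s <= T -> 0 <= t <= T ->
  hb 2 (fun k => F s k - F t k) (L2 * `|s - t|).
Proof.
move=> sT tT; have d4 := lip4 sT tT.
have h1 := psymB_hb (r := 2) s t (a5 sT) (a5 sT).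
have h2 := psym_hb (r := 2) t (hb_ler (isT : (3 <= 4)%N) d4) (hb_ler (isT : (3 <= 5)%N) (a5 sT)).
have h3 := psym_hb (r := 2) t (hb_ler (isT : (3 <= 5)%N) (a5 tT)) (hb_ler (isT : (3 <= 4)%N) d4).
apply: hb_mono (hbD (hbD h1 h2) h3) => [k|].
  rewrite cvBp ?cvBl ?cvBr; do ?[exact: bsym_psym|exact: finA].
  by apply: eq_le_bound; rewrite /F; ring.
rewrite /L2 /L1; have := normr_ge0 (s - t); lra.
Qed.

Variables (t tau : R).
Hypotheses (tau0 : 0 <= tau) (t0 : 0 <= t) (tT : t + tau <= T).

Let W k := a t k + a (t + tau) k.
Let m k := (2^-1)%:C * W k.
Let refl s := t + t + tau - s.

Let inT s : t <= s <= t + tau -> 0 <= s <= T.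
Proof. by move=> /andP[ts sT]; rewrite (le_trans t0) //= (le_trans sT). Qed.

Let reflP s : t <= s <= t + tau -> t <= refl s <= t + tau.
Proof. by rewrite /refl => /andP[? ?]; lra. Qed.

Let tI : t <= t <= t + tau. Proof. by rewrite lexx /= lerDl. Qed.
Let tI' : t <= t + tau <= t + tau. Proof. by rewrite lerDl tau0 lexx. Qed.

Let m5 : hb 5 m M.
Proof.
apply: hb_leB (hbZ _ (hbD (a5 (inT tI)) (a5 (inT tI')))).
rewrite normcR ger0_norm ?invr_ge0 //; lra.
Qed.

Let de s k := a s k - m k.

Let de4 s : t <= s <= t + tau -> hb 4 (de s) (L1 * tau).
Proof.
move=> sI.
have h1 := hbZ (2^-1)%:C (lip4 (inT sI) (inT tI)).
have h2 := hbZ (2^-1)%:C (lip4 (inT sI) (inT tI')).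
have L10 : 0 <= L1 by rewrite mulr_ge0 ?sqr_ge0.
apply: hb_mono (hbD h1 h2) => [k|].
  rewrite /de /m /W; apply: eq_le_bound.
  transitivity (((2^-1)%:C + (2^-1)%:C) * a s k - (2^-1)%:C * (a t k + a (t + tau) k)).
    by rewrite halfC mul1r.
  by ring.
rewrite normcR ger0_norm ?invr_ge0 //.
have e1 : `|s - t| <= tau by case/andP: sI => ? ?; rewrite ler_norml; lra.
have e2 : `|s - (t + tau)| <= tau by case/andP: sI => ? ?; rewrite ler_norml; lra.
have := ler_wpM2l L10 e1; have := ler_wpM2l L10 e2; lra.
Qed.

(** The sum a(u) + a(refl u) has derivative F(u) - F(refl u), which is O(tau) because u and refl u
    are within tau of each other; at u = t the sum is [W], twice the midpoint value. Integrating
    from t to s gains the second tau. *)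
Let deD s : t <= s <= t + tau -> hb 2 (fun k => de s k + de (refl s) k) (L2 * tau * tau).
Proof.
move=> sI; have L20 : 0 <= L2 * tau.
  by have := hb_ge0 (FB (inT tI') (inT tI)); rewrite addrAC subrr add0r ger0_norm.
have h := @hb_mvt R 2 t s (fun u k => a u k + a (refl u) k)
  (fun u k => F u k - F (refl u) k) (L2 * tau).
have {h} : hb 2 (fun k => a s k + a (refl s) k - (a t k + a (refl t) k)) (L2 * tau * (s - t)).
  case/andP: (sI) => ts st; apply: h => // [u k|u] /andP[tu us].
    have uI : t <= u <= t + tau by rewrite tu (le_trans us).
    apply: cderD.
      by apply: cder_sub (ader k (inT uI)) => //; case/andP: (inT sI).
    apply: (@cder_refl R t s (fun v => a v k) u (F (refl u) k) (t + t + tau)).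
    apply: cder_sub (ader k (inT (reflP uI))).
      by case/andP: (inT (reflP sI)).
    by case/andP: (inT (reflP tI)).
  have uI : t <= u <= t + tau by rewrite tu (le_trans us).
  apply: hb_leB (FB (inT uI) (inT (reflP uI))).
  have L20' : 0 <= L2.
    by rewrite /L2 /L1; have := hb_ge0 (a5 (inT tI)) => M0; rewrite addr_ge0 ?mulr_ge0 ?sqr_ge0.
  rewrite ler_wpM2l // /refl; case/andP: uI => ? ?; rewrite ler_norml; lra.
apply: hb_mono => [k|]; last first.
  by rewrite ler_wpM2l //; case/andP: sI => ? ?; lra.
apply: eq_le_bound; rewrite /de /m /W /refl.
have -> : t + t + tau - t = t + tau by ring.
have e : (2^-1)%:C * (a t k + a (t + tau) k) + (2^-1)%:C * (a t k + a (t + tau) k) =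
    a t k + a (t + tau) k :> C.
  by rewrite -mulrDl halfC mul1r.
by rewrite -[in RHS]e; ring.
Qed.

(** The defect of a step stopped at time s, with [W] frozen at its value for the full step. It
    vanishes at s = t and is the local error at s = t + tau. *)
Let D s k := a s k - a t k - cv (ksym t (s - t)) W W k.

Let G s k := F s k - cv (psym s) m m k.

Let D_der s k : t <= s <= t + tau -> cder t (t + tau) (fun u => D u k) s (G s k).
Proof.
move=> sI; rewrite /D /G.
have finW : fin W by apply: finD; apply: finA; exact: inT.
have finm : fin m by exact: finZ.
apply: cderD; last first.
  apply: cderN; apply: (@cder_csum _ _ _ _ _ _ (fun j => w k ^+ 2 * (wn 2 W j * wn 2 W (k - j)))).
  - move=> u; apply: cv_summ0 => //; exact: bsym_ksym.
  - apply: cv_summ0 => //; exact: bsym_psym.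
  - have W2 : hb 2 W (M + M) by apply: hb_ler (hbD (a5 (inT tI)) (a5 (inT tI'))).
    by apply: summZ; apply: (summM W2); exact: (l2_inj (can_inj (@subrKi k)) W2).
  - move=> u j.
    (* At j = 0 and j = k the symbol [ksym] vanishes through the default value of [dsym], while
       [psym] need not. There the derivative relation between them can fail, and the zero mean of W
       makes both products vanish. *)
    have W0 : W 0 = 0 by rewrite /W !a0 ?addr0 //; exact: inT.
    have [->|j0] := eqVneq j 0.
      rewrite /m W0 !(mulr0, mul0r) !subrr normc0.
      by rewrite mulr_ge0 ?sqr_ge0 // mulr_ge0 ?sqr_ge0 // mulr_ge0 ?wn_ge0.
    have [<-|kj] := eqVneq j k.
      rewrite /m subrr W0 !(mulr0, mul0r) !subrr normc0.
      by rewrite mulr_ge0 ?sqr_ge0 // mulr_ge0 ?sqr_ge0 // mulr_ge0 ?wn_ge0.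
    have kj0 : k - j != 0 by rewrite subr_eq0 eq_sym.
    set z := (k * j * (k - j))%:~R : R.
    have E : ksym t (u - t) k j * W j * W (k - j) - ksym t (s - t) k j * W j * W (k - j)
       - (u - s)%:C * (psym s k j * m j * m (k - j)) =
       (24^-1)%:C * (th u k j - th s k j - (0 +i* (- (3 * u * z) - - (3 * s * z))) * th s k j)
         * dsym R j * dsym R (k - j) * W j * W (k - j).
      rewrite /ksym /psym /m ![t + (_ - t)]addrC !subrK.
      set A := th u k j; set B := th s k j; set Bt := th t k j.
      have -> : (u - s)%:C * ((0 +i* (k%:~R / 2)) * B * ((2^-1)%:C * W j) * ((2^-1)%:C * W (k - j))) =
        ((u - s)%:C * (0 +i* (k%:~R / 2)) * (2^-1)%:C * (2^-1)%:C) * B * W j * W (k - j) by ring.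
      (* This is where the 1/24 of the rule is forced: 3/24 = (1/2) (1/2)^2, the 3 from the phase,
         one 1/2 from the equation and two from m = W / 2. *)
      have -> : (u - s)%:C * (0 +i* (k%:~R / 2)) * (2^-1)%:C * (2^-1)%:C =
        (24^-1)%:C * (0 +i* (- (3 * u * z) - - (3 * s * z))) * dsym R j * dsym R (k - j) :> C.
        rewrite !dsymE //.
        rewrite /z !rmorphM /=; apply/eqP; rewrite eq_complex /=; apply/andP; split; apply/eqP; first by ring.
        have : (k - j)%:~R != 0 :> R by rewrite intr_eq0.
        have : j%:~R != 0 :> R by rewrite intr_eq0.
        move: (j%:~R : R) ((k - j)%:~R : R) => b c b0 c0.
        by field; rewrite b0 c0.
      by ring.
    rewrite E !normcM normcR ger0_norm ?invr_ge0 //.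
    have h1 := cis_taylor (- (3 * s * z)) (- (3 * u * z)).
    have h2 := abs_w3 R k j; rewrite -/z in h2.
    have h3 : z ^+ 2 <= (w k * (w j * w (k - j))) ^+ 2.
      by rewrite -real_normK ?num_real // ler_sqr ?nnegrE // (le_trans _ h2).
    have n1 := normc_dsym R j; have n2 := normc_dsym R (k - j).
    have n10 := normc_ge0 (dsym R j); have n20 := normc_ge0 (dsym R (k - j)).
    have w0 := normc_ge0 (W j); have w1 := normc_ge0 (W (k - j)).
    rewrite /wn -/(th u k j) -/(th s k j) in h1 *.
    set X := normc (th u k j - _ - _) in h1 *.
    have X0 : 0 <= X by exact: normc_ge0.
    (* The Taylor remainder is twice the square of the phase increment 3 (u - s) z. The squared
       weights at j and k - j produce the [wn 2] of the majorant, and 18/24 <= 1. *)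
    have h4 : X <= 18 * (u - s) ^+ 2 * (w k * (w j * w (k - j))) ^+ 2.
      apply: le_trans h1 _; have := ler_wpM2l (sqr_ge0 (u - s)) h3; lra.
    have h5 : 24^-1 * X * normc (dsym R j) * normc (dsym R (k - j)) <= 24^-1 * X * 1 * 1.
      by do 2 (apply: ler_pM => //; rewrite ?mulr_ge0 ?invr_ge0 //).
    have h6 := ler_wpM2r (mulr_ge0 w0 w1) h5.
    have h7 := ler_wpM2r (mulr_ge0 w0 w1) h4.
    have h8 : 0 <= (u - s) ^+ 2 * (w k * (w j * w (k - j))) ^+ 2 * (normc (W j) * normc (W (k - j))).
      by apply: mulr_ge0; [apply: mulr_ge0; exact: sqr_ge0|exact: mulr_ge0].
    lra.
rewrite -[F s k]addr0; apply: cderD; last by rewrite -oppr0; apply: cderN; exact: cder_cst.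
by apply: cder_sub (ader k (inT sI)).
Qed.

Let G_hb s : t <= s <= t + tau -> hb 1 (fun k => G s k + G (refl s) k) (loc_cst * tau ^+ 2).
Proof.
move=> sI; have rI := reflP sI.
have finm : fin m by exact: hb_fin m5.
have find u : t <= u <= t + tau -> fin (de u) by move=> /de4 /hb_fin.
have fina u : t <= u <= t + tau -> fin (a u) by move=> /inT /finA.
have D2 := deD sI; have ds := de4 sI; have dr := de4 rI.
have as_ := a5 (inT sI); have ar := a5 (inT rI).
have la := lip4 (inT rI) (inT sI).
have h1 := psym_hb (r := 1) s D2 (hb_ler (isT : (2 <= 5)%N) as_).
have h1' := psym_hb (r := 1) s (hb_ler (isT : (2 <= 5)%N) m5) D2.
have h2 := psymB_hb (r := 1) (refl s) s dr (hb_ler (isT : (4 <= 5)%N) as_).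
have h2' := psymB_hb (r := 1) (refl s) s (hb_ler (isT : (4 <= 5)%N) m5) dr.
have h3 := psym_hb (r := 1) (refl s) (hb_ler (isT : (2 <= 4)%N) dr) (hb_ler (isT : (2 <= 4)%N) la).
apply: hb_mono (hbD (hbD (hbD h1 h1') (hbD h2 h2')) h3) => [k|].
  have find' : fin (fun k => de s k + de (refl s) k) by exact: finD (find _ sI) (find _ rI).
  have fs := find _ sI; have fr := find _ rI; have gs := fina _ sI; have gr := fina _ rI.
  (* The difference of the two quadratic terms is factored through a - m, in the form that [cv_pair]
     expects. *)
  have E u : t <= u <= t + tau ->
      G u k = cv (psym u) (de u) (a u) k + cv (psym u) m (de u) k.
    move=> uI; have fu := fina _ uI.
    rewrite /G /F /de cvBl ?cvBr //; do ?exact: bsym_psym.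
    by rewrite addrA subrK.
  apply: eq_le_bound; rewrite (E _ sI) (E _ rI).
  by apply: cv_pair => //; exact: bsym_psym.
have rs : `|refl s - s| <= tau by rewrite /refl; case/andP: sI => ? ?; rewrite ler_norml; lra.
have M0 : 0 <= M by exact: hb_ge0 m5.
have L10 : 0 <= L1 by rewrite mulr_ge0 ?sqr_ge0.
have := ler_wpM2l (mulr_ge0 (mulr_ge0 L10 tau0) M0) rs.
have := ler_wpM2l (mulr_ge0 (mulr_ge0 L10 tau0) L10) rs.
rewrite /loc_cst; lra.
Qed.

(** D(u) - D(refl u) has derivative G(u) + G(refl u), which is O(tau^2). As u runs from t to t + tau
    it increases by 2 D(t + tau), because D(t) = 0. *)
Lemma local_error : hb 1 (fun k => a (t + tau) k - a t k - cv (ksym t tau) W W k)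
  (loc_cst * tau ^+ 3).
Proof.
have h := @hb_mvt R 1 t (t + tau) (fun u k => D u k - D (refl u) k)
  (fun u k => G u k + G (refl u) k) (loc_cst * tau ^+ 2).
have {h} := h _ _ G_hb; rewrite [t + tau - t]addrAC subrr add0r.
have -> : loc_cst * tau ^+ 2 * tau = loc_cst * tau ^+ 3 by ring.
move=> h; apply: hb_mono (h _ _) => // [k||u k uI].
- rewrite /refl.
  have -> : t + t + tau - (t + tau) = t by ring.
  have -> : t + t + tau - t = t + tau by ring.
  have D0 : D t k = 0.
    rewrite /D subrr add0r /cv subrr (_ : (fun _ => _) = fun=> 0).
      by rewrite (csum_fin (N := 0)) ?big1 ?oppr0.
    by apply/funext => j; rewrite /ksym addr0 subrr mulr0 !mul0r.
  have -> : a (t + tau) k - a t k - cv (ksym t tau) W W k = D (t + tau) k.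
    by rewrite /D [t + tau - t]addrAC subrr add0r.
  rewrite D0 subr0 sub0r opprK; set z := D _ k.
  have -> : z + z = 2%:C * z by rewrite (_ : 2%:C = 1 + 1) ?mulrDl ?mul1r // -rmorphD.
  by rewrite normcM normcR ger0_norm // ler_peMl ?normc_ge0 // ler1n.
- by rewrite lerDl.
- rewrite -[G u k + _]/(G u k + _); apply: cderD; first exact: D_der.
  rewrite -[G (refl u) k]opprK; apply: cderN.
  apply: (@cder_refl R t (t + tau) (fun v => D v k) u (G (refl u) k) (t + t + tau)).
  apply: cder_sub (D_der k (reflP uI)); rewrite /refl; lra.
Qed.

End LocalError.

(** * Energy estimate *)

Section Energy.
Variable R : realType.
Local Notation C := R[i].
Local Notation w := (japanese R).
Implicit Types (x y z : int -> C) (A B : R).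

Definition ip x y : R := rsum (fun k => w k ^+ 2 * complex.Re (x k * conjc (y k))).

Lemma ip_term x y k :
  `|w k ^+ 2 * complex.Re (x k * conjc (y k))| <= wn 1 x k * wn 1 y k.
Proof.
rewrite normrM ger0_norm ?wX_ge0 // /wn !expr1 mulrACA -expr2 ler_wpM2l ?wX_ge0 //.
by apply: le_trans (normc_Re _) _; rewrite normcM normc_conj.
Qed.

Lemma ip_summ x y A B : hb 1 x A -> hb 1 y B ->
  summ (fun k => w k ^+ 2 * complex.Re (x k * conjc (y k))).
Proof.
move=> hx hy; apply: summ_le (summM hx hy) => k.
by apply: le_trans (ip_term _ _ _) _; rewrite ler_norm.
Qed.

Lemma ip_CS x y A B : hb 1 x A -> hb 1 y B -> `|ip x y| <= A * B.
Proof.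
move=> hx hy; have sxy := ip_summ hx hy.
apply: le_trans (ler_norm_rsum sxy) _.
apply: (@le_trans _ _ (rsum (fun k => wn 1 x k * wn 1 y k))).
  apply: rsum_le => [k||]; [exact: ip_term| |exact: (summM hx hy)].
  by apply: summ_le sxy => k; rewrite normr_id.
by apply: le_trans (ler_norm _) _; exact: (rsum_CS hx hy).
Qed.

Lemma ipDl x x' y A A' B : hb 1 x A -> hb 1 x' A' -> hb 1 y B ->
  ip (fun k => x k + x' k) y = ip x y + ip x' y.
Proof.
move=> hx hx' hy; rewrite /ip -rsumD; [|exact: (ip_summ hx hy)|exact: ip_summ hx' hy].
by apply: eq_rsum => k; rewrite mulrDl ReD mulrDr.
Qed.

Lemma ipBl x x' y A A' B : hb 1 x A -> hb 1 x' A' -> hb 1 y B ->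
  ip (fun k => x k - x' k) y = ip x y - ip x' y.
Proof.
move=> hx hx' hy; rewrite /ip -rsumB; [|exact: (ip_summ hx hy)|exact: ip_summ hx' hy].
by apply: eq_rsum => k; rewrite mulrBl ReD ReN mulrDr mulrN.
Qed.

Lemma ip_sqr x k : w k ^+ 2 * complex.Re (x k * conjc (x k)) = wn 1 x k ^+ 2.
Proof.
rewrite /wn expr1 exprMn -sqnormcE; case: (x k) => a b; rewrite /sqnormc /=; ring.
Qed.

Lemma ip_ge0 x A : hb 1 x A -> 0 <= ip x x.
Proof.
by move=> hx; apply: rsum_ge0 (ip_summ hx hx) => k; rewrite ip_sqr sqr_ge0.
Qed.

Lemma ip_hb x A : hb 1 x A -> hb 1 x (Num.sqrt (ip x x)).
Proof.
move=> hx; split; first exact: sqrtr_ge0.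
rewrite sqr_sqrtr; last exact: ip_ge0 hx.
move=> s us; rewrite (eq_bigr _ (fun k _ => esym (ip_sqr x k))).
by apply: sum_le_rsum us; [move=> k; rewrite ip_sqr sqr_ge0|exact: (ip_summ hx hx)].
Qed.

Lemma ip_leP x A B : hb 1 x A -> hb 1 x B -> ip x x <= B ^+ 2.
Proof.
move=> hx [B0 hB]; apply: rsum_leB; first exact: (ip_summ hx hx).
by apply: sumB_le hB => // k; rewrite ip_sqr.
Qed.

(** Polarisation. It explains why the energy argument tests the increment of the error against the
    sum of two consecutive errors. *)
Lemma ip_diff_sqr x y A B : hb 1 x A -> hb 1 y B ->
  ip x x - ip y y = ip (fun k => x k - y k) (fun k => x k + y k).
Proof.
move=> hx hy; rewrite /ip -rsumB; [|exact: (ip_summ hx hx)|exact: (ip_summ hy hy)].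
apply: eq_rsum => k; rewrite -mulrBr; congr (_ * _).
by case: (x k) => a b; case: (y k) => c d /=; ring.
Qed.

Lemma hb_tail r x A : hb r x A -> forall e, 0 < e ->
  exists N, hb r (fun k => if k \in Zs N then 0 else x k) e.
Proof.
move=> hx e e0.
have sx : summ (fun k => wn r x k ^+ 2).
  by case: hx => _ h; apply: sumB_summ h => k; exact: sqr_ge0.
have [N HN] := summ_tail sx (exprn_gt0 2 e0).
exists N; split; first exact: ltW.
move=> s us; apply: le_trans (HN [seq k <- s | k \notin Zs N] _ _); last 2 first.
- by rewrite filter_uniq.
- by move=> k; rewrite mem_filter => /andP[].
rewrite big_filter [leLHS](bigID (mem (Zs N))) /= big1 ?add0r; last first.
  by move=> k kN; rewrite /wn kN normc0 mulr0 expr0n.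
by apply: ler_sum => k /negPf kN; rewrite /wn kN ler_norm.
Qed.

Lemma th_sym t k j : th t k (k - j) = th t k j :> C.
Proof. by rewrite /th subrKi; congr (cis (- (_ * _%:~R))); ring. Qed.

Lemma ksym_sym t tau k j : ksym t tau k (k - j) = ksym t tau k j :> C.
Proof. by rewrite /ksym !th_sym subrKi; ring. Qed.

Lemma cv_ksym_sym t tau x y k : fin x -> fin y ->
  cv (ksym t tau) x y k = cv (ksym t tau) y x k.
Proof.
move=> fx fy; have s := cv_summ0 k (bsym_ksym t tau) fy fx.
rewrite /cv -(csum_bij (subrKi k) (subrKi k) s).
by apply: eq_csum => j /=; rewrite subrKi ksym_sym; ring.
Qed.

Section Pairing.
Variables (t tau A : R) (E : int -> C).
Hypothesis tau0 : 0 <= tau.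
Hypothesis E0 : E 0 = 0.
Hypothesis Econj : forall k, E (- k) = conjc (E k).
Hypothesis hE : hb 1 E A.

Let g (W : int -> C) (j k : int) : R :=
  w k ^+ 2 * complex.Re (ksym t tau k j * W j * E (k - j) * conjc (E k)).

Let E_shift j : l2 (fun k => wn 1 E (k - j)) A.
Proof. by apply: (l2_inj (p := fun k => k - j) _ hE) => a b; lia. Qed.

Let g_summ W j : summ (g W j).
Proof.
apply: summ_le (summZ (Num.sqrt tau * normc (W j) * (2 * w j)) (summM (E_shift j) hE)) => k.
rewrite [leRHS]ger0_norm; last first.
  by rewrite !mulr_ge0 ?sqrtr_ge0 ?normc_ge0 ?wn_ge0 ?w_ge0.
rewrite normrM ger0_norm ?wX_ge0 //.
have h1 : `|complex.Re (ksym t tau k j * W j * E (k - j) * conjc (E k))| <=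
    Num.sqrt tau * normc (W j) * normc (E (k - j)) * normc (E k).
  have := ksym_sqrt t k j tau0; move: (ksym t tau k j) => K hK.
  apply: le_trans (normc_Re _) _; rewrite !normcM normc_conj.
  by do 3 (rewrite ler_wpM2r ?normc_ge0 //).
have h2 := w_le2M R k j.
rewrite /wn !expr1 expr2.
set q := Num.sqrt tau * normc (W j) * normc (E (k - j)) * normc (E k) in h1.
have q0 : 0 <= q by rewrite !mulr_ge0 ?sqrtr_ge0 ?normc_ge0.
have h3 : w k * w k * `|complex.Re (ksym t tau k j * W j * E (k - j) * conjc (E k))| <= w k * w k * q.
  by rewrite ler_wpM2l // mulr_ge0 ?w_ge0.
have h4 : w k * q * w k <= w k * q * (2 * (w j * w (k - j))).
  by rewrite ler_wpM2l // mulr_ge0 ?w_ge0.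
apply: le_trans h3 _; rewrite mulrAC; apply: le_trans h4 _; rewrite /q; lra.
Qed.

(* Exchanging the two E factors, k <-> j - k, turns k^2 into
   (k^3 - (k - j)^3) / (k j (k - j)), and this gains one derivative on E. *)
Let g_pair W j k :
  `|g W j k + g W j (j - k)| <= tau / 2 * wn 3 W j * (wn 1 E k * wn 1 E (k - j)).
Proof.
have rhs0 : 0 <= tau / 2 * wn 3 W j * (wn 1 E k * wn 1 E (k - j)).
  apply: mulr_ge0; last by apply: mulr_ge0; exact: wn_ge0.
  by apply: mulr_ge0; [rewrite mulr_ge0 ?invr_ge0|exact: wn_ge0].
have Re0 : complex.Re (0 : C) = 0 by [].
have e1 : j - k - j = - k by ring.
rewrite /g e1 Econj.
have -> : conjc (E (j - k)) = E (k - j) by rewrite -opprB Econj conjcK.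
have [k0|k0] := eqVneq k 0.
  have Ek : E k = 0 by rewrite k0.
  have -> : ksym t tau k j * W j * E (k - j) * conjc (E k) = 0 by rewrite Ek conjc0 mulr0.
  have -> : ksym t tau (j - k) j * W j * conjc (E k) * E (k - j) = 0 by rewrite Ek conjc0 mulr0 mul0r.
  by rewrite Re0 !mulr0 addr0 normr0.
have [kj|kj] := eqVneq k j.
  have Ekj : E (k - j) = 0 by rewrite kj subrr.
  have -> : ksym t tau k j * W j * E (k - j) * conjc (E k) = 0 by rewrite Ekj mulr0 mul0r.
  have -> : ksym t tau (j - k) j * W j * conjc (E k) * E (k - j) = 0 by rewrite Ekj mulr0.
  by rewrite Re0 !mulr0 addr0 normr0.
have [j0|j0] := eqVneq j 0.
  have dj : dsym R j = 0 by rewrite /dsym j0 eqxx.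
  have -> : ksym t tau k j * W j * E (k - j) * conjc (E k) = 0 by rewrite /ksym dj mulr0 !mul0r.
  have -> : ksym t tau (j - k) j * W j * conjc (E k) * E (k - j) = 0 by rewrite /ksym dj mulr0 !mul0r.
  by rewrite Re0 !mulr0 addr0 normr0.
have kj0 : k - j != 0 by rewrite subr_eq0.
have jk0 : j - k != 0 by rewrite subr_eq0 eq_sym.
have thE s : th s (j - k) j = th s k j :> C.
  by rewrite /th; congr (cis (- (_ * _%:~R))); ring.
rewrite /ksym e1 !thE !dsymE ?oppr_eq0 // /wn !w_int // !expr1.
have h := th_lip (t + tau) t k j; rewrite [t + tau]addrC addrK (ger0_norm tau0) in h.
rewrite ![tau + t]addrC in h *.
set mu := th (t + tau) k j - th t k j in h *.
have ek : `|(j - k)%:~R : R| = `|(k - j)%:~R| by rewrite -opprB rmorphN normrN.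
have enk : (- k)%:~R = - k%:~R :> R by rewrite rmorphN.
rewrite ek !real_normK ?num_real // enk.
have nk : k%:~R != 0 :> R by rewrite intr_eq0.
have nj : j%:~R != 0 :> R by rewrite intr_eq0.
have nkj : (k - j)%:~R != 0 :> R by rewrite intr_eq0.
have gk : 1 <= `|k%:~R : R| by rewrite -w_int // w_ge1.
have gj : 1 <= `|j%:~R : R| by rewrite -w_int // w_ge1.
have gkj : 1 <= `|(k - j)%:~R : R| by rewrite -w_int // w_ge1.
rewrite !rmorphM /= !normrM in h.
have ekj : (k - j)%:~R = k%:~R - j%:~R :> R by rewrite rmorphB.
move: (k%:~R : R) (j%:~R : R) ((k - j)%:~R : R) nk nj nkj gk gj gkj ekj h {ek enk}.
move=> a b c na nb nc ga gb gc ec h.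
set Z := W j * E (k - j) * conjc (E k).
have -> : a ^+ 2 * complex.Re ((24^-1)%:C * mu * (0 +i* (- b^-1)) * (0 +i* (- c^-1))
      * W j * E (k - j) * conjc (E k)) +
   c ^+ 2 * complex.Re ((24^-1)%:C * mu * (0 +i* (- b^-1)) * (0 +i* (- (- a)^-1))
      * W j * conjc (E k) * E (k - j)) =
   - ((24 * b * c)^-1 * a ^+ 2 - (24 * a * b)^-1 * c ^+ 2) * complex.Re (mu * Z).
  have -> : (24^-1)%:C * mu * (0 +i* (- b^-1)) * (0 +i* (- c^-1))
      * W j * E (k - j) * conjc (E k) =
      ((24^-1)%:C * (0 +i* (- b^-1)) * (0 +i* (- c^-1))) * (mu * Z) by rewrite /Z; ring.
  have -> : (24^-1)%:C * mu * (0 +i* (- b^-1)) * (0 +i* (- (- a)^-1))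
      * W j * conjc (E k) * E (k - j) =
      ((24^-1)%:C * (0 +i* (- b^-1)) * (0 +i* (- (- a)^-1))) * (mu * Z) by rewrite /Z; ring.
  case: (mu * Z) => p q /=; field; by rewrite na nb nc.
(* With a = b + c, the numerator is a^3 - c^3 = b (3 a c + b^2): the factor b, the frequency of W,
   replaces one frequency of E. *)
have -> : - ((24 * b * c)^-1 * a ^+ 2 - (24 * a * b)^-1 * c ^+ 2) =
    - (24 * (a * b * c))^-1 * (b * (3 * (a * c) + b ^+ 2)).
  by rewrite ec; field; rewrite -ec na nb nc.
rewrite !normrM normrN normfV !normrM.
have hZ : `|complex.Re (mu * Z)| <= 3 * tau * (`|a| * `|b| * `|c|) * normc Z.
  by apply: le_trans (normc_Re _) _; rewrite normcM ler_wpM2r ?normc_ge0.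
have hb : `|3 * (a * c) + b ^+ 2| <= 4 * (`|a| * `|c|) * `|b| ^+ 2.
  apply: le_trans (ler_normD _ _) _; rewrite normrX !normrM ger0_norm //.
  have h1 : 1 <= `|a| * `|c| by rewrite -[leLHS]mulr1 ler_pM.
  have h2 : 1 <= `|b| ^+ 2 by rewrite exprn_ege1.
  by move: h1 h2; set u := `|a| * `|c|; set v := `|b| ^+ 2 => h1 h2; nra.
have nZ : normc Z = normc (W j) * normc (E (k - j)) * normc (E k).
  by rewrite /Z !normcM normc_conj.
rewrite nZ in hZ; have -> : `|24 : R| = 24 by rewrite ger0_norm.
have a0 := lt_le_trans ltr01 ga; have b0 := lt_le_trans ltr01 gb; have c0 := lt_le_trans ltr01 gc.
set a' := `|a| in hZ hb a0 *; set b' := `|b| in hZ hb b0 *; set c' := `|c| in hZ hb c0 *.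
have z0 : 0 <= normc (W j) * normc (E (k - j)) * normc (E k) by rewrite !mulr_ge0 ?normc_ge0.
have i0 : 0 <= (24 * (a' * b' * c'))^-1 * b'.
  by rewrite mulr_ge0 ?invr_ge0 // ?(ltW b0) // !mulr_ge0 // ltW.
(* The factor a b c from the phase cancels the denominator. Of the remaining a c b^3, one power goes
   to each E and three go to W, and 4 times 3 over 24 is 1/2. *)
apply: (@le_trans _ _ ((24 * (a' * b' * c'))^-1 * b' * (4 * (a' * c') * b' ^+ 2) *
   (3 * tau * (a' * b' * c') * (normc (W j) * normc (E (k - j)) * normc (E k))))).
  rewrite [X in X * _ <= _]mulrA; apply: ler_pM => //; first by rewrite mulr_ge0.
  by rewrite ler_wpM2l.
rewrite le_eqVlt; apply/orP; left; apply/eqP; field.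
by rewrite !gt_eqF.
Qed.

(** The sum over k is invariant under k -> j - k, so twice the sum is the sum of the pairs bounded
    in [g_pair]; Cauchy-Schwarz then handles the two factors E. *)
Let g_rsum W j : `|rsum (g W j)| <= tau / 4 * wn 3 W j * (A * A).
Proof.
have sg := g_summ W j; have sg' := summ_inj (can_inj (@subrKi j)) sg.
have e : 2 * rsum (g W j) = rsum (fun k => g W j k + g W j (j - k)).
  rewrite rsumD //.
  by rewrite -[rsum (fun k => g W j (j - k))]/(rsum (g W j \o (fun k => j - k)))
    (rsum_bij (subrKi j) (subrKi j) sg); ring.
have : `|2 * rsum (g W j)| <= tau / 2 * wn 3 W j * (A * A).
  rewrite e; have sp := summD sg sg'.
  apply: le_trans (ler_norm_rsum sp) _.
  apply: (@le_trans _ _ (rsum (fun k => tau / 2 * wn 3 W j * (wn 1 E k * wn 1 E (k - j))))).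
    apply: rsum_le => [k||]; first exact: g_pair.
      by apply: summ_le sp => k; rewrite normr_id.
    by apply: summZ; exact: (summM hE (E_shift j)).
  rewrite rsumZ; last exact: (summM hE (E_shift j)).
  rewrite ler_wpM2l //; first by apply: mulr_ge0; [exact: mulr_ge0|exact: wn_ge0].
  by apply: le_trans (ler_norm _) _; exact: (rsum_CS hE (E_shift j)).
rewrite normrM ger0_norm //; lra.
Qed.

(** With W cut to finitely many frequencies, the sum over j is finite and can be taken outside the
    sum over k, where the symmetrisation is done for fixed j. *)
Let W_trunc (W : int -> C) n k : C := if k \in Zs n then W k else 0.

Let trunc_ip W n B : sumB (wn 3 W) B ->
  `|ip (cv (ksym t tau) (W_trunc W n) E) E| <= tau / 4 * B * (A * A).
Proof.
move=> hW.
have -> : ip (cv (ksym t tau) (W_trunc W n) E) E = rsum (fun k => \sum_(j <- Zs n) g W j k).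
  apply: eq_rsum => k; rewrite /cv (csum_fin (N := n)).
    rewrite big_distrl Re_sum mulr_sumr; apply: eq_big_seq => j jn.
    by rewrite /g /W_trunc jn.
  by move=> j /negPf jn; rewrite /W_trunc jn mulr0 mul0r.
rewrite rsum_sum; last by move=> j; exact: g_summ.
apply: (@le_trans _ _ (\sum_(j <- Zs n) tau / 4 * wn 3 W j * (A * A))).
  apply: le_trans (ler_norm_sum _ _ _) _; apply: ler_sum => j _; exact: g_rsum.
rewrite -mulr_suml -mulr_sumr ler_wpM2r ?mulr_ge0 ?(hb_ge0 hE) //.
by rewrite ler_wpM2l ?mulr_ge0 ?invr_ge0 // hW // Zs_uniq.
Qed.

(** The bound for truncated W is uniform in the truncation. The tail of W is small in H^1, and for
    it the plain estimate [ksym_hb] suffices. *)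
Lemma energy W B D : hb 1 W D -> sumB (wn 3 W) B ->
  `|ip (cv (ksym t tau) W E) E| <= tau / 4 * B * (A * A).
Proof.
move=> W1 hW; apply/ler_addgt0Pr => e e0.
have A0 := hb_ge0 hE.
(* Chosen so that a tail of size e / K contributes at most e; the + 1 keeps K positive. *)
pose K := 12 * Num.sqrt tau * A * A + 1.
have K0 : 0 < K by rewrite ltr_pwDr // !mulr_ge0 ?sqrtr_ge0.
have [n hn] := hb_tail W1 (divr_gt0 e0 K0).
set V := fun k => if _ then _ else _ in hn.
have T1 : hb 1 (W_trunc W n) D.
  by apply: hb_mono W1 => // k; rewrite /W_trunc; case: ifP => // _; rewrite normc0 normc_ge0.
have EW : W = (fun k => W_trunc W n k + V k).
  by apply/funext => k; rewrite /W_trunc /V; case: ifP; rewrite ?addr0 ?add0r.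
have -> : cv (ksym t tau) W E = fun k => cv (ksym t tau) (W_trunc W n) E k + cv (ksym t tau) V E k.
  by apply/funext => k; rewrite {1}EW cvDl //; [exact: bsym_ksym|exact: hb_fin T1|exact: hb_fin hn|exact: hb_fin hE].
have c1 := ksym_hb t tau0 T1 hE; have c2 := ksym_hb t tau0 hn hE.
rewrite (ipDl c1 c2 hE); apply: le_trans (ler_normD _ _) _; rewrite lerD //.
  exact: trunc_ip.
apply: le_trans (ip_CS c2 hE) _.
have -> : 12 * Num.sqrt tau * (e / K * A) * A = e * ((12 * Num.sqrt tau * A * A) / K) by ring.
by rewrite ler_piMr ?(ltW e0) // ler_pdivrMr // mul1r /K lerDl.
Qed.

End Pairing.

(** The two cross terms coincide because [ksym] is invariant under j -> k - j; [energy] is therefore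
    counted twice. *)
Lemma energy_step t tau A B D L E W loc : 0 <= tau -> E 0 = 0 ->
  (forall k, E (- k) = conjc (E k)) -> hb 1 E A -> hb 1 W D -> sumB (wn 3 W) B ->
  hb 1 loc L ->
  ip (fun k => cv (ksym t tau) (fun k => W k + E k) (fun k => W k + E k) k
     - cv (ksym t tau) W W k - loc k) E
  <= (tau / 2 * B + 12 * Num.sqrt tau * A) * A ^+ 2 + L * A.
Proof.
move=> tau0 E0 Ec hE hD hW hl.
have fE := hb_fin hE; have fW := hb_fin hD; have bs := @bsym_ksym R t tau.
have -> : (fun k => cv (ksym t tau) (fun k => W k + E k) (fun k => W k + E k) k
     - cv (ksym t tau) W W k - loc k) =
  (fun k => (cv (ksym t tau) W E k + cv (ksym t tau) W E k) + cv (ksym t tau) E E k - loc k).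
  apply/funext => k; rewrite cvDl ?cvDr //; try exact: finD.
  by rewrite [cv _ E W k]cv_ksym_sym //; ring.
have c1 := ksym_hb t tau0 hD hE; have c2 := ksym_hb t tau0 hE hE.
rewrite (ipBl (hbD (hbD c1 c1) c2) hl hE) (ipDl (hbD c1 c1) c2 hE) (ipDl c1 c1 hE).
have := energy t tau0 E0 Ec hE hD hW; have := ip_CS c2 hE; have := ip_CS hl hE.
rewrite !ler_norml; move=> /andP[h1 _] /andP[_ h2] /andP[_ h3]; lra.
Qed.

End Energy.

(** * The fixed-point iteration *)

Section FixedPoint.
Variable R : realType.
Local Notation C := R[i].
Implicit Types (x y z u v : int -> C) (A B D t tau e : R).

Definition psi t tau x u k : C :=
  x k + cv (ksym t tau) (fun j => u j + x j) (fun j => u j + x j) k.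

Definition hcvg (X : nat -> int -> C) z := forall e, 0 < e ->
  exists N, forall m, (N <= m)%N -> hb 1 (fun k => X m k - z k) e.

Lemma cvBB p x y k : bsym p -> fin x -> fin y ->
  cv p x x k - cv p y y k = cv p (fun j => x j - y j) x k + cv p y (fun j => x j - y j) k.
Proof. by move=> bp fx fy; rewrite cvBl // cvBr //; ring. Qed.

Section Contraction.
Variables (t tau A : R) (x : int -> C).
Hypotheses (tau0 : 0 <= tau) (hx : hb 1 x A) (small : 144 * (Num.sqrt tau * A) <= 1).

Let q0 : 0 <= Num.sqrt tau. Proof. exact: sqrtr_ge0. Qed.
Let A0 : 0 <= A. Proof. exact: hb_ge0 hx. Qed.

Lemma psi_hb u : hb 1 u (2 * A) -> hb 1 (psi t tau x u) (2 * A).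
Proof.
move=> hu; have hs := hbD hu hx.
apply: hb_leB (hbD hx (ksym_hb t tau0 hs hs)).
have := ler_wpM2r A0 small; have := mulr_ge0 (mulr_ge0 q0 A0) A0; lra.
Qed.

(** Origin of 144: the two terms of the difference have one factor D and one factor at most 3 A, so
    the constant is 2 times 12 times 3 = 72, and a Lipschitz constant 1/2 asks for twice that. *)
Lemma psi_lip u v D : hb 1 u (2 * A) -> hb 1 v (2 * A) ->
  hb 1 (fun k => u k - v k) D ->
  hb 1 (fun k => psi t tau x u k - psi t tau x v k) (D / 2).
Proof.
move=> hu hv hD; have D0 := hb_ge0 hD.
have hu' := hbD hu hx; have hv' := hbD hv hx.
apply: hb_mono (hbD (ksym_hb t tau0 hD hu') (ksym_hb t tau0 hv' hD)) => [k|].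
  apply: eq_le_bound; rewrite /psi.
  have -> : (fun k => u k - v k) = (fun k => u k + x k - (v k + x k)).
    by apply/funext => j; ring.
  have := @cvBB (ksym t tau) (fun j => u j + x j) (fun j => v j + x j) k
    (bsym_ksym _ _) (hb_fin hu') (hb_fin hv') => <-.
  by ring.
have := ler_wpM2r D0 small; lra.
Qed.

Let X m := iter m (psi t tau x) x.

Lemma iter_hb m : hb 1 (X m) (2 * A).
Proof.
elim: m => [|m IH]; last exact: psi_hb.
by apply: hb_leB hx; have := A0; lra.
Qed.

Let iter_diff m : hb 1 (fun k => X m.+1 k - X m k) (4 * A / 2 ^+ m).
Proof.
elim: m => [|m IH].
  by apply: hb_leB (hbB (iter_hb 1) (iter_hb 0)); rewrite expr0; lra.
have -> : 4 * A / 2 ^+ m.+1 = 4 * A / 2 ^+ m / 2.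
  by rewrite exprS; field; rewrite expf_neq0.
exact: psi_lip (iter_hb _) (iter_hb _) IH.
Qed.

Let iter_cauchy m p : hb 1 (fun k => X (m + p)%N k - X m k) (8 * A / 2 ^+ m).
Proof.
elim: p m => [|p IH] m.
  have hz : hb 1 (fun k => 0 * x k) (normc (0 : C) * A) by exact: hbZ.
  rewrite normc0 mul0r in hz; apply: hb_mono hz => [k|].
    by rewrite addn0 subrr mul0r.
  by rewrite mulr_ge0 ?invr_ge0 ?exprn_ge0 // mulr_ge0.
apply: hb_mono (hbD (IH m.+1) (iter_diff m)) => [k|].
  by rewrite addnS addSn addrA subrK.
rewrite exprS; have : 0 < 2 ^+ m :> R by exact: exprn_gt0.
by move=> h; rewrite le_eqVlt; apply/orP; left; apply/eqP; field; rewrite gt_eqF.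
Qed.

Lemma half_small B e : 0 <= B -> 0 < e -> exists N, forall m, (N <= m)%N -> B / 2 ^+ m <= e.
Proof.
move=> B0 e0; have [n Bn] : exists n : nat, B / e <= n%:R.
  by exists (Num.bound (B / e)); apply: ltW; apply: archi_boundP; rewrite divr_ge0 // ltW.
exists n => m nm; rewrite ler_pdivrMr ?exprn_gt0 // mulrC -ler_pdivrMr //.
apply: le_trans Bn _; rewrite -natrX ler_nat (leq_trans nm) //.
by apply: ltnW; apply: ltn_expl.
Qed.

(** Each coefficient converges by completeness of the reals; [hb_fatou] then carries the geometric
    H^1 bound on X (m + p) - X m to the limit in p. *)
Lemma psi_limit : exists z, hcvg X z.
Proof.
have C8 : 0 <= 8 * A by rewrite mulr_ge0.
have cau k (f : C -> R) : (forall z1 z2 : C, f (z1 - z2) = f z1 - f z2) ->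
    (forall z : C, `|f z| <= normc z) -> cvg (f (X m k) @[m --> \oo]).
  move=> fB fn; apply: cauchy_cvg; apply: cauchy_exP => e e0.
  have [N HN] := half_small C8 (divr_gt0 e0 (ltr0n _ 2)).
  exists (f (X N k)); exists N => // m /= Nm.
  rewrite /ball /= -fB -(subnKC Nm).
  apply: le_lt_trans (fn _) _; rewrite normcB.
  apply: le_lt_trans (hb_point k (iter_cauchy N (m - N))) _.
  by apply: le_lt_trans (HN N (leqnn _)) _; lra.
have ReB (z1 z2 : C) : complex.Re (z1 - z2) = complex.Re z1 - complex.Re z2 by rewrite ReD ReN.
have ImB (z1 z2 : C) : complex.Im (z1 - z2) = complex.Im z1 - complex.Im z2 by rewrite ImD ImN.
have cR k := cau k (@complex.Re R) ReB (@normc_Re R).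
have cI k := cau k (@complex.Im R) ImB (@normc_Im R).
pose z k := lim (complex.Re (X m k) @[m --> \oo]) +i* lim (complex.Im (X m k) @[m --> \oo]).
exists z => e e0.
have [N HN] := half_small C8 e0; exists N => m Nm; apply: hb_leB (HN m Nm) _.
apply: (@hb_fatou _ _ (fun p k => X m k - X (m + p)%N k)) => [p|k e' e0'].
  by apply: hb_mono (iter_cauchy m p) => // k; rewrite normcB.
have e2 : 0 < e' / 2 by lra.
have /cvgrPdist_le /(_ _ e2) [N1 _ H1] := cR k.
have /cvgrPdist_le /(_ _ e2) [N2 _ H2] := cI k.
exists (maxn N1 N2) => p; rewrite geq_max => /andP[p1 p2].
have h1 := H1 (m + p)%N (leq_trans p1 (leq_addl _ _)).
have h2 := H2 (m + p)%N (leq_trans p2 (leq_addl _ _)).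
have -> : X m k - X (m + p)%N k - (X m k - z k) = z k - X (m + p)%N k by ring.
apply: le_trans (normc_leD _) _.
rewrite ReD ImD ReN ImN /= in h1 h2 *; lra.
Qed.

Lemma psi_fixed z : hcvg X z -> hb 1 z (2 * A) /\ forall k, z k = psi t tau x z k.
Proof.
move=> Xz.
have hz : hb 1 z (2 * A).
  apply: hb_closed => e e0; have [N HN] := Xz e e0.
  apply: hb_mono (hbB (iter_hb N) (HN N (leqnn _))) => // k.
  by rewrite opprB addrC subrK.
split=> // k; apply/eqP; rewrite -subr_eq0; apply/eqP; apply: normc_eq0_le => e e0.
have e2 : 0 < e / 2 by lra.
have [N HN] := Xz _ e2.
have h1 := hb_point k (HN N.+1 (leqnSn _)).
have h2 := hb_point k (psi_lip (iter_hb N) hz (HN N (leqnn _))).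
rewrite -[z k](subrK (X N.+1 k)) -addrA.
apply: le_trans (le_normcD _ _) _; rewrite normcB.
by apply: le_trans (lerD h1 h2) _; lra.
Qed.

End Contraction.

End FixedPoint.

(** * Error propagation *)

Section GlobalError.
Variable R : realType.
Local Notation C := R[i].
Variables (T M : R).
Hypotheses (T0 : 0 < T) (M0 : 0 < M).

Let L := loc_cst M.
(** Growth rate of the energy inequality: 3 M from the symmetrised term, with 6 M bounding W in
    weighted l^1, and 12 from the cubic term. In [err_cst] the exponential is the Gronwall factor,
    and the + 1 makes the constant positive. *)
Let gr := 3 * M + 12.
Definition err_cst := 2 * L * T * expR (4 * gr * T) + 1.
(** All smallness conditions have the form B sqrt(tau) <= 1, and the sum of the B's dominates each:
    144 (M + 1) for the contraction, 4 [err_cst] + 2 L for the cubic term, 2 [gr] for absorbing the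
    new error, 1 for tau <= 1. *)
Definition tau_cst := (144 * (M + 1) + 4 * err_cst + 2 * L + 2 * gr + 1)^-1 ^+ 2.

Let L0 : 0 <= L.
Proof.
by rewrite /L /loc_cst !addr_ge0 // !mulr_ge0 ?addr_ge0 ?sqr_ge0 // ?mulr_ge0 // ?mulr_ge0 ?sqr_ge0 ?ltW.
Qed.

Let gr0 : 0 < gr. Proof. by rewrite /gr; have := M0; lra. Qed.

Lemma err_cst_gt0 : 0 < err_cst.
Proof.
rewrite /err_cst ltr_wpDl //; apply: mulr_ge0; last exact: expR_ge0.
by apply: mulr_ge0; [exact: mulr_ge0|exact: ltW].
Qed.

Let den0 : 0 < 144 * (M + 1) + 4 * err_cst + 2 * L + 2 * gr + 1.
Proof. by have := err_cst_gt0; move: M0 L0 gr0; lra. Qed.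

Lemma tau_cst_gt0 : 0 < tau_cst.
Proof. by rewrite /tau_cst exprn_gt0 // invr_gt0. Qed.

Variables (tau : R) (a : R -> int -> C).
Hypotheses (tau0 : 0 < tau) (tau_small : tau < tau_cst).
Hypothesis a5 : forall t, 0 <= t <= T -> hb 5 (a t) M.
Hypothesis a0 : forall t, 0 <= t <= T -> a t 0 = 0.
Hypothesis aconj : forall t k, 0 <= t <= T -> a t (- k) = conjc (a t k).
Hypothesis ader : forall t k, 0 <= t <= T ->
  cder 0 T (fun s => a s k) t (cv (psym t) (a t) (a t) k).

Let q := Num.sqrt tau.

Let q0 : 0 < q. Proof. by rewrite sqrtr_gt0. Qed.
Let qq : q ^+ 2 = tau. Proof. by rewrite sqr_sqrtr // ltW. Qed.

Let q_small : (144 * (M + 1) + 4 * err_cst + 2 * L + 2 * gr + 1) * q <= 1.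
Proof.
rewrite -(ler_pdivlMl _ _ den0) mulr1; apply: sqr_le_le; first by rewrite invr_ge0 ltW.
by rewrite qq ltW.
Qed.

Let small_le B : B <= 144 * (M + 1) + 4 * err_cst + 2 * L + 2 * gr + 1 -> B * q <= 1.
Proof. by move=> h; apply: le_trans q_small; rewrite ler_wpM2r // ltW. Qed.

Let q_le1 : q <= 1.
Proof.
by rewrite -[q]mul1r small_le //; have := err_cst_gt0; move: M0 L0 gr0; lra.
Qed.

Let tau_le1 : tau <= 1.
Proof. by rewrite -qq exprn_ile1 // ltW. Qed.

Lemma err_cst_le1 : err_cst * tau ^+ 2 <= 1.
Proof.
apply: (@le_trans _ _ (err_cst * q)).
  rewrite ler_wpM2l ?(ltW err_cst_gt0) // -qq -exprM.
  by rewrite exprS ler_piMr ?(ltW q0) // exprn_ile1 // ltW.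
by apply: small_le; have := err_cst_gt0; move: M0 L0 gr0; lra.
Qed.

Lemma contraction_small : 144 * (Num.sqrt tau * (M + 1)) <= 1.
Proof.
rewrite [_ * (M + 1)]mulrC mulrA; apply: small_le.
by have := err_cst_gt0; move: M0 L0 gr0; lra.
Qed.

(* eps and eps' bound the errors before and after a step.  The first inequality on
   eps' comes from the contraction and makes the cubic term of the second, the
   energy inequality, negligible. *)
Let step_error (eps eps' : R) : 0 <= eps -> 0 <= eps' -> eps <= err_cst * tau ^+ 2 ->
  eps' <= eps + (eps + eps') / 2 + L * tau ^+ 3 ->
  eps' ^+ 2 - eps ^+ 2 <= (tau / 2 * (6 * M) + 12 * q * (eps + eps')) * (eps + eps') ^+ 2
    + L * tau ^+ 3 * (eps + eps') ->
  eps' <= (1 + 4 * gr * tau) * eps + 2 * L * tau ^+ 3.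
Proof.
move=> e0 e0' ec ap en; have E0 := err_cst_gt0; have t0 := ltW tau0; have l0' := L0; have m0 := M0; have g0 := gr0; have q0' := q0.
have [S0|Sn0] := eqVneq (eps + eps') 0.
  have -> : eps' = 0 by lra.
  have -> : eps = 0 by lra.
  by rewrite mulr0 add0r; apply: mulr_ge0; [exact: mulr_ge0|exact: exprn_ge0].
have Sp : 0 < eps + eps' by rewrite lt_def Sn0 addr_ge0.
set S := eps + eps' in Sp ap en *.
have t3 : tau ^+ 3 <= tau ^+ 2 by rewrite exprS ler_piMl ?exprn_ge0.
(* Solving the first inequality for eps' gives eps' <= 3 eps + 2 L tau^3, hence S <= 4 eps + 2 L
   tau^3. *)
have S1 : S <= (4 * err_cst + 2 * L) * tau ^+ 2.
  have := ler_wpM2l L0 t3; rewrite /S in ap *; lra.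
have Sq : S <= q.
  apply: le_trans S1 _; rewrite -qq -exprM.
  have -> : (4 * err_cst + 2 * L) * q ^+ (2 * 2) = ((4 * err_cst + 2 * L) * q) * q ^+ 3 by ring.
  have h1 : (4 * err_cst + 2 * L) * q <= 1 by apply: small_le; move: M0 L0 gr0 E0; lra.
  have h2 : q ^+ 3 <= q by rewrite exprS ler_piMr ?(ltW q0) // exprn_ile1 // ltW.
  apply: le_trans (_ : 1 * q ^+ 3 <= _); last by rewrite mul1r.
  by rewrite ler_wpM2r // exprn_ge0 // ltW.
have en2 : (eps' - eps) * S <= (gr * tau * S + L * tau ^+ 3) * S.
  have -> : (eps' - eps) * S = eps' ^+ 2 - eps ^+ 2 by rewrite /S; ring.
  apply: le_trans en _.
  (* Here S <= q turns the cubic term into a quadratic one of size 12 tau. *)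
  have h1 : q * S <= tau by rewrite -qq expr2 ler_wpM2l // ltW.
  have := ler_wpM2r (sqr_ge0 S) h1; rewrite /gr; lra.
rewrite ler_pM2r // in en2.
have x1 : gr * tau <= 2^-1.
  have h : (2 * gr) * q <= 1 by apply: small_le; move: M0 L0 gr0 E0; lra.
  have h2 : gr * tau <= gr * q by rewrite ler_wpM2l ?(ltW gr0) // -qq expr2 ler_piMl // ltW.
  lra.
have x0 : 0 <= gr * tau by rewrite mulr_ge0 // ltW.
rewrite -mulrA; set x := gr * tau in x0 x1 en2 *.
set l := L * tau ^+ 3 in en2 *; rewrite -[2 * L * _]mulrA -/l.
have l0 : 0 <= l by rewrite mulr_ge0 // exprn_ge0.
rewrite /S in en2.
have h3 : eps' * (1 - x) <= (1 + x) * eps + l by lra.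
(* Dividing by 1 - x: (1 + 4 x) (1 - x) - (1 + x) = 2 x (1 - 2 x) and 2 (1 - x) - 1 = 1 - 2 x, both
   nonnegative as x <= 1/2. *)
have h4 : (1 + x) * eps + l <= ((1 + 4 * x) * eps + 2 * l) * (1 - x).
  have y0 : 0 <= 1 - 2 * x by lra.
  have := mulr_ge0 (mulr_ge0 x0 e0) y0; have := mulr_ge0 l0 y0.
  lra.
have x2 : 0 < 1 - x by lra.
by rewrite -(ler_pM2r x2); apply: le_trans h3 h4.
Qed.

Variable vn : nat -> int -> C.
Hypothesis vn0 : forall k, vn 0%N k = a 0 k.

Let tn n : R := n%:R * tau.
Let er n k := vn n k - a (tn n) k.
(** An explicit supersolution of the recursion in [step_error]: the factor n (1 + 4 gr tau)^n
    dominates the geometric sum and avoids dividing by the rate. *)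
Let epsn n := 2 * L * tau ^+ 3 * n%:R * (1 + 4 * gr * tau) ^+ n.

Let epsn_le n : tn n <= T -> epsn n <= err_cst * tau ^+ 2.
Proof.
move=> nT; rewrite /epsn; have t0 := ltW tau0; have g0 := ltW gr0.
have h1 : (1 + 4 * gr * tau) ^+ n <= expR (4 * gr * T).
  apply: (@le_trans _ _ (expR (4 * gr * tau) ^+ n)).
    apply: lerXn2r; rewrite ?nnegrE ?expR_ge0 ?expR_ge1Dx //.
    by rewrite addr_ge0 // !mulr_ge0.
  rewrite -expRM_natl ler_expR mulrCA ler_wpM2l //; exact: mulr_ge0.
have h2 : tn n * (1 + 4 * gr * tau) ^+ n <= T * expR (4 * gr * T).
  by apply: ler_pM => //; rewrite ?exprn_ge0 ?addr_ge0 // !mulr_ge0.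
have h3 : 0 <= 2 * L * tau ^+ 2 by rewrite !mulr_ge0 ?exprn_ge0.
have h4 := ler_wpM2l h3 h2.
have h5 : 0 <= tau ^+ 2 by exact: exprn_ge0.
have -> : 2 * L * tau ^+ 3 * n%:R * (1 + 4 * gr * tau) ^+ n =
  2 * L * tau ^+ 2 * (tn n * (1 + 4 * gr * tau) ^+ n) by rewrite /tn; ring.
apply: le_trans h4 _; rewrite /err_cst; lra.
Qed.

Let epsnS n : (1 + 4 * gr * tau) * epsn n + 2 * L * tau ^+ 3 <= epsn n.+1.
Proof.
have t0 := ltW tau0; have g0 := ltW gr0.
have l0 : 0 <= 2 * L * tau ^+ 3 by rewrite !mulr_ge0 ?exprn_ge0.
have y1 : 1 <= (1 + 4 * gr * tau) ^+ n.+1.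
  by rewrite exprn_ege1 // lerDl !mulr_ge0.
rewrite /epsn -[n.+1%:R]natr1 exprS in y1 *.
have := ler_wpM2l l0 y1; lra.
Qed.

Let epsn_ge0 n : 0 <= epsn n.
Proof.
have t0 := ltW tau0; have g0 := ltW gr0.
by apply: mulr_ge0; [rewrite !mulr_ge0 ?exprn_ge0|rewrite exprn_ge0 // addr_ge0 // !mulr_ge0].
Qed.

Let er_le N : tn N <= T -> (forall n k, (n <= N)%N -> vn n (- k) = conjc (vn n k)) ->
  (forall n, (n <= N)%N -> vn n 0 = 0) ->
  (forall n, (n < N)%N ->
    hcvg (fun m => iter m (psi (tn n) tau (vn n)) (vn n)) (vn n.+1)) ->
  forall n, (n <= N)%N -> hb 1 (er n) (epsn n).
Proof.
move=> NT vconj v0 steps; have t0 := ltW tau0; have m0 := M0; have q0' := q0.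
have tnT n : (n <= N)%N -> 0 <= tn n <= T.
  move=> nN; rewrite mulr_ge0 //=; apply: le_trans NT.
  by rewrite ler_wpM2r // ler_nat.
elim=> [_|n IH nN].
  have z : hb 1 (fun=> 0 : C) 0.
    by split=> // s us; rewrite big1 // => k _; rewrite /wn normc0 mulr0 expr0n.
  by apply: hb_mono z => // k; rewrite /er vn0 /tn mul0r subrr.
have {}IH := IH (ltnW nN).
have tI := tnT n (ltnW nN); have tI' := tnT n.+1 nN.
have tnS : tn n.+1 = tn n + tau by rewrite /tn -natr1 mulrDl mul1r.
have en_le : epsn n <= err_cst * tau ^+ 2 by apply: epsn_le; case/andP: tI.
have ec1 := err_cst_le1.
have ha : hb 1 (a (tn n)) M by apply: hb_ler (a5 tI).
have ha' : hb 1 (a (tn n.+1)) M by apply: hb_ler (a5 tI').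
have hv : hb 1 (vn n) (M + 1).
  apply: hb_mono (hbD ha IH) => [k|]; last by lra.
  by rewrite /er addrC subrK.
have smallA := contraction_small.
have [hv' fixv] := psi_fixed t0 hv smallA (steps n nN).
pose E k := er n.+1 k + er n k.
pose W k := a (tn n) k + a (tn n.+1) k.
have hW : hb 1 W (M + M) by exact: hbD.
have hloc := @local_error R T M a a5 a0 ader (tn n) tau t0.
rewrite -tnS in hloc; have {hloc} := hloc _ _.
case/andP: (tI) => tn0 _; case/andP: (tI') => _ tnT'.
move=> /(_ tn0 tnT'); rewrite -/L; set loc := fun k => _ => hloc.
have VE : (fun j => vn n.+1 j + vn n j) = (fun j => W j + E j).
  by apply/funext => j; rewrite /W /E /er; ring.
have inc k : er n.+1 k - er n k = cv (ksym (tn n) tau) (fun k => W k + E k) (fun k => W k + E k) k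
    - cv (ksym (tn n) tau) W W k - loc k.
  by rewrite -VE /er {1}fixv /psi /loc /W; ring.
have he0 : hb 1 (er n.+1) (2 * (M + 1) + M) by exact: hbB.
have he := ip_hb IH; have he' := ip_hb he0.
(* The exact norms are needed: the energy inequality concerns a difference of squares, where an
   upper bound such as [epsn n] cannot be substituted. *)
set eps := Num.sqrt (ip (er n) (er n)) in he.
set eps' := Num.sqrt (ip (er n.+1) (er n.+1)) in he'.
have eps0 : 0 <= eps by exact: sqrtr_ge0.
have eps0' : 0 <= eps' by exact: sqrtr_ge0.
have eps2 : eps ^+ 2 = ip (er n) (er n) by rewrite sqr_sqrtr // (ip_ge0 IH).
have eps2' : eps' ^+ 2 = ip (er n.+1) (er n.+1) by rewrite sqr_sqrtr // (ip_ge0 he0).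
have hE : hb 1 E (eps + eps') by rewrite addrC; exact: hbD.
have eps_le : eps <= epsn n.
  by apply: sqr_le_le; rewrite ?eps2 ?(ip_leP IH IH) //; exact: epsn_ge0.
have hV : hb 1 (fun j => W j + E j) (3 * (M + 1)).
  by rewrite -VE; apply: hb_leB (hbD hv' hv); lra.
suff h : eps' <= epsn n.+1 by exact: hb_leB h he'.
apply: le_trans (epsnS n).
apply: (@le_trans _ _ ((1 + 4 * gr * tau) * eps + 2 * L * tau ^+ 3)); last first.
  by rewrite lerD2r ler_wpM2l // addr_ge0 // !mulr_ge0 // ltW.
apply: step_error => //.
- exact: le_trans en_le.
(* The a priori bound: with V = W + E, Phi(V, V) - Phi(W, W) = Phi(E, V) + Phi(W, E). The norms 3 (M
   + 1) and 2 M give at most 60 sqrt(tau) (M + 1), which is below 1/2. *)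
- have hd : hb 1 (fun k => er n.+1 k - er n k) ((eps + eps') / 2 + L * tau ^+ 3).
    have EV : E = fun j => W j + E j - W j by apply/funext => j; rewrite addrAC subrr add0r.
    apply: hb_mono (hbB (hbD (ksym_hb (tn n) t0 hE hV) (ksym_hb (tn n) t0 hW hE)) hloc) => [k|].
      apply: eq_le_bound; rewrite inc; congr (_ - _).
      rewrite cvBB; [|exact: bsym_ksym|exact: hb_fin hV|exact: hb_fin hW].
      by rewrite -EV.
    rewrite lerD2r; have := ler_wpM2r (addr_ge0 eps0 eps0') smallA.
    have := mulr_ge0 (ltW q0) (addr_ge0 eps0 eps0'); rewrite -/q; lra.
  have hf : hb 1 (er n.+1) (eps + ((eps + eps') / 2 + L * tau ^+ 3)).
    by apply: hb_mono (hbD he hd) => // k; rewrite addrC subrK.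
  apply: sqr_le_le; first by rewrite -addrA (hb_ge0 hf).
  by rewrite eps2' -addrA (ip_leP he0 hf).
- rewrite eps2 eps2' (ip_diff_sqr he' he) -[fun k => er n.+1 k + er n k]/E.
  have -> : (fun k => er n.+1 k - er n k) = fun k =>
    cv (ksym (tn n) tau) (fun k => W k + E k) (fun k => W k + E k) k
    - cv (ksym (tn n) tau) W W k - loc k by apply/funext.
  have E0 : E 0 = 0.
    by rewrite /E /er !v0 ?(ltnW nN) // !a0 // !subrr addr0.
  have Ec k : E (- k) = conjc (E k).
    by rewrite /E /er !vconj ?(ltnW nN) // !aconj // -!rmorphB -rmorphD.
  have W3 : sumB (wn 3 W) (6 * M).
    have h5 : hb 4 W (M + M) by apply: hb_ler (hbD (a5 tI) (a5 tI')).
    by apply: sumB_le (hb_l1 h5) => //; lra.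
  exact: energy_step t0 E0 Ec hE hW W3 hloc.
Qed.

Lemma numerical_error N : N%:R * tau <= T ->
  (forall n k, (n <= N)%N -> vn n (- k) = conjc (vn n k)) ->
  (forall n, (n <= N)%N -> vn n 0 = 0) ->
  (forall n, (n < N)%N ->
    hcvg (fun m => iter m (psi (n%:R * tau) tau (vn n)) (vn n)) (vn n.+1)) ->
  hb 1 (fun k => vn N k - a (N%:R * tau) k) (err_cst * tau ^+ 2).
Proof.
move=> NT vconj v0 steps.
by apply: hb_leB (er_le NT vconj v0 steps (leqnn N)); exact: epsn_le.
Qed.

End GlobalError.

(** * Fourier coefficients *)

Section Fourier.
Variable R : realType.
Local Notation C := R[i].
Local Notation mu := (@lebesgue_measure R).
Local Notation I := (`[0%R, 2 * pi]%classic : set R).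
Implicit Types (u v f g h G : R -> R) (c : int -> C) (A B e t : R).

Definition gi u := mu.-integrable I (EFin \o u).

Definition bm u := measurable_fun [set: R] u /\ exists B, forall x, `|u x| <= B.

Let mI : @measurable _ (measurableTypeR R) I. Proof. exact: measurable_itv. Qed.

Let pi2 : 0 < 2 * pi :> R. Proof. by rewrite mulr_gt0 // pi_gt0. Qed.

Let muI : mu I = (2 * pi)%:E.
Proof. by rewrite lebesgue_measure_itv /= lte_fin pi2 oppr0 adde0. Qed.

Lemma bounded_on_I u B : (forall x, `|u x| <= B) -> [bounded u x | x in I].
Proof.
move=> uB; exists B; split; first exact: num_real.
by move=> y By x _ /=; apply: le_trans (uB x) (ltW By).
Qed.

Lemma bm_gi u : bm u -> gi u.
Proof.
move=> [mu_ [B uB]]; apply: measurable_bounded_integrable => //.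
- by rewrite [ltLHS](_ : _ = (2 * pi)%:E) ?ltry //; exact: muI.
- exact: measurable_funTS.
- exact: bounded_on_I uB.
Qed.

Lemma gi_mul u h : gi u -> bm h -> gi (fun x => u x * h x).
Proof.
move=> ui [mh [B hB]].
have := @integrableMl _ _ _ mu I mI _ h ui (measurable_funTS mh) (bounded_on_I hB).
exact.
Qed.

Lemma giD u v : gi u -> gi v -> gi (fun x => u x + v x).
Proof. by move=> ui vi; have := integrableD mI ui vi; exact. Qed.

Lemma giZ a u : gi u -> gi (fun x => a * u x).
Proof. by move=> ui; have := integrableZl mI a ui; exact. Qed.

Lemma giN u : gi u -> gi (fun x => - u x).
Proof. by move=> ui; have := integrableN ui; exact. Qed.

Lemma giB u v : gi u -> gi v -> gi (fun x => u x - v x).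
Proof. by move=> ui vi; apply: giD => //; exact: giN. Qed.

Lemma gi_sqr u : measurable_fun [set: R] u ->
  mu.-integrable I (fun x => ((u x) ^+ 2)%:E) -> gi u.
Proof.
move=> mu_ ui.
have b1 : bm (fun=> 1) by split; [exact: measurable_cst|exists 1 => x; rewrite normr1].
have i1 := giD (bm_gi b1) (ui : gi (fun x => u x ^+ 2)).
apply: le_integrable i1 => //.
  by apply/measurable_EFinP; exact: measurable_funTS.
move=> x _ /=; rewrite lee_fin [leRHS]ger0_norm; last by rewrite addr_ge0 ?sqr_ge0.
rewrite -[u x ^+ 2]real_normK ?num_real //; have := sqr_ge0 (`|u x| - 1); nra.
Qed.

Lemma bmD u v : bm u -> bm v -> bm (fun x => u x + v x).
Proof.
move=> [mu_ [A uA]] [mv [B vB]]; split; first exact: measurable_funD.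
by exists (A + B) => x; apply: le_trans (ler_normD _ _) _; exact: lerD.
Qed.

Lemma bmM u v : bm u -> bm v -> bm (fun x => u x * v x).
Proof.
move=> [mu_ [A uA]] [mv [B vB]]; split; first exact: measurable_funM.
by exists (A * B) => x; rewrite normrM; apply: ler_pM.
Qed.

Lemma bm_cst a : bm (fun=> a).
Proof. by split; [exact: measurable_cst|exists `|a|]. Qed.

Lemma bmZ a u : bm u -> bm (fun x => a * u x).
Proof. by move=> bu; apply: bmM => //; exact: bm_cst. Qed.

Lemma bmB u v : bm u -> bm v -> bm (fun x => u x - v x).
Proof.
move=> bu bv; have := bmD bu (bmZ (-1) bv); congr bm.
by apply/funext => x; rewrite mulN1r.
Qed.

Lemma bm_sum (T : Type) (r : seq T) (F : T -> R -> R) :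
  (forall i, bm (F i)) -> bm (fun x => \sum_(i <- r) F i x).
Proof.
move=> bF; elim: r => [|i r IH].
  by rewrite (_ : (fun _ => _) = fun=> 0); [exact: bm_cst|apply/funext => x; rewrite big_nil].
rewrite (_ : (fun _ => _) = fun x => F i x + \sum_(j <- r) F j x); first exact: bmD.
by apply/funext => x; rewrite big_cons.
Qed.

Let cont_mulr a : continuous (fun x : R => a * x).
Proof. by move=> x; apply: cvgM; [exact: cvg_cst|exact: cvg_id]. Qed.

Let cont_cos a : continuous (fun x : R => cos (a * x)).
Proof.
move=> x; apply: (@continuous_comp _ _ _ (fun x => a * x) (@cos R)).
  exact: cont_mulr.
exact: continuous_cos.
Qed.

Let cont_sin a : continuous (fun x : R => sin (a * x)).
Proof.
move=> x; apply: (@continuous_comp _ _ _ (fun x => a * x) (@sin R)).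
  exact: cont_mulr.
exact: continuous_sin.
Qed.

Lemma bm_cos a : bm (fun x => cos (a * x)).
Proof.
by split; [exact: continuous_measurable_fun|exists 1 => x; exact: cos_max].
Qed.

Lemma bm_sin a : bm (fun x => sin (a * x)).
Proof.
by split; [exact: continuous_measurable_fun|exists 1 => x; exact: sin_max].
Qed.

Definition avg f : R := (2 * pi)^-1 * \int[mu]_(x in `[0%R, 2 * pi]) f x.

Lemma eq_avg f g : f =1 g -> avg f = avg g.
Proof. by move=> /funext ->. Qed.

Lemma avgD f g : gi f -> gi g -> avg (fun x => f x + g x) = avg f + avg g.
Proof. by move=> fi gi_; rewrite /avg RintegralD // mulrDr. Qed.

Lemma avgB f g : gi f -> gi g -> avg (fun x => f x - g x) = avg f - avg g.
Proof. by move=> fi gi_; rewrite /avg RintegralB // mulrBr. Qed.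

Lemma avgZ a f : gi f -> avg (fun x => a * f x) = a * avg f.
Proof. by move=> fi; rewrite /avg RintegralZl // mulrCA. Qed.

Lemma avg_le f e : gi f -> (forall x, `|f x| <= e) -> `|avg f| <= e.
Proof.
move=> fi fe; rewrite /avg normrM ger0_norm ?invr_ge0 ?(ltW pi2) // ler_pdivrMl //.
apply: le_trans (le_normr_Rintegral mI fi) _.
have ei : gi (fun=> e) by exact: bm_gi (bm_cst e).
apply: le_trans (le_Rintegral mI _ ei (fun x _ => fe x)) _.
  by have := integrable_norm fi; exact.
rewrite Rintegral_cst // [X in fine X](_ : _ = (2 * pi)%:E); last exact: muI.
by rewrite mulrC.
Qed.

Lemma fcoefE u k : fcoef u k = avg (fun x => u x * cos (k%:~R * x)) -i* avg (fun x => u x * sin (k%:~R * x)).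
Proof. by []. Qed.

Lemma gi_cos u (k : int) : gi u -> gi (fun x => u x * cos (k%:~R * x)).
Proof. by move=> ui; apply: gi_mul => //; exact: bm_cos. Qed.

Lemma gi_sin u (k : int) : gi u -> gi (fun x => u x * sin (k%:~R * x)).
Proof. by move=> ui; apply: gi_mul => //; exact: bm_sin. Qed.

Lemma fcoefD u v k : gi u -> gi v -> fcoef (fun x => u x + v x) k = fcoef u k + fcoef v k.
Proof.
move=> ui vi; rewrite !fcoefE; simpc; rewrite -opprD.
rewrite -(avgD (gi_cos k ui) (gi_cos k vi)) -(avgD (gi_sin k ui) (gi_sin k vi)).
by congr (_ -i* _); apply: eq_avg => x; rewrite mulrDl.
Qed.

Lemma fcoefZ a u k : gi u -> fcoef (fun x => a * u x) k = a%:C * fcoef u k.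
Proof.
move=> ui; rewrite !fcoefE; simpc; rewrite -(avgZ a (gi_cos k ui)) -(avgZ a (gi_sin k ui)).
by congr (_ -i* _); apply: eq_avg => x; rewrite mulrA.
Qed.

Lemma fcoefB u v k : gi u -> gi v -> fcoef (fun x => u x - v x) k = fcoef u k - fcoef v k.
Proof.
move=> ui vi; have -> : (fun x => u x - v x) = fun x => u x + (-1) * v x.
  by apply/funext => x; rewrite mulN1r.
rewrite fcoefD //; last exact: giZ.
by rewrite fcoefZ // rmorphN mulN1r.
Qed.

Lemma fcoef_sum (T : Type) (r : seq T) (F : T -> R -> R) k :
  (forall i, bm (F i)) ->
  fcoef (fun x => \sum_(i <- r) F i x) k = \sum_(i <- r) fcoef (F i) k.
Proof.
move=> bF; elim: r => [|i r IH].
  rewrite big_nil (_ : (fun _ => _) = fun x => 0 * (0 : R)); last first.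
    by apply/funext => x; rewrite big_nil mul0r.
  by rewrite (fcoefZ 0 k (bm_gi (bm_cst 0))) mul0r.
rewrite big_cons -IH -fcoefD; [|exact: bm_gi|exact/bm_gi/bm_sum].
by congr (fcoef _ k); apply/funext => x; rewrite big_cons.
Qed.

Lemma fcoef_le u e k : gi u -> (forall x, `|u x| <= e) -> normc (fcoef u k) <= 2 * e.
Proof.
move=> ui ue; apply: le_trans (normc_leD _) _; rewrite fcoefE /= normrN.
rewrite mulr_natl mulr2n lerD //; apply: avg_le; do ?[exact: gi_cos|exact: gi_sin] => x;
  by rewrite normrM (le_trans _ (ue x)) // ler_piMr ?cos_max ?sin_max.
Qed.

Lemma fcoef_conj u k : gi u -> fcoef u (- k) = conjc (fcoef u k).
Proof.
move=> ui; rewrite !fcoefE /=; congr Complex.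
  by apply: eq_avg => x; rewrite rmorphN mulNr cosN.
rewrite opprK -[RHS](mul1r) -[X in X * _](opprK 1) mulNr -(avgZ (-1) (gi_sin k ui)).
by congr (- _); apply: eq_avg => x; rewrite rmorphN mulNr sinN mulrN mulN1r.
Qed.

(** A real mode shifts the spectrum of G both ways, by the product formulas for sine and cosine. The
    two halves recombine once j and -j are summed together. *)
Lemma fcoef_modul G (z : C) (j k : int) : gi G ->
  fcoef (fun x => G x * complex.Re (z * cis (j%:~R * x))) k =
  (2^-1)%:C * (z * fcoef G (k - j) + conjc z * fcoef G (k + j)).
Proof.
move=> iG; case: z => a b.
have icc := gi_mul (gi_cos k iG) (bm_cos j%:~R).
have ics := gi_mul (gi_cos k iG) (bm_sin j%:~R).
have isc := gi_mul (gi_sin k iG) (bm_cos j%:~R).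
have iss := gi_mul (gi_sin k iG) (bm_sin j%:~R).
rewrite !fcoefE.
have -> : avg (fun x => G x * complex.Re ((a +i* b) * cis (j%:~R * x)) * cos (k%:~R * x)) =
  a * avg (fun x => G x * cos (k%:~R * x) * cos (j%:~R * x))
  - b * avg (fun x => G x * cos (k%:~R * x) * sin (j%:~R * x)).
  rewrite -!avgZ // -avgB; [|exact: giZ|exact: giZ].
  by apply: eq_avg => x /=; ring.
have -> : avg (fun x => G x * complex.Re ((a +i* b) * cis (j%:~R * x)) * sin (k%:~R * x)) =
  a * avg (fun x => G x * sin (k%:~R * x) * cos (j%:~R * x))
  - b * avg (fun x => G x * sin (k%:~R * x) * sin (j%:~R * x)).
  rewrite -!avgZ // -avgB; [|exact: giZ|exact: giZ].
  by apply: eq_avg => x /=; ring.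
have -> : avg (fun x => G x * cos ((k - j)%:~R * x)) =
  avg (fun x => G x * cos (k%:~R * x) * cos (j%:~R * x)) +
  avg (fun x => G x * sin (k%:~R * x) * sin (j%:~R * x)).
  by rewrite -avgD //; apply: eq_avg => x; rewrite rmorphB mulrBl cosB; ring.
have -> : avg (fun x => G x * cos ((k + j)%:~R * x)) =
  avg (fun x => G x * cos (k%:~R * x) * cos (j%:~R * x)) -
  avg (fun x => G x * sin (k%:~R * x) * sin (j%:~R * x)).
  by rewrite -avgB //; apply: eq_avg => x; rewrite rmorphD mulrDl cosD; ring.
have -> : avg (fun x => G x * sin ((k - j)%:~R * x)) =
  avg (fun x => G x * sin (k%:~R * x) * cos (j%:~R * x)) -
  avg (fun x => G x * cos (k%:~R * x) * sin (j%:~R * x)).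
  by rewrite -avgB //; apply: eq_avg => x; rewrite rmorphB mulrBl sinB; ring.
have -> : avg (fun x => G x * sin ((k + j)%:~R * x)) =
  avg (fun x => G x * sin (k%:~R * x) * cos (j%:~R * x)) +
  avg (fun x => G x * cos (k%:~R * x) * sin (j%:~R * x)).
  by rewrite -avgD //; apply: eq_avg => x; rewrite rmorphD mulrDl sinD; ring.
by apply/eqP; rewrite eq_complex /=; apply/andP; split; apply/eqP; field.
Qed.

Let cos_int (k : int) : cos (k%:~R * (2 * pi)) = 1 :> R.
Proof.
have nat_case (n : nat) : cos (n%:R * (2 * pi)) = 1 :> R.
  elim: n => [|n IH]; first by rewrite mul0r cos0.
  by rewrite -natr1 mulrDl mul1r [X in _ + X]mulr_natl cosD2pi.
case: k => n; first by rewrite -pmulrn.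
by rewrite NegzE rmorphN mulNr cosN; exact: nat_case.
Qed.

Let sin_int (k : int) : sin (k%:~R * (2 * pi)) = 0 :> R.
Proof.
have nat_case (n : nat) : sin (n%:R * (2 * pi)) = 0 :> R.
  elim: n => [|n IH]; first by rewrite mul0r sin0.
  by rewrite -natr1 mulrDl mul1r [X in _ + X]mulr_natl sinD2pi.
case: k => n; first by rewrite -pmulrn.
by rewrite NegzE rmorphN mulNr sinN -[RHS]oppr0; congr (- _); exact: nat_case.
Qed.

Let avg_der (F f : R -> R) : continuous f -> (forall x : R, is_derive x 1 F (f x)) ->
  avg f = (2 * pi)^-1 * (F (2 * pi) - F 0).
Proof.
move=> cf Ff; congr (_ * _).
have dF (x : R) : derivable F x 1 by case: (Ff x).
have cF (x : R) : {for x, continuous F}.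
  by apply: differentiable_continuous; apply/derivable1_diffP.
rewrite /Rintegral (@continuous_FTC2 _ f F 0 (2 * pi)) //.
- exact: continuous_subspaceT.
- by split => [x _||]; [exact: dF|exact: cvg_at_right_filter (cF _)|exact: cvg_at_left_filter (cF _)].
- by move=> x _; rewrite derive1E; case: (Ff x).
Qed.

Lemma fcoef1 k : fcoef (fun=> 1 : R) k = if k == 0 then 1 else 0.
Proof.
rewrite fcoefE; have [->|k0] := eqVneq k 0.
  have -> : avg (fun x => 1 * cos (0%:~R * x)) = 1.
    rewrite (@eq_avg _ (fun=> 1)) => [|x]; last by rewrite mul0r cos0 mulr1.
    rewrite /avg Rintegral_cst // [X in fine X](_ : _ = (2 * pi)%:E); last exact: muI.
    by rewrite mul1r mulVf // gt_eqF.
  have -> : avg (fun x => 1 * sin (0%:~R * x)) = 0.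
    rewrite (@eq_avg _ (fun=> 0)) => [|x]; last by rewrite mul0r sin0 mulr0.
    by rewrite /avg Rintegral_cst // mul0r mulr0.
  by rewrite oppr0.
have kR : k%:~R != 0 :> R by rewrite intr_eq0.
have dl (x : R) : is_derive x 1 (fun y : R => k%:~R * y) k%:~R.
  by have := is_deriveZ k%:~R (is_derive_id x 1); rewrite [_ *: 1]mulr1; exact.
have cc : continuous (fun x : R => 1 * cos (k%:~R * x)).
  move=> x; apply: cvgM; first exact: cvg_cst.
  exact: cont_cos.
have cs : continuous (fun x : R => 1 * sin (k%:~R * x)).
  move=> x; apply: cvgM; first exact: cvg_cst.
  exact: cont_sin.
have ds (x : R) : is_derive x 1 (fun y : R => k%:~R^-1 * sin (k%:~R * y)) (1 * cos (k%:~R * x)).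
  have h := is_derive1_comp (is_derive_sin (k%:~R * x)) (dl x).
  have -> : 1 * cos (k%:~R * x) = k%:~R^-1 *: (cos (k%:~R * x) * k%:~R).
    by rewrite -[RHS]/(_ * (_ * _)); field.
  exact: (is_deriveZ (k%:~R^-1) h).
have dc (x : R) : is_derive x 1 (fun y : R => - k%:~R^-1 * cos (k%:~R * y)) (1 * sin (k%:~R * x)).
  have h := is_derive1_comp (is_derive_cos (k%:~R * x)) (dl x).
  have -> : 1 * sin (k%:~R * x) = - k%:~R^-1 *: (- sin (k%:~R * x) * k%:~R).
    by rewrite -[RHS]/(_ * (_ * _)); field.
  exact: (is_deriveZ (- k%:~R^-1) h).
rewrite (avg_der cc ds) (avg_der cs dc).
by rewrite cos_int sin_int !mulr0 cos0 sin0 !mulr0 !subrr !mulr0 oppr0.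
Qed.

End Fourier.

(** * Fourier series and multipliers *)

Section Series.
Variable R : realType.
Local Notation C := R[i].
Implicit Types (u v f g G : R -> R) (c y : int -> C) (A B e t : R).

Definition fser c (x : R) : R := rsum (fun k => complex.Re (c k * cis (k%:~R * x))).

Lemma fmultE (a : int -> C) u : fmult a u = fser (fun k => a k * fcoef u k).
Proof.
apply/funext => x; rewrite /fmult /fser /rsum; congr (lim (_ @ \oo)).
by apply/funext => N; rewrite big_Zs Re_sum.
Qed.

Lemma fser_term c k (x : R) : `|complex.Re (c k * cis (k%:~R * x))| <= normc (c k).
Proof. by apply: le_trans (normc_Re _) _; rewrite normcM normc_cis mulr1. Qed.

Lemma fser_summ c (x : R) : summC c -> summ (fun k => complex.Re (c k * cis (k%:~R * x))).
Proof.
by apply: summ_le => k; rewrite [leRHS]ger0_norm ?normc_ge0 // fser_term.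
Qed.

Lemma fser_unif c : summC c -> forall e, 0 < e -> exists N, forall M (x : R), (N <= M)%N ->
  `|\sum_(k <- Zs M) complex.Re (c k * cis (k%:~R * x)) - fser c x| <= e.
Proof.
move=> sc e e0; have [N HN] := summ_tail sc e0; exists N => M x NM.
apply/ler_addgt0Pr => e' e0'; have [K HK] := rsum_net (fser_summ x sc) e0'.
set f := fun k => complex.Re _ in HK *.
have u := Zs_uniq (maxn K M).
have h1 := HK _ u (Zs_mono (leq_maxl K M)).
rewrite (big_subseq f u (Zs_uniq M) (Zs_mono (leq_maxr K M))) in h1.
set T := \sum_(k <- [seq k <- _ | _]) _ in h1.
have h2 : `|T| <= e.
  apply: le_trans (ler_norm_sum _ _ _) _.
  apply: le_trans (HN [seq k <- Zs (maxn K M) | k \notin Zs M] _ _).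
  - apply: ler_sum => k _; apply: le_trans (fser_term c k x) _.
    by rewrite ler_norm.
  - by rewrite filter_uniq.
  - move=> k; rewrite mem_filter => /andP[+ _]; apply: contra; exact: Zs_mono.
rewrite -/(fser c x) in h1; rewrite /fser -/f in h1 *.
set a := \sum_(k <- Zs M) f k in h1 *.
move: h1 h2; rewrite !ler_norml; lra.
Qed.

Lemma bm_term c k : bm (fun x : R => complex.Re (c k * cis (k%:~R * x))).
Proof.
have -> : (fun x : R => complex.Re (c k * cis (k%:~R * x))) =
    fun x => complex.Re (c k) * cos (k%:~R * x) - complex.Im (c k) * sin (k%:~R * x).
  by apply/funext => x; case: (c k).
by apply: bmB; apply: bmZ; [exact: bm_cos|exact: bm_sin].
Qed.

Lemma fser_bm c : summC c -> bm (fser c).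
Proof.
move=> sc; split.
  apply: (@measurable_fun_cvg _ R R setT (fun N (x : R) => \sum_(k <- Zs N) complex.Re (c k * cis (k%:~R * x))) (fser c)).
    by move=> N; case: (bm_sum (Zs N) (bm_term c)).
  by move=> x _; exact: rsum_cvg (fser_summ x sc).
exists (rsum (fun k => normc (c k))) => x.
apply: le_trans (ler_norm_rsum (fser_summ x sc)) _.
apply: rsum_le => //; first by move=> k; exact: fser_term.
by apply: summ_le (fser_summ x sc) => k; rewrite normr_id.
Qed.

Lemma fser_period c (x : R) : fser c (x + 2 * pi) = fser c x.
Proof.
apply: eq_rsum => k; congr (complex.Re (_ * _)); rewrite mulrDr cisD.
suff -> : cis (k%:~R * (2 * pi)) = 1 :> C by rewrite mulr1.
have nat_case (n : nat) : cis (n%:R * (2 * pi)) = 1 :> C.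
  elim: n => [|n IH]; first by rewrite mul0r cis0.
  rewrite -natr1 mulrDl mul1r cisD IH mul1r /cis mulr_natl cos2pi sin2pi //.
case: k => n; first exact: nat_case.
rewrite NegzE rmorphN mulNr -conj_cis.
have -> : cis (n.+1%:~R * (2 * pi)) = 1 :> C by exact: nat_case.
by rewrite conjc1.
Qed.

Definition herm c := forall k, c (- k) = conjc (c k).

Lemma big_Zs_opp (F : int -> C) N : \sum_(k <- Zs N) F (- k) = \sum_(k <- Zs N) F k.
Proof.
rewrite -(big_map -%R xpredT F); apply: perm_big; apply: uniq_perm; last first.
- move=> k; apply/mapP/idP => [[j jN ->]|kN].
    by rewrite mem_Zs abszN -mem_Zs.
  by exists (- k); rewrite ?opprK // mem_Zs abszN -mem_Zs.
- exact: Zs_uniq.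
- by rewrite map_inj_uniq ?Zs_uniq //; exact: oppr_inj.
Qed.

(** The partial sums of the series converge uniformly, so the formula for finite trigonometric sums
    passes to the limit inside the integral. *)
Lemma fcoef_mul_fser G c k : bm G -> summC c -> herm c ->
  fcoef (fun x => G x * fser c x) k = csum (fun j => c j * fcoef G (k - j)).
Proof.
move=> bG sc hc; have iG := bm_gi bG; case: (bG) => mG [B GB].
have B0 : 0 <= B by exact: le_trans (GB 0).
have sconv : summC (fun j => c j * fcoef G (k - j)).
  apply: summC_le (summZ (2 * B) sc) => j; rewrite normcM mulrC ler_wpM2r ?normc_ge0 //.
  exact: fcoef_le.
have bF := fser_bm sc.
apply/eqP; rewrite -subr_eq0; apply/eqP; apply: normc_eq0_le => e e0.
have e1 : 0 < e / 2 / (2 * B + 1) by rewrite !divr_gt0 // ltr_wpDl // mulr_ge0.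
have [N1 H1] := fser_unif sc e1.
have e2 : 0 < e / 2 by rewrite divr_gt0.
have [N2 H2] := csum_cvg sconv e2.
pose N := maxn N1 N2.
pose FN x := \sum_(j <- Zs N) complex.Re (c j * cis (j%:~R * x)).
have bFN : bm FN by exact: bm_sum (bm_term c).
have EN : fcoef (fun x => G x * FN x) k = \sum_(j <- Zs N) c j * fcoef G (k - j).
  have -> : (fun x => G x * FN x) =
      fun x => \sum_(j <- Zs N) G x * complex.Re (c j * cis (j%:~R * x)).
    by apply/funext => x; rewrite mulr_sumr.
  rewrite fcoef_sum; last by move=> j; apply: bmM => //; exact: bm_term.
  under eq_bigr do rewrite fcoef_modul // mulrDr.
  (* After j -> -j in the conjugate half, hermitian symmetry makes it equal to the direct half. *)
  rewrite big_split /= -(big_Zs_opp (fun j => (2^-1)%:C * (conjc (c j) * fcoef G (k + j)))).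
  rewrite -big_split /=; apply: eq_bigr => j _.
  by rewrite hc conjcK -mulrDl halfC mul1r.
have D1 : normc (fcoef (fun x => G x * fser c x) k - fcoef (fun x => G x * FN x) k) <= e / 2.
  rewrite -fcoefB; [|exact/bm_gi/bmM|exact/bm_gi/bmM].
  apply: le_trans (fcoef_le (e := B * (e / 2 / (2 * B + 1))) _ _ _) _.
  - by apply/bm_gi/bmB; exact: bmM.
  - move=> x; rewrite -mulrBr normrM distrC; apply: ler_pM => //.
    by apply: H1; rewrite leq_maxl.
  have -> : 2 * (B * (e / 2 / (2 * B + 1))) = (e / 2) * ((2 * B) / (2 * B + 1)) by ring.
  rewrite ler_piMr ?(ltW e2) // ler_pdivrMr ?ltr_wpDl ?mulr_ge0 //.
  by rewrite mul1r lerDl.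
have D2 := H2 N (leq_maxr _ _).
rewrite -(subrK (fcoef (fun x => G x * FN x) k) (fcoef (fun x => G x * fser c x) k)) -addrA.
apply: le_trans (le_normcD _ _) _.
by rewrite -EN in D2; apply: le_trans (lerD D1 D2) _; lra.
Qed.

(** The product formula with G = 1, whose coefficients form a Kronecker delta. *)
Lemma fser_coef c k : summC c -> herm c -> fcoef (fser c) k = c k.
Proof.
move=> sc hc.
have -> : fser c = fun x => 1 * fser c x by apply/funext => x; rewrite mul1r.
rewrite fcoef_mul_fser //; last exact: bm_cst.
rewrite (csum_fin (N := `|k|)) => [|j jk].
  rewrite (bigD1_seq k) ?Zs_uniq ?mem_Zs //= subrr fcoef1 eqxx mulr1.
  rewrite big1_seq ?addr0 // => j /andP[jk _].
  by rewrite fcoef1 subr_eq0 eq_sym (negPf jk) mulr0.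
rewrite fcoef1 subr_eq0; case: eqVneq => [kj|_]; last by rewrite mulr0.
by rewrite -kj mem_Zs leqnn in jk.
Qed.

Lemma fser_sqr_coef c k : summC c -> herm c ->
  fcoef (sqf (fser c)) k = csum (fun j => c j * c (k - j)).
Proof.
move=> sc hc.
have -> : sqf (fser c) = fun x => fser c x * fser c x by apply/funext => x; rewrite /sqf expr2.
rewrite fcoef_mul_fser //; last exact: fser_bm.
by apply: eq_csum => j; rewrite fser_coef.
Qed.

Lemma fser_sqr_bm c : summC c -> bm (sqf (fser c)).
Proof.
move=> sc; have -> : sqf (fser c) = fun x => fser c x * fser c x by apply/funext => x; rewrite /sqf expr2.
by apply: bmM; exact: fser_bm.
Qed.

Lemma herm_fcoef u : gi u -> herm (fcoef u).
Proof. by move=> iu k; exact: fcoef_conj. Qed.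

Lemma hermM c y : herm c -> herm y -> herm (fun k => c k * y k).
Proof. by move=> hc hy k; rewrite hc hy rmorphM. Qed.

Lemma herm_airy t : herm (fun k => cis (- (t * k%:~R ^+ 3))).
Proof. by move=> k; rewrite conj_cis rmorphN; congr cis; ring. Qed.

Lemma herm_dsym : herm (dsym R).
Proof.
move=> k; rewrite /dsym oppr_eq0; case: eqVneq => [_|k0]; first by rewrite conjc0.
rewrite conjc_inv; congr (_^-1); apply/eqP.
by rewrite eq_complex /= rmorphN !eqxx.
Qed.

Lemma herm_ik : herm (fun k => 0 +i* k%:~R).
Proof. by move=> k; apply/eqP; rewrite eq_complex /= rmorphN !eqxx. Qed.

Lemma summC_norm c y : (forall k, normc (c k) <= normc (y k)) -> summC y -> summC c.
Proof.
move=> cy sy; apply: summC_le sy => k; exact: cy.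
Qed.

Lemma fmult_coef (a : int -> C) u k : gi u -> herm a ->
  summC (fun k => a k * fcoef u k) -> fcoef (fmult a u) k = a k * fcoef u k.
Proof.
by move=> iu ha s; rewrite fmultE fser_coef //; apply: hermM => //; exact: herm_fcoef.
Qed.

Lemma fmult_bm (a : int -> C) u : summC (fun k => a k * fcoef u k) -> bm (fmult a u).
Proof. by move=> s; rewrite fmultE; exact: fser_bm. Qed.

(** The resonance identity k^3 - j^3 - (k - j)^3 = 3 k j (k - j). *)
Lemma th_factor t k j :
  cis (- (t * k%:~R ^+ 3)) * (cis (- (- t * j%:~R ^+ 3)) * cis (- (- t * (k - j)%:~R ^+ 3)))
  = th t k j :> C.
Proof. by rewrite /th -!cisD !rmorphM /= rmorphB; congr cis; ring. Qed.

Lemma th_hb r t y A : hb r.+1 y A -> hb r.+1 (cv (th t) y y) (12 * 2 ^+ r * A ^+ 2).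
Proof.
move=> hy; have := @cv_hb R (th t) y y r.+1 r 0 1 A A; rewrite addn0 => h.
apply: hb_leB (h _ _ hy hy); first by rewrite exprS; lra.
  exact: ler01.
by move=> k j; rewrite normc_th expr0 mulr1.
Qed.

(** * The twisted nonlinearity and the map of the scheme on Fourier coefficients *)

Section AirySquare.
Variables (r : nat) (t A : R) (u : R -> R).
Hypotheses (iu : gi u) (hu : hb r.+1 (fcoef u) A).

Let sair : summC (fun k => cis (- (- t * k%:~R ^+ 3)) * fcoef u k).
Proof.
by apply: summC_norm (hb_summ hu) => k; rewrite normcM normc_cis mul1r.
Qed.

Let sq := sqf (airy (- t) u).

Lemma airy_sqf_bm : bm sq.
Proof. by rewrite /sq /airy fmultE; exact: fser_sqr_bm. Qed.

Lemma airy_sqf_coef k :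
  cis (- (t * k%:~R ^+ 3)) * fcoef sq k = cv (th t) (fcoef u) (fcoef u) k.
Proof.
have fu : fin (fcoef u) by exact: hb_fin hu.
rewrite /sq /airy fmultE fser_sqr_coef //; last first.
  by apply: hermM; [exact: herm_airy|exact: herm_fcoef].
rewrite -csumZ; first by apply: eq_csum => j; rewrite -th_factor; ring.
apply: summC_norm (cv_summ0 k (@bsym_th R t) fu fu) => j.
by rewrite !normcM !normc_cis !mul1r.
Qed.

Lemma airy_sqf_hb : hb r.+1 (fcoef sq) (12 * 2 ^+ r * A ^+ 2).
Proof.
apply: hb_mono (th_hb t hu) => // k.
by rewrite -airy_sqf_coef normcM normc_cis mul1r.
Qed.

Lemma airy_airy_sqf_bm : bm (airy t sq).
Proof.
apply: fmult_bm; apply: summC_norm (hb_summ airy_sqf_hb) => k.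
by rewrite normcM normc_cis mul1r.
Qed.

Lemma airy_airy_sqf_coef k : fcoef (airy t sq) k = cv (th t) (fcoef u) (fcoef u) k.
Proof.
rewrite /airy fmult_coef; [exact: airy_sqf_coef|exact/bm_gi/airy_sqf_bm|exact: herm_airy|].
apply: summC_norm (hb_summ airy_sqf_hb) => j.
by rewrite normcM normc_cis mul1r.
Qed.

End AirySquare.

Section TkdvRhs.
Variables (t A : R) (u : R -> R).
Hypotheses (iu : gi u) (hu : hb 2 (fcoef u) A).

Let sq := sqf (airy (- t) u).

(** The second derivative in H^2 pays for absolute summability after one differentiation, so that
    the series defining [dx] converges. *)
Let sdx : summC (fun k => (0 +i* k%:~R) * fcoef sq k).
Proof.
have h1 := hb_l1 (airy_sqf_hb t iu hu).
apply: summC_le (sumB_summ _ h1) => k; last exact: wn_ge0.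
by rewrite normcM normc_i /wn expr1 ler_wpM2r ?normc_ge0 // abs_w.
Qed.

Let dx_coef k : fcoef (dx sq) k = (0 +i* k%:~R) * fcoef sq k.
Proof.
by apply: fmult_coef => //; [exact/bm_gi/(airy_sqf_bm t hu)|exact: herm_ik].
Qed.

Let sair : summC (fun k => cis (- (t * k%:~R ^+ 3)) * fcoef (dx sq) k).
Proof.
by apply: summC_norm sdx => k; rewrite normcM normc_cis mul1r dx_coef.
Qed.

Lemma tkdv_rhs_bm : bm (tkdv_rhs t u).
Proof. by apply: bmZ; exact: fmult_bm. Qed.

Lemma tkdv_rhs_coef k : fcoef (tkdv_rhs t u) k = cv (psym t) (fcoef u) (fcoef u) k.
Proof.
have fu : fin (fcoef u) by exact: hb_fin hu.
rewrite /tkdv_rhs fcoefZ; last exact/bm_gi/fmult_bm.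
rewrite /airy fmult_coef //; [|exact/bm_gi/fmult_bm|exact: herm_airy].
rewrite dx_coef [X in _ * X]mulrCA (airy_sqf_coef t iu hu) mulrA.
rewrite -csumZ; last exact: (cv_summ0 _ (@bsym_th R t) fu fu).
apply: eq_csum => j; rewrite /psym.
have -> : (2^-1)%:C * (0 +i* k%:~R) = 0 +i* (k%:~R / 2) :> C.
  by simpc; rewrite mulrC.
by ring.
Qed.

End TkdvRhs.

Section RmrMap.
Variables (tau t A B : R) (v w : R -> R).
Hypotheses (iv : gi v) (iw : gi w) (hv : hb 1 (fcoef v) A) (hw : hb 1 (fcoef w) B).

Let y k := fcoef w k + fcoef v k.

Let hy : hb 1 y (B + A). Proof. exact: hbD. Qed.

Let z k := dsym R k * y k.

Let hz : hb 1 z (B + A).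
Proof.
apply: hb_mono hy => // k; rewrite normcM ler_piMl ?normc_ge0 //; exact: normc_dsym.
Qed.

Let iy : gi (fun x => w x + v x). Proof. exact: giD. Qed.

Let d := dx_inv (fun x => w x + v x).

Let ycoef : fcoef (fun x => w x + v x) = y.
Proof. by apply/funext => k; rewrite fcoefD. Qed.

Let sz : summC z. Proof. exact: hb_summ hz. Qed.

Let dbm : bm d.
Proof. by apply: fmult_bm; rewrite ycoef. Qed.

Let dcoef : fcoef d = z.
Proof.
apply/funext => k; rewrite /d /dx_inv fmult_coef ?ycoef //; exact: herm_dsym.
Qed.

Let hd : hb 1 (fcoef d) (B + A). Proof. by rewrite dcoef. Qed.

Lemma rmr_map_gi : gi (rmr_map tau t v w).
Proof.
apply: giB; first apply: giD => //.
  by apply: giZ; exact/bm_gi/(airy_airy_sqf_bm (t + tau) (bm_gi dbm) hd).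
by apply: giZ; exact/bm_gi/(airy_airy_sqf_bm t (bm_gi dbm) hd).
Qed.

Lemma rmr_map_coef k : fcoef (rmr_map tau t v w) k = psi t tau (fcoef v) (fcoef w) k.
Proof.
pose f1 := airy (t + tau) (sqf (airy (- (t + tau)) d)).
pose f2 := airy t (sqf (airy (- t) d)).
have i1 : gi f1 := bm_gi (airy_airy_sqf_bm (t + tau) (bm_gi dbm) hd).
have i2 : gi f2 := bm_gi (airy_airy_sqf_bm t (bm_gi dbm) hd).
have c1 : fcoef f1 k = cv (th (t + tau)) z z k.
  by rewrite (airy_airy_sqf_coef _ (bm_gi dbm) hd) dcoef.
have c2 : fcoef f2 k = cv (th t) z z k.
  by rewrite (airy_airy_sqf_coef _ (bm_gi dbm) hd) dcoef.
have -> : rmr_map tau t v w = fun x => v x + 24^-1 * f1 x - 24^-1 * f2 x by [].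
clearbody f1 f2; have j1 := giZ 24^-1 i1; have j2 := giZ 24^-1 i2.
rewrite (fcoefB k (giD iv j1) j2) (fcoefD k iv j1) (fcoefZ _ k i1) (fcoefZ _ k i2) c1 c2.
rewrite -addrA; congr (_ + _).
rewrite -mulrBr -[fun j => fcoef w j + fcoef v j]/y.
have fz : fin z by exact: hb_fin hz.
rewrite -csumB; [|exact: (cv_summ0 _ (@bsym_th R _) fz fz)|exact: (cv_summ0 _ (@bsym_th R _) fz fz)].
rewrite -csumZ; last first.
  by apply: summCB; exact: (cv_summ0 _ (@bsym_th R _) fz fz).
by apply: eq_csum => j; rewrite /ksym /z; ring.
Qed.

End RmrMap.

(** The extended sum is a supremum over finite sets of frequencies, which is what [sumB] bounds one
    set at a time. *)
Lemma hnorm_le r u B : 0 <= B -> (hnorm r u <= B%:E)%E <-> hb r (fcoef u) B.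
Proof.
move=> B0.
have E k : japanese R k ^+ (2 * r) * sqnormc (fcoef u k) = wn r (fcoef u) k ^+ 2.
  by rewrite /wn exprMn -exprM mulnC sqnormcE.
have -> : (hnorm r u <= B%:E)%E =
    (\esum_(m in [set: int]) (wn r (fcoef u) m ^+ 2)%:E <= (B ^+ 2)%:E)%E.
  rewrite /hnorm (eq_esum (fun k _ => congr1 EFin (E k))).
  have -> : B%:E = sqrte ((B ^+ 2)%:E) by rewrite /= sqrtr_sqr ger0_norm.
  by rewrite lee_sqrt // lee_fin exprn_ge0.
split=> [h|[_ h]].
  split=> // s us; rewrite -lee_fin; apply: le_trans h.
  rewrite -sumEFin (fsbig_seq _ _ us); apply: ereal_sup_ubound.
  exists [set` s] => //; split => //; exact: finite_seq.
apply: ge_ereal_sup => _ [S [fS _] <-].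
rewrite fsbig_finite //= sumEFin lee_fin; apply: h; exact: finmap.fset_uniq.
Qed.

End Series.

(** * From functions to coefficient sequences *)

Section Bridge.
Variable R : realType.
Local Notation C := R[i].
Implicit Types (u v w : R -> R) (A B M T t tau e : R).

Lemma in_H_gi r u : in_H r u -> gi u.
Proof. by case=> _ mu2 iu2 _ _; exact: gi_sqr. Qed.

Lemma fcoef_mean u :
  fcoef u 0 = ((2 * pi)^-1 * \int[lebesgue_measure]_(x in `[0%R, 2 * pi]) u x)%:C.
Proof.
rewrite fcoefE (_ : (fun x => u x * cos _) = u); last first.
  by apply/funext => x; rewrite mul0r cos0 mulr1.
rewrite (_ : (fun x => u x * sin _) = fun=> 0 * 1); last first.
  by apply/funext => x; rewrite mul0r sin0 mulr0 mul0r.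
by rewrite (avgZ 0 (bm_gi (bm_cst 1))) mul0r oppr0.
Qed.

Lemma in_H_mean r u : in_H r u -> fcoef u 0 = 0.
Proof. by case=> _ _ _ u0 _; rewrite fcoef_mean u0 mulr0. Qed.

Lemma in_H_hb r u : in_H r u -> exists A, hb r (fcoef u) A.
Proof.
case=> _ _ _ _ hu.
have h0 : (0 <= hnorm r u)%E by exact: sqrte_ge0.
have hf : hnorm r u \is a fin_num by rewrite ge0_fin_numE.
exists (fine (hnorm r u)); apply/hnorm_le; first exact: fine_ge0.
by rewrite fineK.
Qed.

Lemma hnorm_cvgP (I : Type) (F : set_system I) (FF : Filter F) r (f : I -> R -> R) :
  (hnorm r (f i) @[i --> F] --> 0%E) <->
  (forall e, 0 < e -> \forall i \near F, hb r (fcoef (f i)) e).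
Proof.
have h0 i : (0 <= hnorm r (f i))%E by exact: sqrte_ge0.
split=> [/fine_cvgP[hf /cvgrPdist_le hc] e e0|H].
  have he := hc e e0; near=> i.
  have fi : hnorm r (f i) \is a fin_num by near: i.
  apply/hnorm_le; first exact: ltW.
  have : `|0 - fine (hnorm r (f i))| <= e by near: i.
  rewrite sub0r normrN ger0_norm ?fine_ge0 // => h.
  by rewrite -(fineK fi) lee_fin.
have fin e i : 0 < e -> hb r (fcoef (f i)) e -> (hnorm r (f i) <= e%:E)%E.
  by move=> e0 h; apply/hnorm_le => //; exact: ltW.
apply/fine_cvgP; split.
  have H1 := H 1 ltr01; near=> i.
  rewrite ge0_fin_numE //; apply: le_lt_trans (fin 1 i ltr01 _) (ltry 1).
  by near: i.
apply/cvgrPdist_le => e e0; have He := H e e0; near=> i.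
have hi : (hnorm r (f i) <= e%:E)%E by apply: fin => //; near: i.
have fi : hnorm r (f i) \is a fin_num by rewrite ge0_fin_numE // (le_lt_trans hi) ?ltry.
by rewrite sub0r normrN ger0_norm ?fine_ge0 //= -lee_fin fineK.
Unshelve. all: by end_near. Qed.

(** Each Fourier coefficient is bounded by the H^0 norm, so the L^2 limit holds coefficient by
    coefficient. The limit excludes s = t, where the increment is trivially zero. *)
Lemma tkdv_cder T u0 (v : R -> R -> R) t k : tkdv_solution T u0 v -> 0 <= t <= T ->
  cder 0 T (fun s => fcoef (v s) k) t (cv (psym t) (fcoef (v t)) (fcoef (v t)) k).
Proof.
move=> [_ vH vder] tT e e0.
have it s : 0 <= s <= T -> gi (v s) by move=> sT; apply/in_H_gi/vH; rewrite in_itv.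
have [A hA] : exists A, hb 5 (fcoef (v t)) A by apply/in_H_hb/vH; rewrite in_itv.
have hA2 : hb 2 (fcoef (v t)) A by exact: hb_ler hA.
have := vder t; rewrite in_itv => /(_ tT) /hnorm_cvgP /(_ e e0).
rewrite near_withinE => /nbhs_ballP[dl dl0 H].
have {}dl0 : 0 < dl by exact: dl0.
exists (dl / 2); first by rewrite divr_gt0.
set d := cv _ _ _ k.
move=> s sT sd; have [->|st] := eqVneq s t.
  by rewrite !subrr rmorph0 mul0r subr0 normc0 normr0 mulr0.
have bs : ball t dl s by rewrite /ball /= distrC; lra.
have sI : `[0, T]%classic s by rewrite /= in_itv.
have := hb_point k (H s bs st sI).
have i1 : gi (fun x => v s x - v t x) by apply: giB; exact: it.
rewrite fcoefB; [|exact: giZ|exact/bm_gi/(tkdv_rhs_bm t (it t tT) hA2)].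
rewrite fcoefZ // fcoefB ?(tkdv_rhs_coef t (it t tT) hA2); [|exact: it..].
rewrite -/d; set z := fcoef (v s) k - fcoef (v t) k => h.
have st0 : s - t != 0 by rewrite subr_eq0.
have -> : z - (s - t)%:C * d = (s - t)%:C * (((s - t)^-1)%:C * z - d).
  by rewrite mulrBr mulrA -rmorphM mulfV // mul1r.
by rewrite normcM normcR mulrC ler_wpM2r.
Qed.

Lemma rmr_iter tau t v A m : gi v -> hb 1 (fcoef v) A -> 0 <= tau ->
  [/\ gi (iter m (rmr_map tau t v) v),
      fcoef (iter m (rmr_map tau t v) v) = iter m (psi t tau (fcoef v)) (fcoef v) &
      exists B, hb 1 (fcoef (iter m (rmr_map tau t v) v)) B].
Proof.
move=> iv hv tau0; elim: m => [|m [im cm [B hB]]]; first by split=> //; exists A.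
have cS : fcoef (iter m.+1 (rmr_map tau t v) v) = iter m.+1 (psi t tau (fcoef v)) (fcoef v).
  by apply/funext => k; rewrite !iterS (rmr_map_coef tau t iv im hv hB) cm.
split=> //; first exact: (rmr_map_gi tau t iv im hv hB).
rewrite cS iterS -cm; have hs := hbD hB hv.
by eexists; exact: hbD hv (ksym_hb t tau0 hs hs).
Qed.

Lemma rmr_step_hcvg tau t v v' A : gi v -> hb 1 (fcoef v) A -> 0 <= tau -> gi v' ->
  (hnorm 1 (fun x => iter m (rmr_map tau t v) v x - v' x) @[m --> \oo] --> 0%E) <->
  hcvg (fun m => iter m (psi t tau (fcoef v)) (fcoef v)) (fcoef v').
Proof.
move=> iv hv tau0 iv'.
have E m : fcoef (fun x => iter m (rmr_map tau t v) v x - v' x) =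
    fun k => iter m (psi t tau (fcoef v)) (fcoef v) k - fcoef v' k.
  have [im <- _] := rmr_iter t m iv hv tau0.
  by apply/funext => k; rewrite fcoefB.
split=> [/hnorm_cvgP H e e0|H].
  by have [N _ HN] := H e e0; exists N => m Nm; rewrite -E; exact: HN.
apply/hnorm_cvgP => e e0; have [N HN] := H e e0.
by exists N => // m /= Nm; rewrite E; exact: HN.
Qed.

(** The phase is constant at output frequency 0, so the rule conserves the mean. *)
Lemma psi_zero t tau (x y : int -> C) : psi t tau x y 0 = x 0.
Proof.
rewrite /psi /cv (csum_fin (N := 0)) ?big1 ?addr0 // => k _;
  by rewrite /ksym /th !mul0r !mulr0 subrr mulr0 !mul0r.
Qed.

Lemma in_H1_fser (c : int -> C) A : hb 1 c A -> herm c -> c 0 = 0 -> in_H 1 (fser c).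
Proof.
move=> hc hec c0; have sc := hb_summ hc; have [mF _] := fser_bm sc.
have cE : fcoef (fser c) = c by apply/funext => k; rewrite fser_coef.
split=> //.
- exact: fser_period.
- exact: bm_gi (fser_sqr_bm sc).
- have /(congr1 (@complex.Re R)) := fcoef_mean (fser c); rewrite cE c0 /= => /esym/eqP.
  by rewrite mulf_eq0 invr_eq0 mulf_eq0 pnatr_eq0 (gt_eqF (pi_gt0 R)) /= => /eqP.
- apply: le_lt_trans (ltry A); apply/hnorm_le; first exact: hb_ge0 hc.
  by rewrite cE.
Qed.

(** The limit sequence z has to be the coefficients of a real zero-mean function. Hermitian symmetry
    is inherited from the iterates, which are real functions, and the zero mean comes from
    [psi_zero]; then [fser z] is the next iterate. *)
Lemma rmr_step_exists tau t v A : in_H 1 v -> 0 <= tau -> hb 1 (fcoef v) A ->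
  144 * (Num.sqrt tau * A) <= 1 -> exists v', rmr_step tau t v v'.
Proof.
move=> vH tau0 hv small; have iv := in_H_gi vH.
have [z hz] := psi_limit t tau0 hv small.
have [z1 zfix] := psi_fixed tau0 hv small hz.
have hez : herm z.
  move=> k; apply/eqP; rewrite -subr_eq0; apply/eqP; apply: normc_eq0_le => e e0.
  have [N HN] := hz (e / 2) (divr_gt0 e0 (ltr0n _ 2)).
  have [im cm _] := rmr_iter t N iv hv tau0.
  have hN := herm_fcoef im k; rewrite cm in hN.
  have h1 := hb_point (- k) (HN N (leqnn _)).
  have h2 := hb_point k (HN N (leqnn _)).
  rewrite hN in h1; rewrite -normc_conj rmorphB in h2.
  set a := conjc _ in h1 h2.
  have -> : z (- k) - conjc (z k) = (a - conjc (z k)) - (a - z (- k)) by ring.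
  apply: le_trans (le_normcD _ _) _; rewrite normcN.
  by apply: le_trans (lerD h2 h1) _; lra.
have z0 : z 0 = 0 by rewrite zfix psi_zero (in_H_mean vH).
have sz := hb_summ z1.
exists (fser z); split; first exact: in_H1_fser z1 hez z0.
apply/(rmr_step_hcvg t iv hv tau0 (bm_gi (fser_bm sz))).
have -> : fcoef (fser z) = z by apply/funext => k; rewrite fser_coef.
exact: hz.
Qed.

(** * Induction along the numerical solution *)

Section Main.
Variables (T M tau : R) (u0 : R -> R) (v : R -> R -> R).
Hypotheses (T0 : 0 < T) (M0 : 0 < M) (tau0 : 0 < tau) (tau_small : tau < tau_cst T M).
Hypothesis vsol : tkdv_solution T u0 v.
Hypothesis vM : forall t, 0 <= t <= T -> hb 5 (fcoef (v t)) M.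

Let vH t : 0 <= t <= T -> in_H 5 (v t).
Proof. by move=> tT; case: vsol => _ h _; apply: h; rewrite in_itv. Qed.

Lemma rmr_iterates_in_H n vn : n%:R * tau <= T -> rmr_iterates tau n%:Z u0 vn -> in_H 1 (vn n).
Proof.
case: n => [|n] nT [v0 vS]; last by case: (vS n); rewrite // ltz_nat.
have [p m s z _] := vH (introT andP (conj (lexx 0) (ltW T0))).
rewrite v0; have <- : v 0 = u0 by case: vsol.
split=> //; apply: le_lt_trans (ltry M); apply/hnorm_le; first exact: ltW.
by apply: hb_ler (vM _); rewrite // lexx ltW.
Qed.

Lemma rmr_iterates_le n m vn : (m <= n)%N -> rmr_iterates tau n%:Z u0 vn ->
  rmr_iterates tau m%:Z u0 vn.
Proof.
move=> mn [v0 vS]; split=> // i im; apply: vS; apply: lt_le_trans im _.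
by rewrite lez_nat.
Qed.

Let nT_le n m : (m <= n)%N -> n%:R * tau <= T -> m%:R * tau <= T.
Proof.
by move=> mn; apply: le_trans; rewrite ler_wpM2r ?ler_nat // ltW.
Qed.

(** The second conclusion follows from the first, as the error is at most 1. At earlier indices it
    feeds the passage from functions to coefficient sequences, and at n it provides the ball in
    which the next step contracts. *)
Lemma rmr_iterates_error n vn : n%:R * tau <= T -> rmr_iterates tau n%:Z u0 vn ->
  hb 1 (fun k => fcoef (vn n) k - fcoef (v (n%:R * tau)) k) (err_cst T M * tau ^+ 2) /\
  hb 1 (fcoef (vn n)) (M + 1).
Proof.
elim/ltn_ind: n => n IH nT it.
have vnH m : (m <= n)%N -> in_H 1 (vn m).
  by move=> mn; apply: rmr_iterates_in_H (nT_le mn nT) (rmr_iterates_le mn it).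
have tT : 0 <= n%:R * tau <= T by rewrite nT andbT mulr_ge0 // ltW.
suff h : hb 1 (fun k => fcoef (vn n) k - fcoef (v (n%:R * tau)) k) (err_cst T M * tau ^+ 2).
  split=> //; have hv : hb 1 (fcoef (v (n%:R * tau))) M by apply: hb_ler (vM tT).
  apply: hb_mono (hbD hv h) => [k|]; first by rewrite addrC subrK.
  by rewrite lerD2l; exact: (err_cst_le1 T0 M0 tau0 tau_small).
apply: (@numerical_error R T M T0 M0 tau (fun t => fcoef (v t)) tau0 tau_small vM
  _ _ _ (fun m => fcoef (vn m))) => //.
- by move=> t tT'; exact: in_H_mean (vH tT').
- by move=> t k tT'; apply: herm_fcoef; exact: in_H_gi (vH tT').
- by move=> t k tT'; exact: tkdv_cder vsol tT'.
- by move=> k; case: it => -> _; case: vsol => ->.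
- by move=> m k mn; apply: herm_fcoef; exact: in_H_gi (vnH m mn).
- by move=> m mn; exact: in_H_mean (vnH m mn).
- move=> m mn; have [_ hm] := IH m mn (nT_le (ltnW mn) nT) (rmr_iterates_le (ltnW mn) it).
  have [_ st] : rmr_step tau (m%:R * tau) (vn m) (vn m.+1) by case: it => _; apply.
  by move/(rmr_step_hcvg _ (in_H_gi (vnH m (ltnW mn))) hm (ltW tau0) (in_H_gi (vnH m.+1 mn))): st.
Qed.

(** Existence and error bound alternate: the iterates built so far satisfy the error bound, hence
    lie in the ball of radius M + 1 where [rmr_step_exists] applies. *)
Lemma rmr_iterates_exist n : n%:R * tau <= T -> exists vn, rmr_iterates tau n%:Z u0 vn.
Proof.
move=> nT.
(* A choice of next iterate; the default value x is never taken at the indices considered, since a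
   step exists there. *)
pose next m (x : R -> R) : R -> R :=
  xget x [set x' | rmr_step tau (m%:R * tau) x x'].
pose vn := fix vn m := if m is m'.+1 then next m' (vn m') else u0.
suff H m : (m <= n)%N -> rmr_iterates tau m%:Z u0 vn by exists vn; exact: H.
elim: m => [|m IH] mn; first by split.
have it := IH (ltnW mn); have mT := nT_le (ltnW mn) nT.
have [_ hm] := rmr_iterates_error mT it.
have [x' sx'] := rmr_step_exists (m%:R * tau) (rmr_iterates_in_H mT it) (ltW tau0) hm
  (contraction_small T0 M0 tau0 tau_small).
have sm : rmr_step tau (m%:R * tau) (vn m) (vn m.+1) by exact: (xgetPex (vn m) (ex_intro _ x' sx')).
split; first by [].
move=> i; rewrite ltz_nat ltnS leq_eqVlt => /predU1P[->|im]; first exact: sm.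
by case: it => _; apply; rewrite ltz_nat.
Qed.

End Main.

End Bridge.

Theorem theorem4p2 (R : realType) (T M : R) (T_gt0 : 0 < T) (M_gt0 : 0 < M) :
  exists tau_R c_RT : R, [/\ 0 < tau_R, 0 < c_RT &
    forall (tau : R) (u0 : R -> R) (v : R -> R -> R),
      0 < tau -> tau < tau_R ->
      tkdv_solution T u0 v ->
      (ereal_sup [set hnorm 5 (v t) | t in `[0%R, T]] < (M / 2)%:E)%E ->
      (exists vn : nat -> R -> R,
         rmr_iterates tau (Num.floor (T / tau)) u0 vn) /\
      (forall vn : nat -> R -> R,
         rmr_iterates tau (Num.floor (T / tau)) u0 vn ->
         forall n : nat, n%:Z <= Num.floor (T / tau) ->
           (hnorm 1 (fun x => v (n%:R * tau) x - vn n x)%R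
              <= (c_RT * tau ^+ 2)%:E)%E)].
Proof.
(* The section results are applied with radius [M / 2], so the numerical solution stays in the H^1
   ball of radius M / 2 + 1. *)
have M2 : 0 < M / 2 by rewrite divr_gt0.
exists (tau_cst T (M / 2)), (err_cst T (M / 2)); split.
- exact: tau_cst_gt0.
- exact: err_cst_gt0.
move=> tau u0 v tau0 tau_small vsol vsup.
have vM t : 0 <= t <= T -> hb 5 (fcoef (v t)) (M / 2).
  move=> tT; apply/hnorm_le; first exact: ltW.
  apply: le_trans (ltW vsup); apply: ereal_sup_ubound.
  by exists t => //=; rewrite in_itv.
have nT n : n%:Z <= Num.floor (T / tau) -> n%:R * tau <= T.
  move=> nN; rewrite -ler_pdivlMr //; by rewrite floor_ge_int in nN.
have [N EN] : exists N : nat, Num.floor (T / tau) = N%:Z.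
  exists `|Num.floor (T / tau)|%N; by rewrite gez0_abs // floor_ge0 divr_ge0 // ltW.
rewrite EN in nT; rewrite EN; split.
  exact: (rmr_iterates_exist T_gt0 M2 tau0 tau_small vsol vM (nT N (lexx _))).
move=> vn it n nN; have nN' : (n <= N)%N by rewrite lez_nat in nN.
have it' := rmr_iterates_le nN' it.
have tT : 0 <= n%:R * tau <= T by rewrite nT // mulr_ge0 // ltW.
have [h _] := rmr_iterates_error T_gt0 M2 tau0 tau_small vsol vM (nT n nN) it'.
apply/hnorm_le; first by rewrite mulr_ge0 ?exprn_ge0 ?(ltW (err_cst_gt0 _ _)) ?(ltW tau0).
apply: hb_mono h => // k; rewrite fcoefB ?[normc (fcoef (v _) k - _)]normcB //.
  by case: vsol => _ vH _; apply: in_H_gi (vH _ _); rewrite in_itv.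
exact: in_H_gi (rmr_iterates_in_H T_gt0 M2 vsol vM (nT n nN) it').
Qed.
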